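(* Let $n\ge 1$ and $k>0$. Let $\mathcal{D}^J_n$ denote the set $\mathbb{C}^n\times\mathcal{D}_n$ with points $(z,W)$, equipped with the $G^J_n$-invariant Kähler two-form $\omega_n$, and let $\mathcal{X}^J_n$ denote the set $\mathcal{X}_n\times\mathbb{C}^n$ with points $(v,u)$, equipped with the $G^J_n(\mathbb{R})_0$-invariant Kähler two-form $\omega'_n$ (all defined in the context). (i) The map $$FC:\mathbb{C}^n\times\mathcal{D}_n\to\mathcal{D}^J_n,\qquad FC(\eta,W)=(z,W),\quad z=\eta-W\bar\eta,$$ is a homogeneous Kähler diffeomorphism, with inverse given by $$FC^{-1}:\quad \eta=(\mathbb{I}_n-W\bar W)^{-1}(z+W\bar z),$$ and $FC^*\omega_n=\omega_{n,0}$, where $$-\mathrm{i}\,\omega_{n,0}=\tfrac{k}{2}\,\mathrm{Tr}(B\wedge\bar B)+\mathrm{Tr}(d\eta^t\wedge d\bar\eta),\qquad B=(\mathbb{I}_n-W\bar W)^{-1}dW.$$ The form $\omega_{n,0}$ is invariant under the $G^J_n$-action $(g,\alpha)\cdot(\eta,W)=(\eta_1,W_1)$ on $\mathbb{C}^n\times\mathcal{D}_n$ (the action induced through $FC$ from the action on $\mathcal{D}^J_n$), where $$W_1=(pW+q)(\bar qW+\bar p)^{-1},\qquad \eta_1=p(\eta+\alpha)+q(\bar\eta+\bar\alpha).$$ (ii) The map $$FC_1:(v,\eta)\mapsto(v,u),\qquad u=\tfrac{1}{2\mathrm{i}}\big[(v+\mathrm{i}\mathbb{I}_n)\eta-(v-\mathrm{i}\mathbb{I}_n)\bar\eta\big],$$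 is a homogeneous Kähler diffeomorphism from $\mathcal{X}_n\times\mathbb{C}^n$ onto $\mathcal{X}^J_n$, with inverse given by $$FC_1^{-1}:\quad \eta=(\bar v-\mathrm{i}\mathbb{I}_n)(\bar v-v)^{-1}u-(v-\mathrm{i}\mathbb{I}_n)(\bar v-v)^{-1}\bar u,$$ which, wherever $v-\mathrm{i}\mathbb{I}_n$ is invertible, equals $(\bar v-\mathrm{i}\mathbb{I}_n)(\bar v-v)^{-1}(v-\mathrm{i}\mathbb{I}_n)\big[(v-\mathrm{i}\mathbb{I}_n)^{-1}u-(\bar v-\mathrm{i}\mathbb{I}_n)^{-1}\bar u\big]$. Moreover $FC_1^*\omega'_n=\omega'_{n,0}$, where $$-\mathrm{i}\,\omega'_{n,0}=\tfrac{k}{2}\,\mathrm{Tr}(H\wedge\bar H)+\mathrm{Tr}(d\eta^t\wedge d\bar\eta),\qquad H=(\bar v-v)^{-1}dv.$$ The form $\omega'_{n,0}$ is invariant under the action of $G^J_n(\mathbb{R})_0$ on $\mathcal{X}_n\times\mathbb{C}^n$ given, for $g=\begin{pmatrix}a&b\\c&d\end{pmatrix}\in \mathrm{Sp}(n,\mathbb{R})$ and $\alpha\in\mathbb{C}^n$, by $(g,\alpha)\times(v,\eta)\mapsto(v_1,\eta_1)$, $$v_1=(av+b)(cv+d)^{-1},\qquad \eta_1=\tfrac12\,[a+d+\mathrm{i}(b-c)]\,(\eta+\alpha)+\tfrac12\,[a-d-\mathrm{i}(b+c)]\,(\bar\eta+\bar\alpha).$$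
   Context: $\mathbb{I}_n$ is the identity matrix, $A^t$ the transpose, $\bar A$ the entrywise complex conjugate, $A^*=\bar A^t$; vectors in $\mathbb{C}^n$ are columns. $\mathrm{Sp}(n,\mathbb{R})$ is the group of real $2n\times 2n$ matrices with $g^tJg=J$, $J=\begin{pmatrix}0&\mathbb{I}_n\\-\mathbb{I}_n&0\end{pmatrix}$. Siegel ball: $\mathcal{D}_n=\{W\in M(n,\mathbb{C}): W=W^t,\ \mathbb{I}_n-W\bar W>0\}$. Siegel upper half plane: $\mathcal{X}_n=\{v=s+\mathrm{i}r: s,r\in M(n,\mathbb{R}),\ s^t=s,\ r^t=r,\ r>0\}$. $\mathrm{Sp}(n,\mathbb{R})_{\mathbb{C}}=\mathrm{Sp}(n,\mathbb{C})\cap \mathrm{U}(n,n)$ is the group of matrices $\begin{pmatrix}p&q\\\bar q&\bar p\end{pmatrix}$, $p,q\in M(n,\mathbb{C})$, with $pp^*-qq^*=\mathbb{I}_n$, $pq^t=qp^t$, $p^*p-q^t\bar q=\mathbb{I}_n$, $p^t\bar q=q^*p$. Elements of the Jacobi group $G^J_n$ (the center acts trivially and is suppressed) are pairs $(g,\alpha)$, $g=\begin{pmatrix}p&q\\\bar q&\bar p\end{pmatrix}\in\mathrm{Sp}(n,\mathbb{R})_{\mathbb{C}}$, $\alpha\in\mathbb{C}^n$. $G^J_n$ acts on $\mathcal{D}^J_n$ by $(z,W)\mapsto(z_1,W_1)$, $W_1=(pW+q)(\bar qW+\bar p)^{-1}=(Wq^*+p^* )^{-1}(q^t+Wp^t)$,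 $z_1=(Wq^*+p^* )^{-1}(z+\alpha-W\bar\alpha)$. The Kähler form on $\mathcal{D}^J_n$ is $$-\mathrm{i}\,\omega_n=\tfrac{k}{2}\mathrm{Tr}(B\wedge\bar B)+\mathrm{Tr}(A^t\bar M\wedge\bar A),\quad M=(\mathbb{I}_n-W\bar W)^{-1},\ B=M\,dW,\ A=dz+dW\,\bar\eta,\ \eta=M(z+W\bar z).$$ The restricted real Jacobi group $G^J_n(\mathbb{R})_0$ consists of pairs $(g,l)$, $g=\begin{pmatrix}a&b\\c&d\end{pmatrix}\in\mathrm{Sp}(n,\mathbb{R})$, $l=(\mathsf n,\mathsf m)\in\mathbb{R}^{2n}$ with $\mathsf n,\mathsf m\in\mathbb{R}^n$. It is also written as pairs $(g,\alpha)$ with $\alpha=\mathsf m+\mathrm{i}\mathsf n\in\mathbb{C}^n$. It acts on $\mathcal{X}^J_n$ by $v_1=(av+b)(cv+d)^{-1}=(vc^t+d^t)^{-1}(va^t+b^t)$, $u_1=(vc^t+d^t)^{-1}(u+v\mathsf n+\mathsf m)$. The Kähler form on $\mathcal{X}^J_n$ is $$-\mathrm{i}\,\omega'_n=\tfrac{k}{2}\mathrm{Tr}(H\wedge\bar H)+\tfrac{2}{\mathrm{i}}\mathrm{Tr}(G^tD\wedge\bar G),\quad D=(\bar v-v)^{-1},\ H=D\,dv,\ G=du-dv\,D(\bar u-u).$$ A homogeneous Kähler diffeomorphism (transform) is a diffeomorphism $\phi:M\to N$ of homogeneous Kähler manifolds with $\phi^*\omega_N=\omega_M$ (not required to be holomorphic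 in the displayed coordinates). *)

(* Defs.v *)
From mathcomp Require Import all_boot all_order all_algebra.
From mathcomp Require Import complex.
From mathcomp Require Import all_classical all_reals all_analysis.
Set Implicit Arguments.
Unset Strict Implicit.
Unset Printing Implicit Defensive.
Import Order.TTheory GRing.Theory Num.Theory.
Import numFieldNormedType.Exports.
Local Open Scope classical_set_scope.
Local Open Scope ring_scope.

Section Smooth.
Variables (R : realType) (V W : normedModType R).

(* In finite dimension, f is C^k on the open set O iff all its iterated
   directional derivatives of order at most k exist and are continuous on O. *)
Fixpoint Ck (k : nat) (O : set V) (f : V -> W) : Prop :=
  (forall x, O x -> {for x, continuous f}) /\
  match k with
  | 0%N => True
  | k'.+1 => forall v : V,
      (forall x, O x -> derivable f x v) /\ Ck k' O (fun x => 'D_v f x)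
  end.

Definition smooth (O : set V) (f : V -> W) : Prop := forall k, Ck k O f.

(* Smoothness on an arbitrary subset: local extension to a smooth map on an
   open subset of the ambient space. *)
Definition smooth_on (A : set V) (f : V -> W) : Prop :=
  forall x, A x -> exists (O : set V) (g : V -> W),
    [/\ open O, O x, smooth O g & forall y, A y -> O y -> g y = f y].

End Smooth.

Section Maps.
Variables (R : realType) (V W : normedModType R).

Definition inverse_bijections (A : set V) (B : set W)
    (f : V -> W) (g : W -> V) : Prop :=
  [/\ forall x, A x -> B (f x), forall y, B y -> A (g y),
      forall x, A x -> g (f x) = x & forall y, B y -> f (g y) = y].

Definition diffeomorphism (A : set V) (B : set W) (f : V -> W) : Prop :=
  exists g : W -> V,
    [/\ inverse_bijections A B f g, smooth_on A f & smooth_on B g].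

(* A two-form assigns to a point and two tangent vectors a complex number; the
   forms below are real, as is required in [kahler]. *)
Definition pullback (f : V -> W) (w : W -> W -> W -> R[i])
    (x X Y : V) : R[i] := w (f x) ('D_X f x) ('D_Y f x).

(* Equality of two-forms on A, where T is the tangent space at every point. *)
Definition eq_form (A T : set V) (w w' : V -> V -> V -> R[i]) : Prop :=
  forall x X Y, A x -> T X -> T Y -> w x X Y = w' x X Y.

End Maps.

Section Kahler.
Variable R : realType.

Section Structures.
Variable V : normedModType R.
Implicit Types (A T : set V) (w : V -> V -> V -> R[i]) (J : V -> V -> V).

(* A is open in the linear subspace T, so that T is the tangent space of A at
   each of its points. *)
Definition open_in_subspace A T : Prop :=
  [/\ T 0, forall (c : R) X Y, T X -> T Y -> T (c *: X + Y)
    & exists O : set V, open O /\ A = O `&` T].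

Definition smooth_real_two_form A T w : Prop :=
  [/\ forall x X Y, A x -> T X -> T Y -> complex.Im (w x X Y) = 0,
      forall x (c : R) X Y Z, A x -> T X -> T Y -> T Z ->
        w x (c *: X + Y) Z = c%:C%C * w x X Z + w x Y Z,
      forall x X Y, A x -> T X -> T Y -> w x X Y = - w x Y X
    & forall X Y, T X -> T Y ->
        smooth_on A (fun x => complex.Re (w x X Y) : R^o)].

(* The exterior derivative, evaluated on constant vector fields. *)
Definition closed_form A T w : Prop :=
  forall x X Y Z, A x -> T X -> T Y -> T Z ->
    'D_X (fun y => complex.Re (w y Y Z) : R^o) x
    + 'D_Y (fun y => complex.Re (w y Z X) : R^o) x
    + 'D_Z (fun y => complex.Re (w y X Y) : R^o) x = 0.

(* The last clause is the vanishing of the Nijenhuis tensor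
   [JX,JY] - J[JX,Y] - J[X,JY] - [X,Y] on constant vector fields X, Y. *)
Definition complex_structure A T J : Prop :=
  [/\ forall x X, A x -> T X -> T (J x X) /\ J x (J x X) = - X,
      forall x (c : R) X Y, A x -> T X -> T Y ->
        J x (c *: X + Y) = c *: J x X + J x Y,
      forall X, T X -> smooth_on A (fun x => J x X)
    & forall x X Y, A x -> T X -> T Y ->
        let DJ Z U := 'D_Z (fun y => J y U) x in
        DJ (J x X) Y - DJ (J x Y) X + J x (DJ Y X) - J x (DJ X Y) = 0].

Definition kahler A T w J : Prop :=
  [/\ open_in_subspace A T,
      smooth_real_two_form A T w,
      closed_form A T w,
      complex_structure A T J
    & (forall x X Y, A x -> T X -> T Y -> w x (J x X) (J x Y) = w x X Y) /\
      (forall x X, A x -> T X -> X != 0 -> 0 < complex.Re (w x X (J x X)))].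

Definition is_group (E : Type) (G : set E) (mul : E -> E -> E) (one : E) :=
  [/\ G one, forall a b, G a -> G b -> G (mul a b),
      forall a b c, G a -> G b -> G c -> mul a (mul b c) = mul (mul a b) c,
      forall a, G a -> mul one a = a /\ mul a one = a
    & forall a, G a -> exists b, [/\ G b, mul a b = one & mul b a = one]].

Definition is_action (E : Type) (G : set E) (mul : E -> E -> E) (one : E)
    A (act : E -> V -> V) : Prop :=
  [/\ forall a x, G a -> A x -> A (act a x),
      forall x, A x -> act one x = x
    & forall a b x, G a -> G b -> A x -> act (mul a b) x = act a (act b x)].

Definition transitive_action (E : Type) (G : set E) A (act : E -> V -> V) :=
  forall x y, A x -> A y -> exists2 a, G a & act a x = y.

Definition invariant_form (E : Type) (G : set E) A T (act : E -> V -> V) w :=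
  forall a, G a -> eq_form A T (pullback (act a) w) w.

End Structures.

(* A manifold with a two-form and a family of transformations; the conditions
   making it homogeneous Kaehler are in [homogeneous_kahler]. *)
Record gmanifold := GManifold {
  mspace : normedModType R;
  mset : set mspace;
  mtan : set mspace;
  mform : mspace -> mspace -> mspace -> R[i];
  gelt : Type;
  gset : set gelt;
  gmul : gelt -> gelt -> gelt;
  gone : gelt;
  gact : gelt -> mspace -> mspace }.
Arguments mset : clear implicits.
Arguments mtan : clear implicits.
Arguments mform : clear implicits.
Arguments gset : clear implicits.
Arguments gmul : clear implicits.
Arguments gone : clear implicits.
Arguments gact : clear implicits.

Definition homogeneous_kahler (M : gmanifold) : Prop :=
  [/\ is_group (gset M) (gmul M) (gone M),
      is_action (gset M) (gmul M) (gone M) (mset M) (gact M),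
      transitive_action (gset M) (mset M) (gact M)
    & exists J : mspace M -> mspace M -> mspace M,
      [/\ kahler (mset M) (mtan M) (mform M) J,
          forall a, gset M a -> diffeomorphism (mset M) (mset M) (gact M a),
          invariant_form (gset M) (mset M) (mtan M) (gact M) (mform M)
        & forall a x X, gset M a -> mset M x -> mtan M X ->
            'D_(J x X) (gact M a) x = J (gact M a x) ('D_X (gact M a) x)]].

Definition homogeneous_kahler_diffeo (M N : gmanifold)
    (phi : mspace M -> mspace N) : Prop :=
  [/\ homogeneous_kahler M, homogeneous_kahler N,
      diffeomorphism (mset M) (mset N) phi
    & eq_form (mset M) (mtan M) (pullback phi (mform N)) (mform M)].

End Kahler.

Arguments mset {R} _.
Arguments mtan {R} _.
Arguments mform {R} _.
Arguments gset {R} _.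
Arguments gmul {R} _.
Arguments gone {R} _.
Arguments gact {R} _.
Arguments homogeneous_kahler_diffeo {R} M N phi.

Section ComplexMatrices.
Variable R : realType.
Local Notation C := R[i].

(* A complex matrix as the pair of its real and imaginary parts: in this form
   complex matrices are a real normed space, in which derivatives are taken. *)
Definition cmx (m n : nat) : Type := ('M[R]_(m, n) * 'M[R]_(m, n))%type.

Definition rtoc m n (A : 'M[R]_(m, n)) : 'M[C]_(m, n) :=
  map_mx (fun x => x%:C%C) A.

Definition cplx m n (X : cmx m n) : 'M[C]_(m, n) :=
  rtoc X.1 + 'i%C *: rtoc X.2.

Definition reim m n (A : 'M[C]_(m, n)) : cmx m n :=
  (map_mx (@complex.Re R) A, map_mx (@complex.Im R) A).

Definition cbar m n (A : 'M[C]_(m, n)) : 'M[C]_(m, n) := map_mx (@conjc R) A.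

Definition cadj m n (A : 'M[C]_(m, n)) : 'M[C]_(n, m) := (cbar A)^T.

Definition posdefC n (H : 'M[C]_n) : Prop :=
  forall x : 'cV[C]_n, x != 0 -> 0 < (cadj x *m H *m x) ord0 ord0.

Definition posdefR n (H : 'M[R]_n) : Prop :=
  forall x : 'cV[R]_n, x != 0 -> 0 < (x^T *m H *m x) ord0 ord0.

(* Tr(P /\ Q), for matrix-valued one-forms P and Q. *)
Definition tr_wedge (V : Type) m n (P : V -> 'M[C]_(m, n))
    (Q : V -> 'M[C]_(n, m)) (X Y : V) : C :=
  \tr (P X *m Q Y) - \tr (P Y *m Q X).

End ComplexMatrices.

Section Ball.
Variables (R : realType) (n : nat) (k : R).
Local Notation C := R[i].

Definition siegel_ball : set 'M[C]_n :=
  [set W | W = W^T /\ posdefC (1%:M - W *m cbar W)].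

Definition ballspace : Type := (cmx R n 1 * cmx R n n)%type.

(* Common carrier C^n x D_n of the points (z, W) and (eta, W). *)
Definition ball_set : set ballspace := [set x | siegel_ball (cplx x.2)].
Definition ball_tan : set ballspace := [set X | cplx X.2 = (cplx X.2)^T].

Definition SpC : set 'M[C]_(n + n) :=
  [set g | let p := ulsubmx g in let q := ursubmx g in
    [/\ g = block_mx p q (cbar q) (cbar p),
        p *m cadj p - q *m cadj q = 1%:M,
        p *m q^T = q *m p^T,
        cadj p *m p - q^T *m cbar q = 1%:M
      & p^T *m cbar q = cadj q *m p]].

Definition GJ_elt : Type := ('M[C]_(n + n) * 'cV[C]_n)%type.
Definition GJ_set : set GJ_elt := [set h | SpC h.1].

(* The Jacobi group law modulo the center,
   (g, alpha)(g', alpha') = (g g', g'^-1 . alpha + alpha'),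
   with g . alpha = p alpha + q (cbar alpha). *)
Definition GJ_mul (h h' : GJ_elt) : GJ_elt :=
  let p' := ulsubmx h'.1 in let q' := ursubmx h'.1 in
  (h.1 *m h'.1, cadj p' *m h.2 - q'^T *m cbar h.2 + h'.2).
Definition GJ_one : GJ_elt := (1%:M, 0).

Definition ball_act (h : GJ_elt) (x : ballspace) : ballspace :=
  let p := ulsubmx h.1 in let q := ursubmx h.1 in let alpha := h.2 in
  let z := cplx x.1 in let W := cplx x.2 in
  (reim (invmx (W *m cadj q + cadj p) *m (z + alpha - W *m cbar alpha)),
   reim ((p *m W + q) *m invmx (cbar q *m W + cbar p))).

Definition ball_flat_act (h : GJ_elt) (x : ballspace) : ballspace :=
  let p := ulsubmx h.1 in let q := ursubmx h.1 in let alpha := h.2 in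
  let eta := cplx x.1 in let W := cplx x.2 in
  (reim (p *m (eta + alpha) + q *m (cbar eta + cbar alpha)),
   reim ((p *m W + q) *m invmx (cbar q *m W + cbar p))).

Definition ball_form (x X Y : ballspace) : C :=
  let z := cplx x.1 in let W := cplx x.2 in
  let M := invmx (1%:M - W *m cbar W) in
  let eta := M *m (z + W *m cbar z) in
  let B U := M *m cplx U.2 in
  let A U := cplx U.1 + cplx U.2 *m cbar eta in
  'i%C * ((k / 2)%:C%C * tr_wedge B (fun U => cbar (B U)) X Y
          + tr_wedge (fun U => (A U)^T *m cbar M) (fun U => cbar (A U)) X Y).

Definition ball_flat_form (x X Y : ballspace) : C :=
  let W := cplx x.2 in
  let B U := invmx (1%:M - W *m cbar W) *m cplx U.2 in
  let deta U := cplx U.1 in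
  'i%C * ((k / 2)%:C%C * tr_wedge B (fun U => cbar (B U)) X Y
          + tr_wedge (fun U => (deta U)^T) (fun U => cbar (deta U)) X Y).

(* D^J_n with omega_n. *)
Definition SJball : gmanifold R :=
  @GManifold R ballspace ball_set ball_tan ball_form
    GJ_elt GJ_set GJ_mul GJ_one ball_act.

(* C^n x D_n with omega_{n,0}. *)
Definition SJball_flat : gmanifold R :=
  @GManifold R ballspace ball_set ball_tan ball_flat_form
    GJ_elt GJ_set GJ_mul GJ_one ball_flat_act.

Definition FC (x : ballspace) : ballspace :=
  let eta := cplx x.1 in let W := cplx x.2 in
  (reim (eta - W *m cbar eta), x.2).

Definition FCinv (x : ballspace) : ballspace :=
  let z := cplx x.1 in let W := cplx x.2 in
  (reim (invmx (1%:M - W *m cbar W) *m (z + W *m cbar z)), x.2).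

End Ball.

Arguments siegel_ball R n : clear implicits.
Arguments ball_set R n : clear implicits.
Arguments ball_tan R n : clear implicits.
Arguments SpC R n : clear implicits.
Arguments GJ_set R n : clear implicits.

Section Upper.
Variables (R : realType) (n : nat) (k : R).
Local Notation C := R[i].

Definition siegel_upper : set 'M[C]_n :=
  [set v | exists s r : 'M[R]_n,
    [/\ v = rtoc s + 'i%C *: rtoc r, s^T = s, r^T = r & posdefR r]].

Definition upperspace : Type := (cmx R n n * cmx R n 1)%type.

(* Common carrier X_n x C^n of the points (v, u) and (v, eta). *)
Definition upper_set : set upperspace := [set x | siegel_upper (cplx x.1)].
Definition upper_tan : set upperspace := [set X | cplx X.1 = (cplx X.1)^T].

Definition Jsymp : 'M[R]_(n + n) := block_mx 0 1%:M (- 1%:M) 0.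
Definition SpR : set 'M[R]_(n + n) := [set g | g^T *m Jsymp *m g = Jsymp].

(* Pairs (g, l), with l = (n, m) a row vector of size 2n; the group law modulo
   the center is (g, l)(g', l') = (g g', l g' + l'). *)
Definition GJR_elt : Type := ('M[R]_(n + n) * 'rV[R]_(n + n))%type.
Definition GJR_set : set GJR_elt := [set h | SpR h.1].
Definition GJR_mul (h h' : GJR_elt) : GJR_elt :=
  (h.1 *m h'.1, h.2 *m h'.1 + h'.2).
Definition GJR_one : GJR_elt := (1%:M, 0).

Definition GJR_n (l : 'rV[R]_(n + n)) : 'cV[R]_n := (lsubmx l)^T.
Definition GJR_m (l : 'rV[R]_(n + n)) : 'cV[R]_n := (rsubmx l)^T.
Definition GJR_alpha (l : 'rV[R]_(n + n)) : 'cV[C]_n :=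
  rtoc (GJR_m l) + 'i%C *: rtoc (GJR_n l).

Definition upper_act (h : GJR_elt) (x : upperspace) : upperspace :=
  let a := rtoc (ulsubmx h.1) in let b := rtoc (ursubmx h.1) in
  let c := rtoc (dlsubmx h.1) in let d := rtoc (drsubmx h.1) in
  let v := cplx x.1 in let u := cplx x.2 in
  (reim ((a *m v + b) *m invmx (c *m v + d)),
   reim (invmx (v *m c^T + d^T)
         *m (u + v *m rtoc (GJR_n h.2) + rtoc (GJR_m h.2)))).

(* The transformation of (v, eta) by a pair (g, alpha), alpha in C^n. *)
Definition upper_flat_transf (g : 'M[R]_(n + n)) (alpha : 'cV[C]_n)
    (x : upperspace) : upperspace :=
  let a := rtoc (ulsubmx g) in let b := rtoc (ursubmx g) in
  let c := rtoc (dlsubmx g) in let d := rtoc (drsubmx g) in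
  let v := cplx x.1 in let eta := cplx x.2 in
  (reim ((a *m v + b) *m invmx (c *m v + d)),
   reim (2^-1 *: (a + d + 'i%C *: (b - c)) *m (eta + alpha)
         + 2^-1 *: (a - d - 'i%C *: (b + c)) *m (cbar eta + cbar alpha))).

Definition upper_flat_act (h : GJR_elt) : upperspace -> upperspace :=
  upper_flat_transf h.1 (GJR_alpha h.2).

Definition upper_form (x X Y : upperspace) : C :=
  let v := cplx x.1 in let u := cplx x.2 in
  let D := invmx (cbar v - v) in
  let H U := D *m cplx U.1 in
  let G U := cplx U.2 - cplx U.1 *m D *m (cbar u - u) in
  'i%C * ((k / 2)%:C%C * tr_wedge H (fun U => cbar (H U)) X Y
          + 2 / 'i%C
            * tr_wedge (fun U => (G U)^T *m D) (fun U => cbar (G U)) X Y).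

Definition upper_flat_form (x X Y : upperspace) : C :=
  let v := cplx x.1 in
  let H U := invmx (cbar v - v) *m cplx U.1 in
  let deta U := cplx U.2 in
  'i%C * ((k / 2)%:C%C * tr_wedge H (fun U => cbar (H U)) X Y
          + tr_wedge (fun U => (deta U)^T) (fun U => cbar (deta U)) X Y).

(* X^J_n with omega'_n. *)
Definition SJupper : gmanifold R :=
  @GManifold R upperspace upper_set upper_tan upper_form
    GJR_elt GJR_set GJR_mul GJR_one upper_act.

(* X_n x C^n with omega'_{n,0}. *)
Definition SJupper_flat : gmanifold R :=
  @GManifold R upperspace upper_set upper_tan upper_flat_form
    GJR_elt GJR_set GJR_mul GJR_one upper_flat_act.

Definition FC1 (x : upperspace) : upperspace :=
  let v := cplx x.1 in let eta := cplx x.2 in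
  (x.1, reim ((2 * 'i%C)^-1 *:
    ((v + 'i%C%:M) *m eta - (v - 'i%C%:M) *m cbar eta))).

Definition FC1inv (x : upperspace) : upperspace :=
  let v := cplx x.1 in let u := cplx x.2 in
  let D := invmx (cbar v - v) in
  (x.1, reim ((cbar v - 'i%C%:M) *m D *m u - (v - 'i%C%:M) *m D *m cbar u)).

End Upper.

Arguments siegel_upper R n : clear implicits.
Arguments upper_set R n : clear implicits.
Arguments upper_tan R n : clear implicits.
Arguments SpR R n : clear implicits.
Arguments GJR_set R n : clear implicits.

(* Main.v *)
Require Import Defs.
From mathcomp Require Import all_boot all_order all_algebra.
From mathcomp Require Import complex.
From mathcomp Require Import all_classical all_reals all_analysis.
From mathcomp Require Import ring.
Import Order.TTheory GRing.Theory Num.Theory.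
Import numFieldNormedType.Exports.
Local Open Scope classical_set_scope.
Local Open Scope ring_scope.

(* Both models are cases of one construction.  Over a domain {W symmetric,
   Kf W > 0}, the fibre C^n is trivialised by a real-linear isomorphism
   L_W(a) = l1(W) a + l2(W) abar with l1, l2 affine in W and
   Kf = l1 l1bar - l2 l2bar, and FC is (a, W) |-> (L_W a, W).  Since L_W carries
   da^t /\ dabar to the form weighted by Kf^-1, and the invariant combination
   dz - dW Q(eta) is L_W(deta), the given form pulls back to the flat one; this
   also gives closedness, the fibre part being the pullback of a constant form
   by eta = L_W^-1 z.  A symplectic matrix acts with an automorphy factor N(W)
   for which W_1 = gW satisfies dW_1 = N^-1 dW N^-t, Kf(W_1) = N^-1 Kf(W) N^-*
   and L_(W_1) rho = N^-1 L_W, so invariance of both forms and equivariance of FC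
   are congruences by N.  Transitivity: translations move each fibre, and a
   Cholesky factor of Kf(W)^-1 (of Im v for the half plane) moves the base point
   to W. *)

Set Implicit Arguments.
Unset Strict Implicit.
Unset Printing Implicit Defensive.

(** * Smooth maps and directional derivatives *)

(** The domain is open only in the space of symmetric matrices, and identities between forms are
    established on the domain alone; derivatives in tangent directions are therefore compared along
    segments. All maps involve conjugates, so differentiation is over the reals, entry by entry, and
    the derivatives of [L_W^-1 z] and [N^-1 z] come from differentiating the equations they solve.
    FC is not holomorphic in the coordinate eta: the flat complex structure is [L_W^-1 i L_W] on the
    fibre, and its integrability has to be computed. N is invertible because Kf = e0 + e1 W +
    conj(e1) conj(W) + e2 W conj(W) has e2 <= 0 (it is -1 for the ball, 0 for the half plane): a row
    v != 0 with v N = 0 would give v Kf v^* = e2 |v U|^2 <= 0, where U is the transpose of the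
    numerator of gW. Closedness of the base term rests on E Kf = conj(Kf) E, where E is the
    coefficient of dW in dKf. The base term has weight k/2 for the ball and k/8 for the half plane,
    since (conj v - v)^-1 = (i/2) Kf^-1 there. *)

Section LineDerivative.
Variables (R : realType) (V W W' : normedModType R).

(** The difference quotient of the composite is [L] of the difference quotient of [f], and
    continuity carries the limit. Besides the rules for sums, products and inverses, this is the
    only chain rule used. *)
Lemma derive_comp_linear (L : W -> W') (f : V -> W) x v :
  linear L -> continuous L -> derivable f x v ->
  derivable (fun y => L (f y)) x v /\ 'D_v (fun y => L (f y)) x = L ('D_v f x).
Proof.
move=> Llin Lcont df.
have L0 : L 0 = 0 by have := Llin (-1) 0 0; rewrite scaler0 addr0 scaleN1r addNr.
have LZ a u : L (a *: u) = a *: L u by rewrite -[a *: u]addr0 Llin L0 addr0.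
have LB u w : L (u - w) = L u - L w by rewrite addrC -scaleN1r Llin scaleN1r addrC.
have E : (fun h : R => h^-1 *: ((L \o f) (h *: v + x) - L (f x))) =
   (fun h : R => L (h^-1 *: (f (h *: v + x) - f x))).
  by apply/funext => h /=; rewrite LZ LB.
have cv : (fun h : R => h^-1 *: ((L \o f) (h *: v + x) - L (f x))) @ 0^' --> L ('D_v f x).
  rewrite E; apply: (@cvg_comp _ _ _ _ L); first exact: df.
  exact: Lcont.
split; first by apply/cvg_ex; exists (L ('D_v f x)).
exact: (cvg_lim _ cv).
Qed.

(** A directional derivative sees one line only. Agreement on a full neighbourhood would be too much
    to ask: the domains are open merely inside the subspace of symmetric matrices. *)
Lemma derive_eq_on_line (f g : V -> W) x v :
  (\forall h \near (0 : R), f (h *: v + x) = g (h *: v + x)) ->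
  'D_v f x = 'D_v g x.
Proof.
move=> fg.
have e0 : f x = g x by have := nbhs_singleton fg; rewrite scale0r add0r.
have E : \forall h \near 0, h^-1 *: (f (h *: v + x) - f x)
                       = h^-1 *: (g (h *: v + x) - g x).
  by near=> h; rewrite e0 (near fg h).
rewrite /derive; congr (lim _); rewrite eqEsubset.
split; apply/near_eq_cvg/cvg_within => //.
by near=> h; rewrite -(near E h).
Unshelve. all: by end_near.
Qed.

End LineDerivative.

Section SmoothFunctions.
Variables (R : realType) (V : normedModType R).

Lemma Ck_continuous (W : normedModType R) k (O : set V) (f : V -> W) x :
  Ck k O f -> O x -> {for x, continuous f}.
Proof. by case: k => [|k] [fc _] /fc. Qed.

Lemma Ck_prec (W : normedModType R) k (O : set V) (f : V -> W) :
  Ck k.+1 O f -> Ck k O f.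
Proof.
elim: k f => [|k IH] f [fc fd]; first by [].
by split=> // v; split; [apply: (fd v).1|apply/IH/(fd v).2].
Qed.

Lemma Ck_subset (W : normedModType R) k (O O' : set V) (f : V -> W) :
  O' `<=` O -> Ck k O f -> Ck k O' f.
Proof.
move=> sO; elim: k f => [|k IH] f [fc fd]; split=> //; try by move=> x /sO /fc.
by move=> v; split; [move=> x /sO; apply: (fd v).1|apply/IH/(fd v).2].
Qed.

Lemma Ck_eq (W : normedModType R) k (O : set V) (f g : V -> W) :
  open O -> (forall x, O x -> f x = g x) -> Ck k O f -> Ck k O g.
Proof.
move=> oO; have nO x : O x -> nbhs x O by move=> Ox; exact: open_nbhs_nbhs.
elim: k f g => [|k IH] f g fg [fc fd]; split=> //.
- move=> x Ox; rewrite /prop_for /continuous_at -fg//.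
  apply: cvg_trans (fc x Ox); apply: near_eq_cvg.
  by apply: filterS (nO _ Ox) => y /fg.
- move=> x Ox; rewrite /prop_for /continuous_at -fg//.
  apply: cvg_trans (fc x Ox); apply: near_eq_cvg.
  by apply: filterS (nO _ Ox) => y /fg.
move=> v; split.
  move=> x Ox; apply: near_eq_derivable ((fd v).1 x Ox).
  by apply: filterS (nO _ Ox) => y /fg.
apply: IH (fd v).2 => x Ox; apply: near_eq_derive.
by apply: filterS (nO _ Ox) => y /fg.
Qed.

Lemma Ck_cst (W : normedModType R) k (O : set V) (w : W) :
  Ck k O (fun=> w).
Proof.
elim: k w => [|k IH] w; split=> //; try by move=> x _; exact: cvg_cst.
move=> v; split=> [x _|]; first exact: derivable_cst.
have -> : 'D_v (fun=> w) = (fun=> 0) :> (V -> W) by apply/funext => x; exact: derive_cst.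
exact: IH.
Qed.

Lemma Ck_add (W : normedModType R) k (O : set V) (f g : V -> W) :
  open O -> Ck k O f -> Ck k O g -> Ck k O (fun x => f x + g x).
Proof.
move=> oO; elim: k f g => [|k IH] f g Hf Hg; split=> //;
  try by move=> x Ox; apply: cvgD; [exact: Ck_continuous Hf Ox|exact: Ck_continuous Hg Ox].
move=> v; split=> [x Ox|].
  by apply: derivableD; [apply: (Hf.2 v).1|apply: (Hg.2 v).1].
apply: Ck_eq (IH _ _ (Hf.2 v).2 (Hg.2 v).2) => // x Ox; symmetry.
by apply: deriveD; [apply: (Hf.2 v).1|apply: (Hg.2 v).1].
Qed.

Lemma Ck_linear (W W' : normedModType R) k (O : set V) (f : V -> W) (L : W -> W') :
  linear L -> continuous L -> open O -> Ck k O f -> Ck k O (fun x => L (f x)).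
Proof.
move=> Ll Lc oO; elim: k f => [|k IH] f Hf; split=> //;
  try by move=> x Ox; apply: continuous_comp; [exact: Ck_continuous Hf Ox|exact: Lc].
move=> v; split=> [x Ox|].
  by have [] := derive_comp_linear Ll Lc ((Hf.2 v).1 x Ox).
apply: Ck_eq (IH _ (Hf.2 v).2) => // x Ox.
by have [_ ->] := derive_comp_linear Ll Lc ((Hf.2 v).1 x Ox).
Qed.

Lemma Ck_linear_map (W : normedModType R) k (O : set V) (L : V -> W) :
  linear L -> continuous L -> Ck k O L.
Proof.
move=> Ll Lc.
have D x v := derive_comp_linear Ll Lc (@derivable_id _ _ x v).
case: k => [|k]; (split; first by move=> x _; exact: Lc) => // v.
split=> [x _|]; first by have [] := D x v.
have -> : 'D_v L = (fun=> L v).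
  by apply/funext => x; have [_ ->] := D x v; rewrite derive_id.
exact: Ck_cst.
Qed.

Lemma Ck_mul k (O : set V) (f g : V -> R^o) :
  open O -> Ck k O f -> Ck k O g -> Ck k O (fun x => f x * g x : R^o).
Proof.
move=> oO; elim: k f g => [|k IH] f g Hf Hg; split=> //;
  try by move=> x Ox; apply: cvgM; [exact: Ck_continuous Hf Ox|exact: Ck_continuous Hg Ox].
move=> v; split=> [x Ox|].
  by apply: derivableM; [apply: (Hf.2 v).1|apply: (Hg.2 v).1].
apply: (@Ck_eq _ _ _ (fun x => f x * 'D_v g x + g x * 'D_v f x)) => // [x Ox|].
  by symmetry; apply: deriveM; [apply: (Hf.2 v).1|apply: (Hg.2 v).1].
apply: Ck_add => //; apply: IH; try exact: Ck_prec.
  exact: (Hg.2 v).2.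
exact: (Hf.2 v).2.
Qed.

(** The induction closes because the derivative of 1/f is -(1/f)^2 f', a product of functions
    already known to have one order of smoothness less. *)
Lemma Ck_inv k (O : set V) (f : V -> R^o) :
  open O -> (forall x, O x -> f x != 0) -> Ck k O f ->
  Ck k O (fun x => (f x)^-1 : R^o).
Proof.
move=> oO f0; elim: k => [|k IH] Hf; split=> //;
  try by move=> x Ox; apply: cvgV; [exact: f0|exact: Ck_continuous Hf Ox].
move=> v; split=> [x Ox|].
  by apply: derivableV; [exact: f0|apply: (Hf.2 v).1].
apply: (@Ck_eq _ _ _ (fun x => -1 * ((f x)^-1 * (f x)^-1 * 'D_v f x))) => // [x Ox|].
  rewrite deriveV//; [|exact: f0|exact: (Hf.2 v).1].
  by rewrite mulN1r scaleNr -exprVn -expr2.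
have IHf := IH (Ck_prec Hf).
apply: Ck_mul => //; first exact: Ck_cst.
by apply: Ck_mul => //; [exact: Ck_mul|exact: (Hf.2 v).2].
Qed.

End SmoothFunctions.

Section SmoothAt.
Variables (R : realType) (V : normedModType R).

(** Smoothness as a property of germs: the neighbourhood may shrink at every step, as it must when a
    denominator is only known to be nonzero at [x]. *)
Definition smooth_at (W : normedModType R) (x : V) (f : V -> W) : Prop :=
  exists D : set V, [/\ open D, D x & smooth D f].

Lemma smooth_at_continuous (W : normedModType R) (x : V) (f : V -> W) :
  smooth_at x f -> {for x, continuous f}.
Proof. by case=> D [oD Ox /(_ 0%N) [fc _]]; apply: fc. Qed.

Lemma smooth_at_derivable (W : normedModType R) (x v : V) (f : V -> W) :
  smooth_at x f -> derivable f x v.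
Proof. by case=> D [oD Ox /(_ 1%N) [_ /(_ v) [fd _]]]; apply: fd. Qed.

Lemma smooth_at_eq (W : normedModType R) (x : V) (f g : V -> W) :
  (\forall y \near x, f y = g y) -> smooth_at x f -> smooth_at x g.
Proof.
move=> fg [D [oD Ox sf]].
have oD' : open (D `&` (interior [set y | f y = g y])).
  by apply: openI => //; exact: open_interior.
exists (D `&` (interior [set y | f y = g y])); split=> // k.
apply: (@Ck_eq _ _ _ _ _ f) => // [y [_ /interior_subset]//|].
by apply: Ck_subset (sf k) => y [].
Qed.

Lemma smooth_at_cst (W : normedModType R) (x : V) (w : W) :
  smooth_at x (fun=> w).
Proof. by exists setT; split=> //; [exact: openT|move=> k; exact: Ck_cst]. Qed.

Lemma smooth_at_linear_map (W : normedModType R) (L : V -> W) (x : V) :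
  linear L -> continuous L -> smooth_at x L.
Proof. by move=> Ll Lc; exists setT; split=> //; [exact: openT|move=> k; exact: Ck_linear_map]. Qed.

Lemma smooth_at_comp_linear (W W' : normedModType R) (L : W -> W') (x : V)
    (f : V -> W) :
  linear L -> continuous L -> smooth_at x f -> smooth_at x (fun y => L (f y)).
Proof.
by move=> Ll Lc [D [oD Ox sf]]; exists D; split=> // k; exact: Ck_linear.
Qed.

Lemma smooth_at_add (W : normedModType R) (x : V) (f g : V -> W) :
  smooth_at x f -> smooth_at x g -> smooth_at x (fun y => f y + g y).
Proof.
move=> [D [oD Ox sf]] [D' [oD' Ox' sg]].
have oI := openI oD oD'; exists (D `&` D'); split=> // k.
by apply: Ck_add => //; [exact: Ck_subset (sf k)|exact: Ck_subset (sg k)].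
Qed.

Lemma smooth_at_sum (W : normedModType R) (I : Type) (r : seq I) (P : pred I)
    (F : I -> V -> W) (x : V) :
  (forall i, smooth_at x (F i)) ->
  smooth_at x (fun y => \sum_(i <- r | P i) F i y).
Proof.
move=> sF; elim: r => [|i r IH].
  by under eq_fun do rewrite big_nil; exact: smooth_at_cst.
under eq_fun do rewrite big_cons.
by case: (P i) => //; exact: smooth_at_add.
Qed.

Lemma smooth_at_mul (x : V) (f g : V -> R^o) :
  smooth_at x f -> smooth_at x g -> smooth_at x (fun y => f y * g y : R^o).
Proof.
move=> [D [oD Ox sf]] [D' [oD' Ox' sg]].
have oI := openI oD oD'; exists (D `&` D'); split=> // k.
by apply: Ck_mul => //; [exact: Ck_subset (sf k)|exact: Ck_subset (sg k)].
Qed.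

Lemma smooth_at_neq0 (x : V) (f : V -> R^o) :
  smooth_at x f -> f x != 0 -> \forall y \near x, f y != 0.
Proof.
move=> /smooth_at_continuous fc fx0; apply: (fc [set r | r != 0]).
by have := @open_nbhs_nbhs R (f x) [set r | r != 0] (conj (@open_neq R 0) fx0).
Qed.

Lemma smooth_at_inv (x : V) (f : V -> R^o) :
  f x != 0 -> smooth_at x f -> smooth_at x (fun y => (f y)^-1 : R^o).
Proof.
move=> fx0 sf; have fn := smooth_at_neq0 sf fx0.
case: sf => D [oD Dx sf].
pose U := [set y | f y != 0].
have oD' : open (D `&` interior U) by apply: openI => //; exact: open_interior.
exists (D `&` interior U); split=> // k.
apply: Ck_inv => // [y [_ /interior_subset]//|].
by apply: Ck_subset (sf k) => y [].
Qed.

Lemma smooth_at_on (W : normedModType R) (A : set V) (f : V -> W) :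
  (forall x, A x -> smooth_at x f) -> smooth_on A f.
Proof. by move=> sf x /sf [D [oD Ox sO]]; exists D, f; split. Qed.

End SmoothAt.

(** * Real differentiation of complex-valued functions *)

Section ComplexFunctions.
Variables (R : realType) (V : normedModType R).
Local Notation C := R[i].
Implicit Types (f g : V -> C) (x X : V).

(** Smoothness is over the reals, since conjugates occur everywhere; a complex function counts as
    its real and imaginary parts. *)
Definition csmooth x f : Prop :=
  smooth_at x (fun y => complex.Re (f y) : R^o) /\
  smooth_at x (fun y => complex.Im (f y) : R^o).

Definition cderive X f x : C :=
  Complex ('D_X (fun y => complex.Re (f y) : R^o) x)
          ('D_X (fun y => complex.Im (f y) : R^o) x).

Lemma csmooth_near x f g :
  (\forall y \near x, f y = g y) -> csmooth x f -> csmooth x g.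
Proof.
by move=> fg [sr si]; split; [apply: smooth_at_eq sr|apply: smooth_at_eq si];
   apply: filterS fg => y ->.
Qed.

Lemma cderive_near x X f g :
  (\forall y \near x, f y = g y) -> cderive X f x = cderive X g x.
Proof.
by move=> fg; congr Complex; apply: near_eq_derive; apply: filterS fg => y ->.
Qed.

Lemma csmooth_cst x (c : C) : csmooth x (fun=> c).
Proof. by split; exact: smooth_at_cst. Qed.

Lemma cderive_cst x X (c : C) : cderive X (fun=> c) x = 0.
Proof. by rewrite /cderive !derive_cst. Qed.

Lemma ReD (a b : C) : complex.Re (a + b) = complex.Re a + complex.Re b.
Proof. by case: a; case: b. Qed.

Lemma ImD (a b : C) : complex.Im (a + b) = complex.Im a + complex.Im b.
Proof. by case: a; case: b. Qed.

Lemma csmooth_add x f g :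
  csmooth x f -> csmooth x g -> csmooth x (fun y => f y + g y).
Proof.
by move=> [fr fi] [gr gi]; split; under eq_fun do rewrite ?ReD ?ImD; exact: smooth_at_add.
Qed.

Lemma cderive_add x X f g : csmooth x f -> csmooth x g ->
  cderive X (fun y => f y + g y) x = cderive X f x + cderive X g x.
Proof.
move=> [fr fi] [gr gi]; apply/eqP; rewrite eq_complex /=; apply/andP; split; apply/eqP.
  have -> : (fun y => complex.Re (f y + g y) : R^o) =
     (fun y => complex.Re (f y) : R^o) \+ (fun y => complex.Re (g y) : R^o).
    by apply/funext => y; rewrite /= ReD.
  by apply: deriveD; exact: smooth_at_derivable.
have -> : (fun y => complex.Im (f y + g y) : R^o) =
   (fun y => complex.Im (f y) : R^o) \+ (fun y => complex.Im (g y) : R^o).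
  by apply/funext => y; rewrite /= ImD.
by apply: deriveD; exact: smooth_at_derivable.
Qed.

(** The sign is written as the factor -1, so that only sums and products of smooth functions
    appear. *)
Lemma ReM (a b : C) : complex.Re (a * b) =
  complex.Re a * complex.Re b + (-1) * (complex.Im a * complex.Im b).
Proof. by case: a => ? ?; case: b => ? ? /=; rewrite mulN1r. Qed.

Lemma ImM (a b : C) : complex.Im (a * b) =
  complex.Re a * complex.Im b + complex.Im a * complex.Re b.
Proof. by case: a => ? ?; case: b. Qed.

Lemma csmooth_mul x f g :
  csmooth x f -> csmooth x g -> csmooth x (fun y => f y * g y).
Proof.
move=> [fr fi] [gr gi]; split.
  under eq_fun do rewrite ReM; apply: smooth_at_add; first exact: smooth_at_mul.
  by apply: smooth_at_mul; [exact: smooth_at_cst|exact: smooth_at_mul].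
by under eq_fun do rewrite ImM; apply: smooth_at_add; exact: smooth_at_mul.
Qed.

Lemma derive_mulE x X (f g : V -> R^o) : smooth_at x f -> smooth_at x g ->
  'D_X (fun y => f y * g y : R^o) x = 'D_X f x * g x + f x * 'D_X g x.
Proof.
move=> sf sg.
have -> : 'D_X (fun y => f y * g y : R^o) x = f x *: 'D_X g x + g x *: 'D_X f x.
  by apply: deriveM; exact: smooth_at_derivable.
by rewrite addrC /GRing.scale /= [g x * _]mulrC.
Qed.

Lemma derive_addE x X (f g : V -> R^o) : smooth_at x f -> smooth_at x g ->
  'D_X (fun y => f y + g y : R^o) x = 'D_X f x + 'D_X g x.
Proof. by move=> sf sg; apply: deriveD; exact: smooth_at_derivable. Qed.

Lemma cderive_mul x X f g : csmooth x f -> csmooth x g ->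
  cderive X (fun y => f y * g y) x = cderive X f x * g x + f x * cderive X g x.
Proof.
move=> [fr fi] [gr gi]; apply/eqP; rewrite eq_complex; apply/andP; split; apply/eqP.
  rewrite ReD !ReM /=; under eq_fun do rewrite ReM.
  have sc := smooth_at_cst x (-1 : R^o).
  rewrite derive_addE ?derive_mulE ?derive_cst//; try ring.
  - exact: smooth_at_mul.
  - exact: smooth_at_mul.
  - by apply: smooth_at_mul => //; exact: smooth_at_mul.
rewrite ImD !ImM /=; under eq_fun do rewrite ImM.
rewrite derive_addE ?derive_mulE//; try ring; exact: smooth_at_mul.
Qed.

Lemma csmooth_conj x f : csmooth x f -> csmooth x (fun y => conjc (f y)).
Proof.
move=> [fr fi]; split.
  by have -> : (fun y => complex.Re (conjc (f y)) : R^o) = (fun y => complex.Re (f y) : R^o);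
     [apply/funext => y; case: (f y)|].
have -> : (fun y => complex.Im (conjc (f y)) : R^o) = (fun y => -1 * complex.Im (f y) : R^o).
  by apply/funext => y; rewrite mulN1r; case: (f y).
by apply: smooth_at_mul => //; exact: smooth_at_cst.
Qed.

Lemma cderive_conj x X f : csmooth x f ->
  cderive X (fun y => conjc (f y)) x = conjc (cderive X f x).
Proof.
move=> [fr fi]; apply/eqP; rewrite eq_complex /=; apply/andP; split; apply/eqP.
  have -> // : (fun y => complex.Re (conjc (f y)) : R^o) = (fun y => complex.Re (f y) : R^o).
  by apply/funext => y; case: (f y).
have -> : (fun y => complex.Im (conjc (f y)) : R^o) = (fun y => -1 * complex.Im (f y) : R^o).
  by apply/funext => y; rewrite mulN1r; case: (f y).
by rewrite derive_mulE ?derive_cst//; [rewrite mul0r add0r mulN1r|exact: smooth_at_cst].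
Qed.

(** 1/f = conj(f) / |f|^2, where the squared modulus [nf] is a real smooth function that is nonzero
    at [x]. *)
Lemma csmooth_inv x f : f x != 0 -> csmooth x f -> csmooth x (fun y => (f y)^-1).
Proof.
move=> fx0 [fr fi].
pose nf := fun y => complex.Re (f y) * complex.Re (f y)
                    + complex.Im (f y) * complex.Im (f y) : R^o.
have snf : smooth_at x nf by apply: smooth_at_add; exact: smooth_at_mul.
have nf0 : nf x != 0.
  move: fx0; rewrite eq_complex /nf /= -!expr2; apply: contraNneq => /eqP.
  by rewrite paddr_eq0 ?sqr_ge0// !sqrf_eq0.
have sinv := smooth_at_inv nf0 snf; split.
  have -> : (fun y => complex.Re (f y)^-1 : R^o)
          = (fun y => complex.Re (f y) * (nf y)^-1 : R^o).
    by apply/funext => y; rewrite /nf; case: (f y) => a b /=; rewrite !expr2.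
  exact: smooth_at_mul.
have -> : (fun y => complex.Im (f y)^-1 : R^o)
        = (fun y => -1 * (complex.Im (f y) * (nf y)^-1) : R^o).
  by apply/funext => y; rewrite /nf mulN1r; case: (f y) => a b /=; rewrite !expr2.
by apply: smooth_at_mul; [exact: smooth_at_cst|exact: smooth_at_mul].
Qed.

Lemma csmooth_sum x (I : Type) (r : seq I) (P : pred I) (F : I -> V -> C) :
  (forall i, csmooth x (F i)) -> csmooth x (fun y => \sum_(i <- r | P i) F i y).
Proof.
move=> sF; elim: r => [|i r IH].
  by under eq_fun do rewrite big_nil; exact: csmooth_cst.
by under eq_fun do rewrite big_cons; case: (P i) => //; exact: csmooth_add.
Qed.

Lemma cderive_sum x X (I : Type) (r : seq I) (P : pred I) (F : I -> V -> C) :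
  (forall i, csmooth x (F i)) ->
  cderive X (fun y => \sum_(i <- r | P i) F i y) x
  = \sum_(i <- r | P i) cderive X (F i) x.
Proof.
move=> sF; elim: r => [|i r IH].
  by under eq_fun do rewrite big_nil; rewrite cderive_cst big_nil.
under eq_fun do rewrite big_cons; rewrite big_cons; case: (P i) => //.
by rewrite cderive_add ?IH//; exact: csmooth_sum.
Qed.

Lemma csmooth_prod x (I : Type) (r : seq I) (P : pred I) (F : I -> V -> C) :
  (forall i, csmooth x (F i)) -> csmooth x (fun y => \prod_(i <- r | P i) F i y).
Proof.
move=> sF; elim: r => [|i r IH].
  by under eq_fun do rewrite big_nil; exact: csmooth_cst.
by under eq_fun do rewrite big_cons; case: (P i) => //; exact: csmooth_mul.
Qed.

End ComplexFunctions.

(** * Real differentiation of complex matrix-valued functions *)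

Section MatrixFunctions.
Variables (R : realType) (V : normedModType R).
Local Notation C := R[i].
Implicit Types (x X : V).

Definition msmooth m n x (F : V -> 'M[C]_(m, n)) : Prop :=
  forall i j, csmooth x (fun y => F y i j).

Definition mderive m n X (F : V -> 'M[C]_(m, n)) x : 'M[C]_(m, n) :=
  \matrix_(i, j) cderive X (fun y => F y i j) x.

Lemma msmooth_near m n x (F G : V -> 'M[C]_(m, n)) :
  (\forall y \near x, F y = G y) -> msmooth x F -> msmooth x G.
Proof. by move=> FG sF i j; apply: csmooth_near (sF i j); apply: filterS FG => y ->. Qed.

Lemma mderive_near m n x X (F G : V -> 'M[C]_(m, n)) :
  (\forall y \near x, F y = G y) -> mderive X F x = mderive X G x.
Proof.
move=> FG; apply/matrixP => i j; rewrite !mxE; apply: cderive_near.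
by apply: filterS FG => y ->.
Qed.

Lemma msmooth_cst m n x (A : 'M[C]_(m, n)) : msmooth x (fun=> A).
Proof. by move=> i j; exact: csmooth_cst. Qed.

Lemma mderive_cst m n x X (A : 'M[C]_(m, n)) : mderive X (fun=> A) x = 0.
Proof. by apply/matrixP => i j; rewrite !mxE cderive_cst. Qed.

Lemma msmooth_add m n x (F G : V -> 'M[C]_(m, n)) :
  msmooth x F -> msmooth x G -> msmooth x (fun y => F y + G y).
Proof.
move=> sF sG i j; under eq_fun do rewrite mxE.
by apply: csmooth_add; [exact: sF|exact: sG].
Qed.

Lemma mderive_add m n x X (F G : V -> 'M[C]_(m, n)) :
  msmooth x F -> msmooth x G ->
  mderive X (fun y => F y + G y) x = mderive X F x + mderive X G x.
Proof.
move=> sF sG; apply/matrixP => i j; rewrite !mxE; under eq_fun do rewrite mxE.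
by rewrite cderive_add.
Qed.

Lemma msmooth_scale m n x (c : V -> C) (F : V -> 'M[C]_(m, n)) :
  csmooth x c -> msmooth x F -> msmooth x (fun y => c y *: F y).
Proof.
move=> sc sF i j; under eq_fun do rewrite mxE.
by apply: csmooth_mul => //; exact: sF.
Qed.

Lemma mderive_scale m n x X (c : C) (F : V -> 'M[C]_(m, n)) :
  msmooth x F -> mderive X (fun y => c *: F y) x = c *: mderive X F x.
Proof.
move=> sF; apply/matrixP => i j; rewrite !mxE; under eq_fun do rewrite mxE.
by rewrite cderive_mul// ?cderive_cst ?mul0r ?add0r//; exact: csmooth_cst.
Qed.

Lemma msmooth_opp m n x (F : V -> 'M[C]_(m, n)) :
  msmooth x F -> msmooth x (fun y => - F y).
Proof.
move=> sF; under eq_fun do rewrite -scaleN1r.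
by apply: msmooth_scale => //; exact: csmooth_cst.
Qed.

Lemma mderive_opp m n x X (F : V -> 'M[C]_(m, n)) :
  msmooth x F -> mderive X (fun y => - F y) x = - mderive X F x.
Proof.
by move=> sF; under eq_fun do rewrite -scaleN1r; rewrite mderive_scale// scaleN1r.
Qed.

Lemma msmooth_sub m n x (F G : V -> 'M[C]_(m, n)) :
  msmooth x F -> msmooth x G -> msmooth x (fun y => F y - G y).
Proof. by move=> sF sG; apply: msmooth_add => //; exact: msmooth_opp. Qed.

Lemma mderive_sub m n x X (F G : V -> 'M[C]_(m, n)) :
  msmooth x F -> msmooth x G ->
  mderive X (fun y => F y - G y) x = mderive X F x - mderive X G x.
Proof. by move=> sF sG; rewrite mderive_add ?mderive_opp//; exact: msmooth_opp. Qed.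

Lemma msmooth_mul m n p x (F : V -> 'M[C]_(m, n)) (G : V -> 'M[C]_(n, p)) :
  msmooth x F -> msmooth x G -> msmooth x (fun y => F y *m G y).
Proof.
move=> sF sG i j; under eq_fun do rewrite mxE.
by apply: csmooth_sum => k; apply: csmooth_mul; [exact: sF|exact: sG].
Qed.

Lemma mderive_mul m n p x X (F : V -> 'M[C]_(m, n)) (G : V -> 'M[C]_(n, p)) :
  msmooth x F -> msmooth x G ->
  mderive X (fun y => F y *m G y) x = mderive X F x *m G x + F x *m mderive X G x.
Proof.
move=> sF sG; apply/matrixP => i j; rewrite !mxE; under eq_fun do rewrite mxE.
rewrite cderive_sum => [|k]; last by apply: csmooth_mul; [exact: sF|exact: sG].
rewrite -big_split; apply: eq_bigr => k _ /=; rewrite !mxE cderive_mul//.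
Qed.

Lemma msmooth_conj m n x (F : V -> 'M[C]_(m, n)) :
  msmooth x F -> msmooth x (fun y => cbar (F y)).
Proof.
by move=> sF i j; under eq_fun do rewrite mxE; apply: csmooth_conj; exact: sF.
Qed.

Lemma mderive_conj m n x X (F : V -> 'M[C]_(m, n)) :
  msmooth x F -> mderive X (fun y => cbar (F y)) x = cbar (mderive X F x).
Proof.
move=> sF; apply/matrixP => i j; rewrite !mxE; under eq_fun do rewrite mxE.
by rewrite cderive_conj.
Qed.

Lemma msmooth_tr m n x (F : V -> 'M[C]_(m, n)) :
  msmooth x F -> msmooth x (fun y => (F y)^T).
Proof. by move=> sF i j; under eq_fun do rewrite mxE; exact: sF. Qed.

Lemma mderive_tr m n x X (F : V -> 'M[C]_(m, n)) :
  mderive X (fun y => (F y)^T) x = (mderive X F x)^T.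
Proof. by apply/matrixP => i j; rewrite !mxE; under eq_fun do rewrite mxE. Qed.

Lemma csmooth_trace n x (F : V -> 'M[C]_n) :
  msmooth x F -> csmooth x (fun y => \tr (F y)).
Proof. by move=> sF; apply: csmooth_sum. Qed.

Lemma cderive_trace n x X (F : V -> 'M[C]_n) :
  msmooth x F -> cderive X (fun y => \tr (F y)) x = \tr (mderive X F x).
Proof.
by move=> sF; rewrite cderive_sum//; apply: eq_bigr => i _; rewrite mxE.
Qed.

Lemma csmooth_det n x (F : V -> 'M[C]_n) :
  msmooth x F -> csmooth x (fun y => \det (F y)).
Proof.
move=> sF; apply: csmooth_sum => s; apply: csmooth_mul; first exact: csmooth_cst.
by apply: csmooth_prod => i; exact: sF.
Qed.

Lemma csmooth_neq0 x (f : V -> C) : csmooth x f -> f x != 0 ->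
  \forall y \near x, f y != 0.
Proof.
move=> [sr si]; rewrite eq_complex negb_and => /orP[] n0.
  apply: filterS (smooth_at_neq0 sr n0) => y /= n0'.
  by rewrite eq_complex negb_and n0'.
apply: filterS (smooth_at_neq0 si n0) => y /= n0'.
by rewrite eq_complex negb_and n0' orbT.
Qed.

Lemma near_unitmx n x (F : V -> 'M[C]_n) :
  msmooth x F -> F x \in unitmx -> \forall y \near x, F y \in unitmx.
Proof.
move=> sF; rewrite unitmxE unitfE => dF; have := csmooth_neq0 (csmooth_det sF) dF.
by apply: filterS => y; rewrite unitmxE unitfE.
Qed.

Lemma msmooth_invmx n x (F : V -> 'M[C]_n) :
  msmooth x F -> F x \in unitmx -> msmooth x (fun y => invmx (F y)).
Proof.
move=> sF uF.
(* The cofactor formula is valid only where [F y] is invertible, because [invmx] returns a singular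
   matrix unchanged; hence the passage to germs. *)
apply: (@msmooth_near _ _ _ (fun y => (\det (F y))^-1 *: \adj (F y))).
  by apply: filterS (near_unitmx sF uF) => y uy; rewrite /invmx uy.
apply: msmooth_scale.
  by apply: csmooth_inv; [rewrite -unitfE -unitmxE|exact: csmooth_det].
move=> i j; under eq_fun do rewrite mxE.
apply: csmooth_mul; first exact: csmooth_cst.
apply: csmooth_det => i' j'; under eq_fun do rewrite !mxE.
exact: sF.
Qed.

(** Obtained by differentiating [F y *m invmx (F y) = 1], which holds near [x]. *)
Lemma mderive_invmx n x X (F : V -> 'M[C]_n) :
  msmooth x F -> F x \in unitmx ->
  mderive X (fun y => invmx (F y)) x = - (invmx (F x) *m mderive X F x *m invmx (F x)).
Proof.
move=> sF uF; have sI := msmooth_invmx sF uF.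
have : mderive X (fun y => F y *m invmx (F y)) x = 0.
  rewrite (@mderive_near _ _ _ _ _ (fun=> 1%:M)) ?mderive_cst//.
  by apply: filterS (near_unitmx sF uF) => y; exact: mulmxV.
rewrite mderive_mul// => /eqP; rewrite addrC addr_eq0 => /eqP E.
by rewrite -mulmxA -mulmxN -E mulmxA mulVmx// mul1mx.
Qed.

End MatrixFunctions.

(** * Complex matrices as pairs of real matrices *)

Section Coordinates.
Variables (R : realType) (V : normedModType R).
Local Notation C := R[i].

Lemma cplx_entry m n (X : cmx R m n) i j :
  cplx X i j = Complex (X.1 i j) (X.2 i j).
Proof. by rewrite !mxE [RHS]complexE. Qed.

Lemma reimK m n (A : 'M[C]_(m, n)) : cplx (reim A) = A.
Proof. by apply/matrixP => i j; rewrite cplx_entry !mxE; case: (A i j). Qed.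

Lemma cplxK m n (X : cmx R m n) : reim (cplx X) = X.
Proof.
by rewrite [RHS]surjective_pairing; congr pair; apply/matrixP => i j;
  rewrite mxE cplx_entry.
Qed.

Lemma cplxP m n (c : R) (X Y : cmx R m n) :
  cplx (c *: X + Y) = c%:C%C *: cplx X + cplx Y.
Proof.
by apply/matrixP => i j; rewrite !mxE !(rmorphD, rmorphM) /=; ring.
Qed.

Lemma smooth_at_mx m n (F : V -> 'M[R]_(m, n)) x :
  (forall i j, smooth_at x (fun y => F y i j : R^o)) -> smooth_at x F.
Proof.
move=> sF.
have -> : F = (fun y => \sum_i \sum_j F y i j *: delta_mx i j).
  by apply/funext => y; rewrite [LHS]matrix_sum_delta.
apply: smooth_at_sum => i; apply: smooth_at_sum => j.
apply: (@smooth_at_comp_linear _ _ R^o _ (fun r : R^o => r *: delta_mx i j : 'M[R]_(m, n))) => //.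
  by move=> c u v; rewrite scalerDl scalerA.
by move=> r; exact: (@cvgZr_tmp _ _ _ _ _ _ _ _ cvg_id).
Qed.

Lemma smooth_at_pair (W W' : normedModType R) (f : V -> W) (g : V -> W') x :
  smooth_at x f -> smooth_at x g -> smooth_at x (fun y => (f y, g y)).
Proof.
move=> sf sg.
have -> : (fun y => (f y, g y)) = (fun y => (f y, 0) + (0, g y)).
  by apply/funext => y; congr pair; rewrite /= ?addr0 ?add0r.
apply: smooth_at_add.
  apply: (@smooth_at_comp_linear _ _ _ _ (fun u => (u, 0 : W'))) => //.
    by move=> c u v; congr pair; rewrite /= ?scaler0 ?addr0.
  by move=> u; apply: cvg_pair => //; exact: cvg_cst.
apply: (@smooth_at_comp_linear _ _ _ _ (fun u => (0 : W, u))) => //.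
  by move=> c u v; congr pair; rewrite /= ?scaler0 ?addr0.
by move=> u; apply: cvg_pair => //; exact: cvg_cst.
Qed.

Lemma continuous_entry1 m n i j : continuous (fun A : cmx R m n => A.1 i j : R^o).
Proof.
move=> A; have cp : continuous (fst : cmx R m n -> 'M[R]_(m, n)) by move=> B; exact: cvg_fst.
by have H := continuous_comp (cp A) (@coord_continuous R m n i j A.1); exact H.
Qed.

Lemma continuous_entry2 m n i j : continuous (fun A : cmx R m n => A.2 i j : R^o).
Proof.
move=> A; have cp : continuous (snd : cmx R m n -> 'M[R]_(m, n)) by move=> B; exact: cvg_snd.
by have H := continuous_comp (cp A) (@coord_continuous R m n i j A.2); exact H.
Qed.

Lemma smooth_at_cplx m n (f : V -> cmx R m n) x :
  msmooth x (fun y => cplx (f y)) -> smooth_at x f.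
Proof.
move=> sf.
have -> : f = (fun y => ((f y).1, (f y).2)) by apply/funext => y; rewrite -surjective_pairing.
apply: smooth_at_pair; apply: smooth_at_mx => i j.
  by have [] := sf i j; under eq_fun do rewrite cplx_entry.
by have [_] := sf i j; under eq_fun do rewrite cplx_entry.
Qed.

Lemma cplx_smooth m n (f : V -> cmx R m n) x :
  smooth_at x f -> msmooth x (fun y => cplx (f y)).
Proof.
move=> sf i j; split; under eq_fun do rewrite cplx_entry /=.
  apply: (@smooth_at_comp_linear _ _ _ _ (fun A : cmx R m n => A.1 i j : R^o)) sf.
    by move=> c A B; rewrite /= !mxE.
  exact: continuous_entry1.
apply: (@smooth_at_comp_linear _ _ _ _ (fun A : cmx R m n => A.2 i j : R^o)) sf.
  by move=> c A B; rewrite /= !mxE.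
exact: continuous_entry2.
Qed.

(** The bridge between the derivatives of the theorem, taken in a space of pairs of real matrices,
    and the entrywise complex ones in which all computations are made. *)
Lemma cplx_derive m n (f : V -> cmx R m n) x X :
  smooth_at x f -> cplx ('D_X f x) = mderive X (fun y => cplx (f y)) x.
Proof.
move=> sf; have df := @smooth_at_derivable _ _ _ x X _ sf.
apply/matrixP => i j; rewrite [RHS]mxE cplx_entry; congr Complex.
  under eq_fun do rewrite cplx_entry /=; symmetry.
  apply: (derive_comp_linear (L := fun A : cmx R m n => A.1 i j : R^o) _ _ df).2.
    by move=> c A B; rewrite /= !mxE.
  exact: continuous_entry1.
under eq_fun do rewrite cplx_entry /=; symmetry.
apply: (derive_comp_linear (L := fun A : cmx R m n => A.2 i j : R^o) _ _ df).2.
  by move=> c A B; rewrite /= !mxE.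
exact: continuous_entry2.
Qed.

End Coordinates.

(** * Complex matrices *)

Section ComplexRules.
Variable R : realType.
Local Notation C := R[i].

Lemma CmulDl m n p (A B : 'M[C]_(m, n)) (D : 'M[C]_(n, p)) : (A + B) *m D = A *m D + B *m D.
Proof. exact: mulmxDl. Qed.
Lemma CmulDr m n p (D : 'M[C]_(m, n)) (A B : 'M[C]_(n, p)) : D *m (A + B) = D *m A + D *m B.
Proof. exact: mulmxDr. Qed.
Lemma CmulNl m n p (A : 'M[C]_(m, n)) (D : 'M[C]_(n, p)) : (- A) *m D = - (A *m D).
Proof. exact: mulNmx. Qed.
Lemma CmulNr m n p (A : 'M[C]_(m, n)) (D : 'M[C]_(n, p)) : A *m (- D) = - (A *m D).
Proof. exact: mulmxN. Qed.
Lemma CmulZl m n p (c : C) (A : 'M[C]_(m, n)) (D : 'M[C]_(n, p)) : (c *: A) *m D = c *: (A *m D).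
Proof. by rewrite scalemxAl. Qed.
Lemma CmulZr m n p (c : C) (A : 'M[C]_(m, n)) (D : 'M[C]_(n, p)) : A *m (c *: D) = c *: (A *m D).
Proof. by rewrite scalemxAr. Qed.
Lemma CmulSl m n (c : C) (A : 'M[C]_(m, n)) : c%:M *m A = c *: A.
Proof. exact: mul_scalar_mx. Qed.
Lemma CmulSr m n (c : C) (A : 'M[C]_(m, n)) : A *m c%:M = c *: A.
Proof. exact: mul_mx_scalar. Qed.
Lemma Cmul0l m n p (A : 'M[C]_(n, p)) : (0 : 'M[C]_(m, n)) *m A = 0.
Proof. exact: mul0mx. Qed.
Lemma Cmul0r m n p (A : 'M[C]_(m, n)) : A *m (0 : 'M[C]_(n, p)) = 0.
Proof. exact: mulmx0. Qed.
Lemma CmulA m n p q (A : 'M[C]_(m, n)) (B : 'M[C]_(n, p)) (D : 'M[C]_(p, q)) :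
  A *m (B *m D) = A *m B *m D.
Proof. exact: mulmxA. Qed.
Lemma CscaleD m n (c : C) (A B : 'M[C]_(m, n)) : c *: (A + B) = c *: A + c *: B.
Proof. exact: scalerDr. Qed.
Lemma CscaleN m n (c : C) (A : 'M[C]_(m, n)) : c *: (- A) = - (c *: A).
Proof. exact: scalerN. Qed.
Lemma CscaleA m n (c d : C) (A : 'M[C]_(m, n)) : c *: (d *: A) = (c * d) *: A.
Proof. exact: scalerA. Qed.
Lemma CoppD m n (A B : 'M[C]_(m, n)) : - (A + B) = - A - B.
Proof. exact: opprD. Qed.
Lemma CoppK m n (A : 'M[C]_(m, n)) : - - A = A.
Proof. exact: opprK. Qed.
Definition mx_rules := (CmulDl, CmulDr, CmulNl, CmulNr, CmulZl, CmulZr, CmulSl, CmulSr,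
  Cmul0l, Cmul0r, CmulA, CscaleD, CscaleN, CscaleA, CoppD, CoppK).

Lemma addmxE m n (A B : 'M[C]_(m, n)) i j : (A + B) i j = A i j + B i j.
Proof. by rewrite mxE. Qed.
Lemma oppmxE m n (A : 'M[C]_(m, n)) i j : (- A) i j = - A i j.
Proof. by rewrite mxE. Qed.
Lemma scalemxE m n (c : C) (A : 'M[C]_(m, n)) i j : (c *: A) i j = c * A i j.
Proof. by rewrite mxE. Qed.
Lemma scalarmxE n (c : C) i j : (c%:M : 'M[C]_n) i j = c * (i == j)%:R.
Proof. by rewrite mxE mulr_natr. Qed.
Lemma zeromxE m n i j : (0 : 'M[C]_(m, n)) i j = 0.
Proof. by rewrite mxE. Qed.
Definition entry_rules := (addmxE, oppmxE, scalemxE, scalarmxE, zeromxE).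
End ComplexRules.

Ltac mx_expand := rewrite ?mx_rules.

Ltac mx_generalize := repeat match goal with
  | |- context [@mulmx ?R ?m ?n ?p ?A ?B] => generalize (@mulmx R m n p A B); intro
  | |- context [@trmx ?R ?m ?n ?A] => generalize (@trmx R m n A); intro
  | |- context [@cbar ?R ?m ?n ?A] => generalize (@cbar R m n A); intro
  | |- context [@invmx ?R ?n ?A] => generalize (@invmx R n A); intro
  end.

Ltac mx_set := repeat match goal with
  | |- context [@mulmx ?R ?m ?n ?p ?A ?B] =>
      let x := fresh "x" in set x := (@mulmx R m n p A B); clearbody x
  | |- context [@trmx ?R ?m ?n ?A] =>
      let x := fresh "x" in set x := (@trmx R m n A); clearbody x
  | |- context [@cbar ?R ?m ?n ?A] =>
      let x := fresh "x" in set x := (@cbar R m n A); clearbody x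
  | |- context [@invmx ?R ?n ?A] =>
      let x := fresh "x" in set x := (@invmx R n A); clearbody x
  end.

Ltac mx_entries := apply/matrixP => ? ?; rewrite ?entry_rules; ring.

(** For identities that follow from expansion alone: after distribution every product, transpose,
    conjugate and inverse becomes an opaque matrix, and the linear identity that remains is checked
    entry by entry. *)
Ltac mx_ring := mx_expand; first [mx_generalize; mx_entries | mx_set; mx_entries].

Ltac tr_generalize := repeat match goal with
  | |- context [@mxtrace ?R ?n ?A] => generalize (@mxtrace R n A); intro
  end.

Ltac tr_ring := tr_generalize; ring.

Section Conjugation.
Variable R : realType.
Local Notation C := R[i].

Lemma conjcD (x y : C) : conjc (x + y) = conjc x + conjc y.
Proof. exact: rmorphD. Qed.
Lemma conjcN (x : C) : conjc (- x) = - conjc x.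
Proof. exact: rmorphN. Qed.
Lemma conjcM (x y : C) : conjc (x * y) = conjc x * conjc y.
Proof. exact: rmorphM. Qed.

Definition conjcE := (conjcD, conjcN, conjcM, @conjcK R, @conjc0 R, @conjc1 R).

Lemma cbarD m n (A B : 'M[C]_(m, n)) : cbar (A + B) = cbar A + cbar B.
Proof. exact: map_mxD. Qed.
Lemma cbarN m n (A : 'M[C]_(m, n)) : cbar (- A) = - cbar A.
Proof. exact: map_mxN. Qed.
Lemma cbarM m n p (A : 'M[C]_(m, n)) (B : 'M[C]_(n, p)) :
  cbar (A *m B) = cbar A *m cbar B.
Proof. exact: map_mxM. Qed.
Lemma cbarZ m n c (A : 'M[C]_(m, n)) : cbar (c *: A) = conjc c *: cbar A.
Proof. exact: map_mxZ. Qed.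
Lemma cbar_scalar n (c : C) : cbar (c%:M : 'M[C]_n) = (conjc c)%:M.
Proof. exact: map_scalar_mx. Qed.
Lemma cbarK m n (A : 'M[C]_(m, n)) : cbar (cbar A) = A.
Proof. by apply/matrixP => i j; rewrite !mxE conjcK. Qed.
Lemma cbar_tr m n (A : 'M[C]_(m, n)) : cbar A^T = (cbar A)^T.
Proof. by apply/matrixP => i j; rewrite !mxE. Qed.
Lemma cbar0 m n : cbar (0 : 'M[C]_(m, n)) = 0.
Proof. by apply/matrixP => i j; rewrite !mxE conjc0. Qed.
Lemma cbar_inv n (A : 'M[C]_n) : cbar (invmx A) = invmx (cbar A).
Proof. exact: map_invmx. Qed.
Lemma cbar_unit n (A : 'M[C]_n) : (cbar A \in unitmx) = (A \in unitmx).
Proof. exact: map_unitmx. Qed.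
Lemma cbar_trace n (A : 'M[C]_n) : \tr (cbar A) = conjc (\tr A).
Proof. exact: trace_map_mx. Qed.

Definition cbarE := (cbarD, cbarN, cbarM, cbarZ, cbar_scalar, cbarK, cbar_tr, cbar0).

Lemma trmxD m n (A B : 'M[C]_(m, n)) : (A + B)^T = A^T + B^T.
Proof. by rewrite linearD. Qed.
Lemma trmxN m n (A : 'M[C]_(m, n)) : (- A)^T = - A^T.
Proof. by rewrite linearN. Qed.
Lemma trmxZ m n c (A : 'M[C]_(m, n)) : (c *: A)^T = c *: A^T.
Proof. by rewrite linearZ. Qed.

Lemma trmxM m n p (A : 'M[C]_(m, n)) (B : 'M[C]_(n, p)) : (A *m B)^T = B^T *m A^T.
Proof. exact: trmx_mul. Qed.
Lemma trmxS n (c : C) : (c%:M : 'M[C]_n)^T = c%:M.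
Proof. exact: tr_scalar_mx. Qed.

Definition trmxE := (trmxD, trmxN, trmxZ, trmxM, @trmxK C, trmxS).

Lemma invmx_eq n (A B : 'M[C]_n) : A *m B = 1%:M -> invmx A = B.
Proof.
by move=> AB; have [uA _] := mulmx1_unit AB; rewrite -[B](mulKmx uA) AB mulmx1.
Qed.

Lemma trace_mx11 (A : 'M[C]_1) : \tr A = A ord0 ord0.
Proof. by rewrite /mxtrace big_ord1. Qed.

Lemma adj_norm_ge0 m n (A : 'M[C]_(m, n)) : 0 <= \tr (cadj A *m A).
Proof.
apply: sumr_ge0 => i _; rewrite !mxE; apply: sumr_ge0 => j _.
by rewrite !mxE mulrC mulcJ_ge0.
Qed.

Lemma adj_norm_gt0 m n (A : 'M[C]_(m, n)) : A != 0 -> 0 < \tr (cadj A *m A).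
Proof.
move=> A0; rewrite lt_neqAle adj_norm_ge0 andbT eq_sym; apply: contraNneq A0 => /eqP.
rewrite psumr_eq0 => [/allP H|i _]; last first.
  by rewrite !mxE; apply: sumr_ge0 => j _; rewrite !mxE mulrC mulcJ_ge0.
apply/eqP/matrixP => i j; have := H j (mem_index_enum j).
rewrite !mxE psumr_eq0 => [/allP /(_ i (mem_index_enum i))|k _]; last first.
  by rewrite !mxE mulrC mulcJ_ge0.
by rewrite !mxE mulf_eq0 conjc_eq0 orbb => /eqP.
Qed.

(** A nonzero row [v] with [v *m H = 0] would make the Hermitian form vanish at the adjoint of
    [v]. *)
Lemma posdef_unitmx n (H : 'M[C]_n) : posdefC H -> H \in unitmx.
Proof.
move=> Hp; rewrite unitmxE unitfE; apply/negP => /det0P [v v0 vH].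
have := Hp (cadj v); rewrite /cadj cbar_tr cbarK trmxK vH mul0mx mxE ltxx.
suff -> : (cbar v)^T != 0 by move=> /(_ isT).
apply: contraNneq v0 => /(congr1 trmx); rewrite trmxK trmx0 => /(congr1 (@cbar R _ _)).
by rewrite cbarK cbar0 => ->.
Qed.

Lemma posdef_congr n (T H : 'M[C]_n) : T \in unitmx -> posdefC H ->
  posdefC (cadj T *m H *m T).
Proof.
move=> uT Hp x x0.
have Tx0 : T *m x != 0.
  by apply: contraNneq x0 => Tx; rewrite -(mulKmx uT x) Tx mulmx0.
by have := Hp _ Tx0; rewrite /cadj cbarM trmx_mul !mulmxA.
Qed.

Lemma adj_unit n (A : 'M[C]_n) : (cadj A \in unitmx) = (A \in unitmx).
Proof. by rewrite /cadj unitmx_tr cbar_unit. Qed.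

End Conjugation.

(** * Cholesky factorisation over a field with involution *)

Section Cholesky.
Variables (F : numFieldType) (c : {rmorphism F -> F}).
Hypothesis cK : involutive c.
Hypothesis norm_root : forall x : F, 0 < x -> exists y, y * c y = x.

(** Induction through the Schur complement of the upper left entry. The involution is kept abstract
    because the result serves twice: with conjugation for the Hermitian [Kf], and with the identity
    for the real matrix Im v. *)
Lemma cholesky n (H : 'M[F]_n) : H^T = map_mx c H ->
  (forall x : 'cV[F]_n, x != 0 -> 0 < ((map_mx c x)^T *m H *m x) ord0 ord0) ->
  exists p : 'M[F]_n, H = p *m (map_mx c p)^T.
Proof.
elim: n H => [|n IH] H Hh Hp; first by exists 0; rewrite [LHS]flatmx0 [RHS]flatmx0.
rewrite -[n.+1]/(1 + n)%N in H Hh Hp *.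
pose a := ulsubmx H; pose b := ursubmx H; pose b' := dlsubmx H; pose d := drsubmx H.
have HE : H = block_mx a b b' d by rewrite submxK.
have [aT b'E bE dT] : [/\ a^T = map_mx c a, b'^T = map_mx c b, b^T = map_mx c b' & d^T = map_mx c d].
  by move: Hh; rewrite HE tr_block_mx map_block_mx => /eq_block_mx [].
pose al := a ord0 ord0.
have aE : a = al%:M by rewrite [LHS]mx11_scalar.
have al0 : 0 < al.
  have := Hp (col_mx 1%:M 0).
  rewrite map_col_mx map_scalar_mx rmorph1 map_mx0 tr_col_mx trmx0 trmx1 HE.
  rewrite mul_row_block mul_row_col !mul1mx !mul0mx mulmx1 mulmx0 !addr0; apply.
  apply/negP => /eqP /colP /(_ (lshift n ord0)); rewrite mxE (unsplitK (inl _)) !mxE eqxx.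
  by move/eqP; rewrite oner_eq0.
have [y yy] := norm_root al0.
have y0 : y != 0 by apply: contraTneq al0 => y0; rewrite -yy y0 mul0r ltxx.
have cy0 : c y != 0 by rewrite fmorph_eq0.
have b'E' : b' = (map_mx c b)^T by rewrite -b'E trmxK.
have cal : c al = al by rewrite -yy rmorphM /= cK mulrC.
pose S := d - al^-1 *: (b' *m b).
have [||p pE] := IH S.
- rewrite /S linearB linearZ /= trmx_mul dT b'E map_mxB map_mxZ map_mxM fmorphV cal.
  by rewrite -bE.
- move=> x x0.
  (* With this first coordinate the upper block of [H] times the vector vanishes, and the value of
     the form is that of the Schur complement [S] at [x]. *)
  have := Hp (col_mx (- (al^-1 *: (b *m x))) x).
  have -> : (col_mx (- (al^-1 *: (b *m x))) x != 0 :> 'cV_(1 + n)).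
    apply: contraNneq x0 => /(congr1 dsubmx); rewrite col_mxKd => ->.
    by apply/eqP/matrixP => i j; rewrite !mxE.
  move=> /(_ isT); congr (0 < fun_of_matrix _ _ _).
  rewrite map_col_mx tr_col_mx HE mul_row_block mul_row_col aE.
  have -> : (map_mx c (- (al^-1 *: (b *m x))))^T = - (al^-1 *: ((map_mx c x)^T *m b')).
    by rewrite map_mxN map_mxZ map_mxM fmorphV cal raddfN /= linearZ /= trmx_mul -b'E'.
  rewrite mul_mx_scalar scalerN scalerA divff ?gt_eqF// scale1r addNr mul0mx add0r.
  by congr (_ *m x); rewrite mulmxBr -scalemxAr mulmxA mulNmx -scalemxAl addrC.
exists (block_mx y%:M 0 ((c y)^-1 *: b') p).
rewrite HE map_block_mx tr_block_mx mulmx_block map_mx0 trmx0 !(mulmx0, mul0mx, addr0).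
rewrite map_scalar_mx tr_scalar_mx -scalar_mxM yy aE; congr block_mx.
- by rewrite mul_scalar_mx map_mxZ linearZ /= fmorphV cK scalerA divff// scale1r -bE trmxK.
- by rewrite mul_mx_scalar scalerA divff// scale1r.
rewrite -pE map_mxZ linearZ /= fmorphV cK -scalemxAl -scalemxAr scalerA.
rewrite -invfM [c y * y]mulrC yy.
by rewrite -bE trmxK /S addrC subrK.
Qed.

End Cholesky.

(* The fibre isomorphism is L_W(a) = (p1 + q1 W) a + (p2 + q2 W) abar.  The ball
   is the case (p1, p2, q1, q2) = (1, 0, 0, -1), the upper half plane the case
   (1/2, 1/2, 1/(2i), -1/(2i)), where Pc and Qc below are the real and
   imaginary parts. *)
Record coeffs (R : realType) := Coeffs { cp1 : R[i]; cp2 : R[i]; cq1 : R[i]; cq2 : R[i] }.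

(** Meant for A = l1, B = l2, with primes for conjugates: the block matrix is then [L_W] acting on
    pairs (a, conj a). The hypotheses exhibit a right inverse; a right inverse of a square matrix is
    a left inverse, and the conclusions are the first row of that product. *)
Lemma block2_inv (R : realType) n (A B A' B' P Q : 'M[R[i]]_n) :
  A *m B = B *m A -> A' *m B' = B' *m A' ->
  (A *m A' - B *m B') *m P = 1%:M -> (A' *m A - B' *m B) *m Q = 1%:M ->
  A' *m P *m A - B *m Q *m B' = 1%:M /\ A' *m P *m B = B *m Q *m A'.
Proof.
move=> AB AB' EP EQ.
have : block_mx A B B' A' *m
   block_mx (A' *m P) (- (B *m Q)) (- (B' *m P)) (A *m Q) = 1%:M.
  rewrite mulmx_block [RHS]scalar_mx_block; congr block_mx.
  - by rewrite -EP; mx_ring.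
  - by rewrite mulmxN !mulmxA AB addNr.
  - by rewrite mulmxN !mulmxA AB' subrr.
  - by rewrite -EQ; mx_ring.
move=> /mulmx1C; rewrite mulmx_block scalar_mx_block => /eq_block_mx [E1 E2 _ _].
split; first by rewrite -E1 mulNmx.
by apply/eqP; rewrite -subr_eq0 -E2 mulNmx addrC.
Qed.

(** * The fibre isomorphism and the Hermitian weight *)

Section Domain.
Variables (R : realType) (n : nat) (k : coeffs R).
Local Notation C := R[i].
Local Notation p1 := (cp1 k).
Local Notation p2 := (cp2 k).
Local Notation q1 := (cq1 k).
Local Notation q2 := (cq2 k).
Implicit Types (W X Y : 'M[C]_n) (a b z : 'cV[C]_n).

Definition Pc a : 'cV[C]_n := locked (p1 *: a + p2 *: cbar a).
Definition Qc a : 'cV[C]_n := locked (q1 *: a + q2 *: cbar a).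
Definition l1 W : 'M[C]_n := locked (p1%:M + q1 *: W).
Definition l2 W : 'M[C]_n := locked (p2%:M + q2 *: W).
Definition Lf W a : 'cV[C]_n := locked (l1 W *m a + l2 W *m cbar a).
Definition Kf W : 'M[C]_n := locked (l1 W *m cbar (l1 W) - l2 W *m cbar (l2 W)).
Definition Pf W : 'M[C]_n := locked (invmx (Kf W)).
(** The inverse of [L_W], found by solving z = l1 a + l2 conj(a) together with its conjugate, which
    is possible in closed form because l1 and l2 commute. *)
Definition Li W z : 'cV[C]_n :=
  locked (cbar (l1 W) *m Pf W *m z - l2 W *m cbar (Pf W) *m cbar z).
Definition dom W : Prop := W = W^T /\ posdefC (Kf W).

(** With [ce1] and [ce2], the coefficients of [Kf] as a polynomial in W and its conjugate: e0
    constant, e1 at W, conj(e1) at conj(W), e2 at W conj(W). *)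
Definition ce0 : C := p1 * conjc p1 - p2 * conjc p2.
Definition ce1 : C := q1 * conjc p1 - q2 * conjc p2.
Definition ce2 : C := q1 * conjc q1 - q2 * conjc q2.

Lemma PcE a : Pc a = p1 *: a + p2 *: cbar a. Proof. by rewrite /Pc -lock. Qed.
Lemma QcE a : Qc a = q1 *: a + q2 *: cbar a. Proof. by rewrite /Qc -lock. Qed.
Lemma Lf_l12 W a : Lf W a = l1 W *m a + l2 W *m cbar a.
Proof. by rewrite /Lf -lock. Qed.
Lemma Li_l12 W z :
  Li W z = cbar (l1 W) *m Pf W *m z - l2 W *m cbar (Pf W) *m cbar z.
Proof. by rewrite /Li -lock. Qed.
Lemma l1E W : l1 W = p1%:M + q1 *: W. Proof. by rewrite /l1 -lock. Qed.
Lemma l2E W : l2 W = p2%:M + q2 *: W. Proof. by rewrite /l2 -lock. Qed.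
Lemma Kf_l12 W : Kf W = l1 W *m cbar (l1 W) - l2 W *m cbar (l2 W).
Proof. by rewrite /Kf -lock. Qed.
Lemma Pf_inv W : Pf W = invmx (Kf W). Proof. by rewrite /Pf -lock. Qed.

(** Isolates the dependence on W: differentiating [L_W a] therefore adds the term dW Q(a) to
    L_W(da). *)
Lemma LfE W a : Lf W a = Pc a + W *m Qc a.
Proof. by rewrite Lf_l12 PcE QcE l1E l2E; mx_ring. Qed.

Lemma KfE W : Kf W = ce0%:M + ce1 *: W + conjc ce1 *: cbar W + ce2 *: (W *m cbar W).
Proof.
by rewrite Kf_l12 !l1E !l2E /ce0 /ce1 /ce2 !cbarE !conjcE; mx_ring.
Qed.

Lemma l12C W : l1 W *m l2 W = l2 W *m l1 W.
Proof. by rewrite l1E l2E; mx_ring. Qed.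

Lemma cbar_Kf W : cbar (Kf W) = cbar (l1 W) *m l1 W - cbar (l2 W) *m l2 W.
Proof. by rewrite Kf_l12 !cbarE. Qed.

Section Unit.
Variable W : 'M[C]_n.
Hypothesis KW : Kf W \in unitmx.

Let KP : Kf W *m Pf W = 1%:M. Proof. by rewrite Pf_inv mulmxV. Qed.
Let cKP : cbar (Kf W) *m cbar (Pf W) = 1%:M.
Proof. by rewrite -cbarM KP cbar_scalar conjc1. Qed.

Lemma LiK2 :
  cbar (l1 W) *m Pf W *m l1 W - l2 W *m cbar (Pf W) *m cbar (l2 W) = 1%:M /\
  cbar (l1 W) *m Pf W *m l2 W = l2 W *m cbar (Pf W) *m cbar (l1 W).
Proof.
apply: block2_inv; first exact: l12C.
- by rewrite -!cbarM l12C.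
- by rewrite -Kf_l12.
- by rewrite -cbar_Kf cKP.
Qed.

Lemma LiK a : Li W (Lf W a) = a.
Proof.
have [E1 E2] := LiK2.
rewrite Li_l12 Lf_l12 !cbarE; mx_expand.
rewrite E2 -[RHS]mul1mx -E1; mx_ring.
Qed.

Lemma LfK z : Lf W (Li W z) = z.
Proof.
rewrite Li_l12 Lf_l12 !cbarE; mx_expand.
rewrite l12C -[RHS]mul1mx -KP Kf_l12; mx_ring.
Qed.

End Unit.

Lemma conj_ce0 : conjc ce0 = ce0.
Proof. by rewrite /ce0 !conjcE; ring. Qed.

Lemma conj_ce2 : conjc ce2 = ce2.
Proof. by rewrite /ce2 !conjcE; ring. Qed.

Lemma l1_tr W : W = W^T -> (l1 W)^T = l1 W.
Proof. by move=> Ws; rewrite l1E !trmxE -Ws. Qed.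

Lemma l2_tr W : W = W^T -> (l2 W)^T = l2 W.
Proof. by move=> Ws; rewrite l2E !trmxE -Ws. Qed.

Lemma Kf_tr W : W = W^T -> (Kf W)^T = cbar (Kf W).
Proof.
by move=> Ws; rewrite Kf_l12 !(cbarE, trmxE) -!cbar_tr l1_tr// l2_tr.
Qed.

Lemma Pf_tr W : W = W^T -> (Pf W)^T = cbar (Pf W).
Proof. by move=> Ws; rewrite Pf_inv trmx_inv Kf_tr// cbar_inv. Qed.

Lemma dom_unit W : dom W -> Kf W \in unitmx.
Proof. by case=> _ /posdef_unitmx. Qed.

Lemma Pf_cholesky W : dom W -> exists2 t, t \in unitmx & Pf W = t *m cadj t.
Proof.
move=> dW; have [Ws Wp] := dW; have uK := dom_unit dW.
have [|x x0|||u Ku] := @cholesky R[i] (conjc : {rmorphism C -> C}) _ _ n (Kf W).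
- exact: conjcK.
(* The square root of a positive number is real, hence equal to its own conjugate. *)
- exists (sqrtc x).
  have : 0 <= sqrtc x by rewrite sqrtc_ge0 ltW.
  by move=> /ger0_Im sx; rewrite -[RHS]sqr_sqrtc expr2; case: (sqrtc x) sx => a b /= ->; rewrite oppr0.
- exact: Kf_tr.
- exact: Wp.
have uu : u \in unitmx by move: uK; rewrite Ku unitmx_mul => /andP[].
(* From Kf = u u^* the inverse is t t^* with t the inverse of u^*. *)
exists (invmx (cadj u)); first by rewrite unitmx_inv adj_unit.
have -> : cadj (invmx (cadj u)) = invmx u.
  by rewrite /cadj cbar_inv cbar_tr cbarK trmx_inv trmxK.
rewrite Pf_inv Ku; apply: (canRL (mulKmx _)); first by rewrite adj_unit.
have uu' : u *m cadj u \in unitmx by rewrite unitmx_mul adj_unit uu.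
by rewrite -[LHS](mulKmx uu) [X in _ *m X]mulmxA mulmxV// mulmx1.
Qed.

(** The two-form Tr(A^t conj(P) /\ conj(A)), where [a] and [b] are the values of the one-form A on
    two tangent vectors. *)
Definition fib (P : 'M[C]_n) a b : C :=
  \tr (a^T *m cbar P *m cbar b) - \tr (b^T *m cbar P *m cbar a).

(** The two-form Tr(B /\ conj(B)) with B = P dW, on two values of dW; for P = (1 - W conj(W))^-1 it
    is the Siegel term of the ball. *)
Definition sieg (P : 'M[C]_n) X Y : C :=
  \tr (P *m X *m cbar (P *m Y)) - \tr (P *m Y *m cbar (P *m X)).

Definition gform (c : C) P a X b Y : C := 'i%C * (c * sieg P X Y + fib P a b).

(* L_W is an isometry from the constant symplectic form of C^n onto the
   Pf-weighted one: this is what makes the form flat in the coordinate eta. *)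
Lemma fib_Lf W a b : dom W ->
  fib (Pf W) (Lf W a) (Lf W b) = \tr (a^T *m cbar b) - \tr (b^T *m cbar a).
Proof.
move=> dW; have [Ws _] := dW.
have [E1 E2] := LiK2 (dom_unit dW).
have Pt := Pf_tr Ws; have l1t := l1_tr Ws; have l2t := l2_tr Ws.
rewrite /fib !Lf_l12 !trmxE l1t l2t !cbarE.
move: (l1 W) (l2 W) (Pf W) l1t l2t Pt E1 E2 => A B P At Bt Pt E1 E2.
have T1 : A *m cbar P *m cbar A = 1%:M + cbar B *m P *m B.
  have := congr1 (@cbar R n n) E1; rewrite !cbarE conjc1 => <-.
  by rewrite subrK.
have T2 : A *m cbar P *m cbar B = cbar B *m P *m A.
  by have := congr1 (@cbar R n n) E2; rewrite !cbarE.
have Pt' : (cbar P)^T = P by rewrite -cbar_tr Pt cbarK.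
have At' : (cbar A)^T = cbar A by rewrite -cbar_tr At.
have Bt' : (cbar B)^T = cbar B by rewrite -cbar_tr Bt.
(* Of the five terms only the first survives antisymmetrisation in u and v: the second and the fifth
   are exchanged, while the third and the fourth are symmetric by [Y] and [Z]. *)
have X (u v : 'cV[C]_n) : \tr ((u^T *m A + (cbar u)^T *m B) *m cbar P *m (cbar A *m cbar v + cbar B *m v))
  = \tr (u^T *m cbar v) + \tr (u^T *m (cbar B *m P *m B) *m cbar v)
    + \tr (u^T *m (A *m cbar P *m cbar B) *m v)
    + \tr ((cbar u)^T *m (cbar A *m P *m B)^T *m cbar v)
    + \tr (v^T *m (cbar B *m P *m B) *m cbar u).
  rewrite -[\tr (v^T *m _ *m _)]mxtrace_tr !trmxE Pt Bt Bt'.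
  rewrite At' -!mxtraceD; congr (\tr _).
  have -> : u^T *m cbar v + u^T *m (cbar B *m P *m B) *m cbar v =
     u^T *m (A *m cbar P *m cbar A) *m cbar v by rewrite T1; mx_ring.
  by mx_ring.
have Y (u v : 'cV[C]_n) : \tr (u^T *m (A *m cbar P *m cbar B) *m v)
           = \tr (v^T *m (A *m cbar P *m cbar B) *m u).
  by rewrite [in LHS]T2 -[LHS]mxtrace_tr !trmxE Pt At Bt' !mulmxA.
have Z (u v : 'cV[C]_n) : \tr ((cbar u)^T *m (cbar A *m P *m B)^T *m cbar v)
           = \tr ((cbar v)^T *m (cbar A *m P *m B)^T *m cbar u).
  by rewrite -[LHS]mxtrace_tr !trmxE Pt At' Bt E2 !mulmxA.
by rewrite !X (Y b a) (Z b a); tr_ring.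
Qed.

Lemma fib_congr N P a b : N \in unitmx ->
  fib (cadj N *m P *m N) (invmx N *m a) (invmx N *m b) = fib P a b.
Proof.
move=> uN; have uN' : N^T \in unitmx by rewrite unitmx_tr.
have ucN : cbar N \in unitmx by rewrite cbar_unit.
have E u v : (invmx N *m u)^T *m cbar (cadj N *m P *m N) *m cbar (invmx N *m v)
           = u^T *m cbar P *m cbar v.
  rewrite /cadj !trmxE !cbarE trmx_inv cbar_inv !mulmxA.
  by rewrite (mulmxKV uN') (mulmxK ucN).
by rewrite /fib !E.
Qed.

(** The inner factors N cancel directly; the outer N^* meets its inverse after a cyclic rotation
    under the trace. *)
Lemma sieg_congr N P X Y : N \in unitmx ->
  sieg (cadj N *m P *m N) (invmx N *m X *m (invmx N)^T) (invmx N *m Y *m (invmx N)^T)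
  = sieg P X Y.
Proof.
move=> uN; have uN' : N^T \in unitmx by rewrite unitmx_tr.
have ucN : cbar N \in unitmx by rewrite cbar_unit.
have uaN : cadj N \in unitmx by rewrite adj_unit.
have E (U V : 'M[C]_n) :
  \tr (cadj N *m P *m N *m (invmx N *m U *m (invmx N)^T) *m
    cbar (cadj N *m P *m N *m (invmx N *m V *m (invmx N)^T)))
  = \tr (P *m U *m cbar (P *m V)).
  have -> : cadj N *m P *m N *m (invmx N *m U *m (invmx N)^T)
          = cadj N *m (P *m U *m invmx N^T).
    by rewrite trmx_inv !mulmxA (mulmxK uN).
  have -> : cbar (cadj N *m P *m N *m (invmx N *m V *m (invmx N)^T))
          = N^T *m (cbar (P *m V) *m invmx (cadj N)).
    by rewrite trmx_inv /cadj !cbarE !cbar_inv !mulmxA (mulmxK ucN) cbar_tr.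
  rewrite -mulmxA mxtrace_mulC !mulmxA (mulmxKV uN') mulmxKV//.
exact: (f_equal2 (fun u v : C => u - v) (E X Y) (E Y X)).
Qed.

Lemma gform_congr c N P a X b Y : N \in unitmx ->
  gform c (cadj N *m P *m N)
    (invmx N *m a) (invmx N *m X *m (invmx N)^T)
    (invmx N *m b) (invmx N *m Y *m (invmx N)^T) = gform c P a X b Y.
Proof.
move=> uN; exact: (f_equal2 (fun u v : C => 'i%C * (c * u + v))
  (sieg_congr _ _ _ uN) (fib_congr _ _ _ uN)).
Qed.

Lemma conj_i : conjc ('i%C : C) = - 'i%C.
Proof. by apply/eqP; rewrite eq_complex /= oppr0 !eqxx. Qed.

Lemma ii : 'i%C * 'i%C = -1 :> C.
Proof. by rewrite -expr2 sqr_i. Qed.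

Lemma gform_i c P a X b Y :
  gform c P ('i%C *: a) ('i%C *: X) ('i%C *: b) ('i%C *: Y) = gform c P a X b Y.
Proof.
rewrite /gform /sieg /fib !cbarE !trmxE conj_i; mx_expand.
by rewrite !mxtraceZ !mulNr !ii; tr_ring.
Qed.

Lemma gform_antisym c P a X b Y : gform c P a X b Y = - gform c P b Y a X.
Proof. by rewrite /gform /sieg /fib; tr_ring. Qed.

Lemma gform_addl c P a X a' X' b Y :
  gform c P (a + a') (X + X') b Y = gform c P a X b Y + gform c P a' X' b Y.
Proof.
by rewrite /gform /sieg /fib !cbarE !trmxE; mx_expand; rewrite !mxtraceD; tr_ring.
Qed.

Lemma gform_scalel c P (x : R) a X b Y :
  gform c P (x%:C%C *: a) (x%:C%C *: X) b Y = x%:C%C * gform c P a X b Y.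
Proof.
rewrite /gform /sieg /fib !cbarE !trmxE; mx_expand.
by rewrite conjc_real !mxtraceZ; tr_ring.
Qed.

(** Conjugation exchanges the two traces of each antisymmetrised pair, and the resulting sign is
    absorbed by the conjugate of the prefactor i. *)
Lemma gform_real (c : R) P a X b Y : P^T = cbar P ->
  complex.Im (gform c%:C%C P a X b Y) = 0.
Proof.
move=> Pt.
suff : conjc (gform c%:C%C P a X b Y) = gform c%:C%C P a X b Y.
  case: (gform _ _ _ _ _ _) => u v /= [] /eqP; rewrite eq_sym -subr_eq0 opprK -mulr2n mulrn_eq0 /=.
  by move=> /eqP.
rewrite /gform /sieg /fib !conjcE conj_i conjc_real -!cbar_trace.
have F (u v : 'cV[C]_n) : \tr (cbar (u^T *m cbar P *m cbar v)) = \tr (v^T *m cbar P *m cbar u).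
  by rewrite -[LHS]mxtrace_tr !cbarE !trmxE Pt !mulmxA.
have S (U V : 'M[C]_n) : \tr (cbar (P *m U *m cbar (P *m V))) = \tr (P *m V *m cbar (P *m U)).
  by rewrite [LHS]/= !cbarE mxtrace_mulC.
by rewrite !F !S; tr_ring.
Qed.

(** With Pf = t t^*, b = t^T conj(a) and Y = t^T conj(X) t, the value on a vector and i times it is
    2 (c |Y|^2 + |b|^2) in Frobenius norms; t is invertible, so b and Y cannot both vanish. *)
Lemma gform_pos (c : R) W a X : 0 < c -> dom W -> X = X^T ->
  ~~ ((a == 0) && (X == 0)) ->
  0 < gform c%:C%C (Pf W) a X ('i%C *: a) ('i%C *: X).
Proof.
move=> c0 dW Xs aX; have [t ut Pt] := Pf_cholesky dW.
have cXs : (cbar X)^T = cbar X by rewrite -cbar_tr -Xs.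
pose b := t^T *m cbar a; pose Y := t^T *m cbar X *m t.
have -> : gform c%:C%C (Pf W) a X ('i%C *: a) ('i%C *: X) =
  2 * (c%:C%C * \tr (cadj Y *m Y) + \tr (cadj b *m b)).
  have S : \tr (cadj Y *m Y) = \tr (Pf W *m X *m cbar (Pf W *m X)).
    rewrite Pt /Y /cadj !cbarE !trmxE -Xs.
    by rewrite !CmulA -!(CmulA t) [RHS]mxtrace_mulC.
  have F : \tr (cadj b *m b) = \tr (a^T *m cbar (Pf W) *m cbar a).
    by rewrite Pt /b /cadj !cbarE !trmxE ?cbarE !CmulA.
  rewrite S F /gform /sieg /fib !cbarE !trmxE conj_i; mx_expand.
  rewrite !mxtraceZ !mulNr.
  have E (u v : C) : 'i%C * (c%:C%C * (- ('i%C * u) - 'i%C * u) + (- ('i%C * v) - 'i%C * v))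
     = - ('i%C * 'i%C) * (2 * (c%:C%C * u + v)) by ring.
  by rewrite E ii opprK mul1r.
apply: mulr_gt0; first by rewrite ltr0n.
have c0' : 0 < c%:C%C :> C by rewrite ltcR.
have utT : t^T \in unitmx by rewrite unitmx_tr.
have b0 : a != 0 -> b != 0.
  move=> a0; apply: contraNneq a0 => b0.
  have : cbar a = 0 by rewrite -(mulKmx utT (cbar a)) -/b b0 mulmx0.
  by move=> /(congr1 (@cbar R _ _)); rewrite cbarK cbar0 => ->.
have Y0 : X != 0 -> Y != 0.
  move=> X0; apply: contraNneq X0 => Y0.
  have : cbar X = 0.
    by rewrite -(mulKmx utT (cbar X)) -[t^T *m cbar X](mulmxK ut) -/Y Y0 mul0mx mulmx0.
  by move=> /(congr1 (@cbar R _ _)); rewrite cbarK cbar0 => ->.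
have [a0|a0] := eqVneq a 0.
  rewrite ltr_wpDr ?adj_norm_ge0// mulr_gt0// adj_norm_gt0//; apply: Y0.
  by move: aX; rewrite a0 eqxx.
by rewrite ltr_wpDl ?adj_norm_gt0 ?b0// mulr_ge0 ?adj_norm_ge0// ltW.
Qed.

End Domain.

(* W |-> (p W + q)(r W + s)^-1, eta |-> rho1 (eta + al) + rho2 (eta + al)bar. *)
Record coeff_transf (R : realType) (n : nat) := CoeffTransf {
  tp : 'M[R[i]]_n; tq : 'M[R[i]]_n; tr : 'M[R[i]]_n; ts : 'M[R[i]]_n;
  trho1 : 'M[R[i]]_n; trho2 : 'M[R[i]]_n; tal : 'cV[R[i]]_n }.

(** * Fractional linear transformations and their automorphy factor *)

Section Action.
Variables (R : realType) (n : nat) (k : coeffs R).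
Local Notation C := R[i].
Implicit Types (W X : 'M[C]_n) (a z : 'cV[C]_n) (g : coeff_transf R n).

Definition zden g W : 'M[C]_n := locked (tr g *m W + ts g).
(** The automorphy factor N(W); on symmetric W it is the transpose of the denominator [zden]. *)
Definition nden g W : 'M[C]_n := locked (W *m (tr g)^T + (ts g)^T).
Definition Wact g W : 'M[C]_n := locked ((tp g *m W + tq g) *m invmx (zden g W)).
Definition rho g a : 'cV[C]_n := trho1 g *m a + trho2 g *m cbar a.
(** Both fibre actions have this shape: z + alpha - W conj(alpha) on the ball and u + v n + m on the
    half plane are each z + L_W(alpha). *)
Definition zact g z W : 'cV[C]_n := invmx (nden g W) *m (z + Lf k W (tal g)).
Definition eact g a : 'cV[C]_n := rho g (a + tal g).

Lemma zdenE g W : zden g W = tr g *m W + ts g.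
Proof. by rewrite /zden -lock. Qed.
Lemma ndenE g W : nden g W = W *m (tr g)^T + (ts g)^T.
Proof. by rewrite /nden -lock. Qed.
Lemma WactE g W : Wact g W = (tp g *m W + tq g) *m invmx (zden g W).
Proof. by rewrite /Wact -lock. Qed.

(* The first group says that the matrix with blocks p, q, r, s is symplectic, the
   second that it preserves the Hermitian form with blocks e2, e1, e1bar, e0 that
   defines the domain, and the third that rho intertwines L_W and L_(g W). *)
Definition admissible g : Prop :=
  let p := tp g in let q := tq g in let r := tr g in let s := ts g in
  let e0 := ce0 k in let e1 := ce1 k in let e2 := ce2 k in
  [/\ [/\ p^T *m s - r^T *m q = 1%:M, p^T *m r = r^T *m p & q^T *m s = s^T *m q],
      [/\ e0 *: (r^T *m cbar r) + conjc e1 *: (r^T *m cbar p)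
            + e1 *: (p^T *m cbar r) + e2 *: (p^T *m cbar p) = e2%:M,
          e0 *: (r^T *m cbar s) + conjc e1 *: (r^T *m cbar q)
            + e1 *: (p^T *m cbar s) + e2 *: (p^T *m cbar q) = e1%:M,
          e0 *: (s^T *m cbar r) + conjc e1 *: (s^T *m cbar p)
            + e1 *: (q^T *m cbar r) + e2 *: (q^T *m cbar p) = (conjc e1)%:M
        & e0 *: (s^T *m cbar s) + conjc e1 *: (s^T *m cbar q)
            + e1 *: (q^T *m cbar s) + e2 *: (q^T *m cbar q) = e0%:M]
    & forall a, p^T *m Qc k (rho g a) + r^T *m Pc k (rho g a) = Qc k a
             /\ q^T *m Qc k (rho g a) + s^T *m Pc k (rho g a) = Pc k a].

Variable g : coeff_transf R n.
Hypothesis gadm : admissible g.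
Hypothesis e2_le0 : ce2 k <= 0.
Variable W : 'M[C]_n.
Hypothesis dW : dom k W.

Local Notation p := (tp g).
Local Notation q := (tq g).
Local Notation r := (tr g).
Local Notation s := (ts g).
Local Notation N := (nden g W).
Local Notation U := (W *m p^T + q^T).

Let Ws : W = W^T. Proof. by case: dW. Qed.

Lemma zden_tr : (zden g W)^T = N.
Proof. by rewrite zdenE ndenE !trmxE -Ws. Qed.

Lemma num_tr : (p *m W + q)^T = U.
Proof. by rewrite !trmxE -Ws. Qed.

(** [Kf W] is the Hermitian form with blocks e2, e1, conj(e1), e0 evaluated on the row (W, 1). The
    row (U, N) is the product of (W, 1) with the transpose of g, which preserves that form. *)
Lemma Kf_transf : ce0 k *: (N *m cadj N) + conjc (ce1 k) *: (N *m cadj U)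
  + ce1 k *: (U *m cadj N) + ce2 k *: (U *m cadj U) = Kf k W.
Proof.
have [_ [h1 h2 h3 h4] _] := gadm.
have cN : cadj N = cbar r *m cbar W + cbar s.
  by rewrite /cadj ndenE !cbarE !trmxE -cbar_tr -Ws.
have cU : cadj U = cbar p *m cbar W + cbar q.
  by rewrite /cadj !cbarE !trmxE -cbar_tr -Ws.
rewrite cN cU KfE ndenE.
move: (ce0 k) (ce1 k) (conjc (ce1 k)) (ce2 k) h1 h2 h3 h4 => e0 e1 e1' e2 h1 h2 h3 h4.
have -> : e0%:M + e1 *: W + e1' *: cbar W + e2 *: (W *m cbar W) =
  e0%:M + W *m e1%:M + e1'%:M *m cbar W + W *m e2%:M *m cbar W by mx_ring.
by rewrite -h1 -h2 -h3 -{1}h4; mx_ring.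
Qed.

(** If v N = 0 for a row v != 0, [Kf_transf] leaves v Kf v^* = e2 |v U|^2 <= 0, against the
    positivity of Kf. This is where the sign of [ce2] enters. *)
Lemma nden_unit : N \in unitmx.
Proof.
rewrite unitmxE unitfE; apply/negP => /det0P [v v0 vN].
have [_ Kp] := dW; have := Kp (cadj v).
have -> : cadj v != 0.
  apply: contraNneq v0 => /(congr1 trmx); rewrite /cadj trmxK trmx0 => /(congr1 (@cbar R _ _)).
  by rewrite cbarK cbar0 => ->.
have -> : cadj (cadj v) = v by rewrite /cadj cbar_tr cbarK trmxK.
have Nv : cadj N *m cadj v = 0 by rewrite /cadj -trmxM -cbarM vN cbar0 trmx0.
have -> : v *m Kf k W *m cadj v = ce2 k *: (cadj (cadj (v *m U)) *m cadj (v *m U)).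
  rewrite -Kf_transf.
  have -> : cadj (cadj (v *m U)) = v *m U by rewrite /cadj cbar_tr cbarK trmxK.
  have -> : cadj (v *m U) = cadj U *m cadj v by rewrite /cadj cbarM trmxM.
  move: (nden g W) (W *m p^T + q^T) vN Nv => N0 U0 vN Nv.
  have -> : v *m (ce0 k *: (N0 *m cadj N0) + conjc (ce1 k) *: (N0 *m cadj U0)
      + ce1 k *: (U0 *m cadj N0) + ce2 k *: (U0 *m cadj U0)) *m cadj v
    = ce0 k *: (v *m N0 *m (cadj N0 *m cadj v)) + conjc (ce1 k) *: (v *m N0 *m (cadj U0 *m cadj v))
      + ce1 k *: (v *m U0 *m (cadj N0 *m cadj v)) + ce2 k *: (v *m U0 *m (cadj U0 *m cadj v)).
    by rewrite /cadj; mx_ring.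
  by rewrite vN Nv !Cmul0l Cmul0r !scaler0 !add0r.
move=> /(_ isT); rewrite mxE -trace_mx11 => /lt_geF.
by rewrite mulr_le0_ge0 ?adj_norm_ge0.
Qed.

Lemma zden_unit : zden g W \in unitmx.
Proof. by rewrite -unitmx_tr zden_tr nden_unit. Qed.

(** After cross-multiplication both sides are quadratic in W and agree coefficientwise by the
    symplectic relations. The identity also yields the symmetry of W_1. *)
Lemma Wact_left : Wact g W = invmx N *m U.
Proof.
have [[h1 h2 h3] _ _] := gadm.
apply: (canRL (mulKmx nden_unit)); rewrite WactE mulmxA.
apply: (canLR (mulmxK zden_unit)); rewrite zdenE ndenE.
have h1' : s^T *m p = q^T *m r + 1%:M.
  by have := congr1 trmx h1; rewrite !trmxE => <-; rewrite addrC subrK.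
have h4 : p^T *m s = r^T *m q + 1%:M by rewrite -h1 addrC subrK.
have -> : (W *m r^T + s^T) *m (p *m W + q) = W *m (r^T *m p) *m W
   + W *m (r^T *m q) + (s^T *m p) *m W + s^T *m q by mx_ring.
have -> : (W *m p^T + q^T) *m (r *m W + s) = W *m (p^T *m r) *m W
   + W *m (p^T *m s) + (q^T *m r) *m W + q^T *m s by mx_ring.
by rewrite h1' h4 h2 h3; mx_ring.
Qed.

Lemma nden_Wact : N *m Wact g W = U.
Proof. by rewrite Wact_left mulKVmx// nden_unit. Qed.

Lemma Wact_sym : Wact g W = (Wact g W)^T.
Proof.
rewrite [in RHS]WactE trmxM trmx_inv zden_tr num_tr.
exact: Wact_left.
Qed.

(** Since U = N W_1, the row (U, N) of [Kf_transf] is N times the row (W_1, 1). *)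
Lemma Kf_Wact : N *m Kf k (Wact g W) *m cadj N = Kf k W.
Proof.
have WN : cbar (Wact g W) *m cadj N = cadj U.
  rewrite /cadj -nden_Wact cbarM trmxM; congr (_ *m _).
  by rewrite -cbar_tr -Wact_sym.
have UE := nden_Wact.
rewrite KfE -[RHS]Kf_transf -WN -UE /cadj.
by move: (Wact g W) (nden g W) => W1 N1; mx_ring.
Qed.

Lemma Kf_WactE : Kf k (Wact g W) = cadj (invmx (cadj N)) *m Kf k W *m invmx (cadj N).
Proof.
have uN := nden_unit; have uaN : cadj N \in unitmx by rewrite adj_unit.
have -> : cadj (invmx (cadj N)) = invmx N.
  by rewrite /cadj cbar_inv cbar_tr cbarK trmx_inv trmxK.
by rewrite -Kf_Wact -!mulmxA mulmxV// mulmx1 mulKmx.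
Qed.

Lemma Wact_dom : dom k (Wact g W).
Proof.
split; first exact: Wact_sym.
rewrite Kf_WactE; apply: posdef_congr; last by case: dW.
by rewrite unitmx_inv adj_unit nden_unit.
Qed.

Lemma Pf_Wact : Pf k (Wact g W) = cadj N *m Pf k W *m N.
Proof.
have uN := nden_unit; have uaN : cadj N \in unitmx by rewrite adj_unit.
have uK := dom_unit Wact_dom.
have uKW := dom_unit dW.
rewrite !Pf_inv.
have -> : Kf k (Wact g W) = invmx N *m (Kf k W *m invmx (cadj N)).
  by rewrite -Kf_Wact mulmxK// mulKmx.
by apply: invmx_eq; rewrite !mulmxA mulmxKV// mulmxK// mulVmx.
Qed.

Lemma Lf_Wact a : Lf k (Wact g W) (rho g a) = invmx N *m Lf k W a.
Proof.
apply: (canRL (mulKmx nden_unit)).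
have [_ _ /(_ a) [hQ hP]] := gadm.
rewrite !LfE CmulDr CmulA nden_Wact ndenE -hQ -hP; mx_ring.
Qed.

(** The quotient rule for W_1 produces the left factor p - W_1 r; this identifies it, and makes dW_1
    a congruence of dW. *)
Lemma Wact_den : invmx N = p - Wact g W *m r.
Proof.
have [[h1 h2 h3] _ _] := gadm.
have h1' : s^T *m p = q^T *m r + 1%:M.
  by have := congr1 trmx h1; rewrite !trmxE => <-; rewrite addrC subrK.
rewrite -[RHS](mulKmx nden_unit); rewrite CmulDr CmulNr CmulA nden_Wact.
suff -> : N *m p - U *m r = 1%:M by rewrite mulmx1.
have -> : N *m p - U *m r = W *m (r^T *m p) + s^T *m p - W *m (p^T *m r) - q^T *m r.
  by rewrite ndenE; mx_ring.
by rewrite h1' h2; mx_ring.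
Qed.

End Action.

(* The two models list the matrix and the vector coordinate in opposite orders. *)
Record chart (R : realType) (n : nat) (V : normedModType R) := Chart {
  zp : V -> cmx R n 1;
  Wp : V -> cmx R n n;
  mkp : cmx R n 1 * cmx R n n -> V;
  zp_linear : linear zp;
  zp_continuous : continuous zp;
  Wp_linear : linear Wp;
  Wp_continuous : continuous Wp;
  mkp_linear : linear mkp;
  mkp_continuous : continuous mkp;
  zp_mkp : forall u, zp (mkp u) = u.1;
  Wp_mkp : forall u, Wp (mkp u) = u.2;
  mkpK : forall x, mkp (zp x, Wp x) = x }.

(** * Coordinates and openness of the domain *)

Section ChartCalculus.
Variables (R : realType) (n : nat) (V : normedModType R) (k : coeffs R) (ch : chart n V).
Local Notation C := R[i].
Implicit Types (x X Y : V).

Definition zz x : 'cV[C]_n := locked (cplx (zp ch x)).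
Definition WW x : 'M[C]_n := locked (cplx (Wp ch x)).
Definition mk (a : 'cV[C]_n) (B : 'M[C]_n) : V := mkp ch (reim a, reim B).

Lemma zzE x : zz x = cplx (zp ch x). Proof. by rewrite /zz -lock. Qed.
Lemma WWE x : WW x = cplx (Wp ch x). Proof. by rewrite /WW -lock. Qed.

Lemma zz_fun : zz = (fun x => cplx (zp ch x)).
Proof. by apply/funext => x; exact: zzE. Qed.
Lemma WW_fun : WW = (fun x => cplx (Wp ch x)).
Proof. by apply/funext => x; exact: WWE. Qed.

Lemma zz_mk a B : zz (mk a B) = a.
Proof. by rewrite zzE /mk zp_mkp reimK. Qed.

Lemma WW_mk a B : WW (mk a B) = B.
Proof. by rewrite WWE /mk Wp_mkp reimK. Qed.

Lemma mk_coord x : mk (zz x) (WW x) = x.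
Proof. by rewrite /mk zzE WWE !cplxK mkpK. Qed.

Lemma coord_inj x y : zz x = zz y -> WW x = WW y -> x = y.
Proof. by move=> ez eW; rewrite -(mk_coord x) -(mk_coord y) ez eW. Qed.

Lemma zzP (c : R) X Y : zz (c *: X + Y) = c%:C%C *: zz X + zz Y.
Proof. by rewrite !zzE zp_linear cplxP. Qed.

Lemma WWP (c : R) X Y : WW (c *: X + Y) = c%:C%C *: WW X + WW Y.
Proof. by rewrite !WWE Wp_linear cplxP. Qed.

Lemma zz0 : zz 0 = 0.
Proof. by have := zzP (-1) 0 0; rewrite scaler0 addr0 rmorphN rmorph1 scaleN1r addNr. Qed.

Lemma WW0 : WW 0 = 0.
Proof. by have := WWP (-1) 0 0; rewrite scaler0 addr0 rmorphN rmorph1 scaleN1r addNr. Qed.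

Lemma zzD X Y : zz (X + Y) = zz X + zz Y.
Proof. by rewrite -[X]scale1r zzP rmorph1 !scale1r. Qed.

Lemma WWD X Y : WW (X + Y) = WW X + WW Y.
Proof. by rewrite -[X]scale1r WWP rmorph1 !scale1r. Qed.

Lemma zzN X : zz (- X) = - zz X.
Proof. by rewrite -[- X]addr0 -scaleN1r zzP zz0 addr0 rmorphN rmorph1 scaleN1r. Qed.

Lemma WWN X : WW (- X) = - WW X.
Proof. by rewrite -[- X]addr0 -scaleN1r WWP WW0 addr0 rmorphN rmorph1 scaleN1r. Qed.

Lemma derive_linear_map (W : normedModType R) (L : V -> W) x X :
  linear L -> continuous L -> 'D_X L x = L X.
Proof.
move=> Ll Lc; have [_] := derive_comp_linear Ll Lc (@derivable_id _ _ x X).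
by rewrite derive_id.
Qed.

Lemma msmooth_zz x : msmooth x zz.
Proof.
rewrite zz_fun.
by apply: cplx_smooth; apply: smooth_at_linear_map; [exact: zp_linear|exact: zp_continuous].
Qed.

Lemma msmooth_WW x : msmooth x WW.
Proof.
rewrite WW_fun.
by apply: cplx_smooth; apply: smooth_at_linear_map; [exact: Wp_linear|exact: Wp_continuous].
Qed.

Lemma mderive_zz x X : mderive X zz x = zz X.
Proof.
rewrite zzE zz_fun -cplx_derive; last by
  apply: smooth_at_linear_map; [exact: zp_linear|exact: zp_continuous].
by rewrite derive_linear_map//; [exact: zp_linear|exact: zp_continuous].
Qed.

Lemma mderive_WW x X : mderive X WW x = WW X.
Proof.
rewrite WWE WW_fun -cplx_derive; last by
  apply: smooth_at_linear_map; [exact: Wp_linear|exact: Wp_continuous].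
by rewrite derive_linear_map//; [exact: Wp_linear|exact: Wp_continuous].
Qed.

Section Mk.
Variables (x : V) (a : V -> 'cV[C]_n) (B : V -> 'M[C]_n).
Hypotheses (sa : msmooth x a) (sB : msmooth x B).

Lemma smooth_mk : smooth_at x (fun y => mk (a y) (B y)).
Proof.
apply: smooth_at_comp_linear; [exact: mkp_linear|exact: mkp_continuous|].
apply: smooth_at_pair; apply: smooth_at_cplx.
  by under eq_fun do rewrite reimK.
by under eq_fun do rewrite reimK.
Qed.

Lemma zz_derive_mk X : zz ('D_X (fun y => mk (a y) (B y)) x) = mderive X a x.
Proof.
have [_ E] := derive_comp_linear (@zp_linear _ _ _ ch) (@zp_continuous _ _ _ ch)
   (@smooth_at_derivable _ _ _ x X _ smooth_mk).
rewrite zzE -E cplx_derive; last first.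
  by apply: smooth_at_comp_linear smooth_mk; [exact: zp_linear|exact: zp_continuous].
by under [in LHS]eq_fun do rewrite -zzE zz_mk.
Qed.

Lemma WW_derive_mk X : WW ('D_X (fun y => mk (a y) (B y)) x) = mderive X B x.
Proof.
have [_ E] := derive_comp_linear (@Wp_linear _ _ _ ch) (@Wp_continuous _ _ _ ch)
   (@smooth_at_derivable _ _ _ x X _ smooth_mk).
rewrite WWE -E cplx_derive; last first.
  by apply: smooth_at_comp_linear smooth_mk; [exact: Wp_linear|exact: Wp_continuous].
by under [in LHS]eq_fun do rewrite -WWE WW_mk.
Qed.

End Mk.

Lemma msmooth_l1 x : msmooth x (fun y => l1 k (WW y)).
Proof.
under eq_fun do rewrite l1E; apply: msmooth_add; first exact: msmooth_cst.
by apply: msmooth_scale; [exact: csmooth_cst|exact: msmooth_WW].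
Qed.

Lemma msmooth_l2 x : msmooth x (fun y => l2 k (WW y)).
Proof.
under eq_fun do rewrite l2E; apply: msmooth_add; first exact: msmooth_cst.
by apply: msmooth_scale; [exact: csmooth_cst|exact: msmooth_WW].
Qed.

Lemma msmooth_Kf x : msmooth x (fun y => Kf k (WW y)).
Proof.
under eq_fun do rewrite Kf_l12; apply: msmooth_sub.
  by apply: msmooth_mul; [exact: msmooth_l1|apply: msmooth_conj; exact: msmooth_l1].
by apply: msmooth_mul; [exact: msmooth_l2|apply: msmooth_conj; exact: msmooth_l2].
Qed.

Lemma msmooth_Pc x (a : V -> 'cV[C]_n) : msmooth x a -> msmooth x (fun y => Pc k (a y)).
Proof.
move=> sa; under eq_fun do rewrite PcE.
apply: msmooth_add; apply: msmooth_scale => //; try exact: csmooth_cst.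
exact: msmooth_conj.
Qed.

Lemma msmooth_Qc x (a : V -> 'cV[C]_n) : msmooth x a -> msmooth x (fun y => Qc k (a y)).
Proof.
move=> sa; under eq_fun do rewrite QcE.
apply: msmooth_add; apply: msmooth_scale => //; try exact: csmooth_cst.
exact: msmooth_conj.
Qed.

Lemma mderive_Pc x X (a : V -> 'cV[C]_n) : msmooth x a ->
  mderive X (fun y => Pc k (a y)) x = Pc k (mderive X a x).
Proof.
move=> sa; have sca := msmooth_conj sa; under eq_fun do rewrite PcE; rewrite PcE.
rewrite mderive_add ?mderive_scale ?mderive_conj//;
  by apply: msmooth_scale => //; exact: csmooth_cst.
Qed.

Lemma mderive_Qc x X (a : V -> 'cV[C]_n) : msmooth x a ->
  mderive X (fun y => Qc k (a y)) x = Qc k (mderive X a x).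
Proof.
move=> sa; have sca := msmooth_conj sa; under eq_fun do rewrite QcE; rewrite QcE.
rewrite mderive_add ?mderive_scale ?mderive_conj//;
  by apply: msmooth_scale => //; exact: csmooth_cst.
Qed.

Lemma msmooth_Lf x (a : V -> 'cV[C]_n) : msmooth x a ->
  msmooth x (fun y => Lf k (WW y) (a y)).
Proof.
move=> sa; under eq_fun do rewrite LfE; apply: msmooth_add; first exact: msmooth_Pc.
by apply: msmooth_mul; [exact: msmooth_WW|exact: msmooth_Qc].
Qed.

Lemma mderive_Lf x X (a : V -> 'cV[C]_n) : msmooth x a ->
  mderive X (fun y => Lf k (WW y) (a y)) x
  = Lf k (WW x) (mderive X a x) + WW X *m Qc k (a x).
Proof.
move=> sa; under eq_fun do rewrite LfE.
have sW := msmooth_WW x; have sP := msmooth_Pc sa; have sQ := msmooth_Qc sa.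
have sWQ := msmooth_mul sW sQ.
rewrite mderive_add// mderive_mul// mderive_Pc// mderive_Qc// mderive_WW LfE.
by rewrite [WW X *m _ + _]addrC addrA.
Qed.

Section AtUnit.
Variable x : V.
Hypothesis Ku : Kf k (WW x) \in unitmx.

Lemma near_Kf_unit : \forall y \near x, Kf k (WW y) \in unitmx.
Proof. by apply: near_unitmx Ku; exact: msmooth_Kf. Qed.

Lemma msmooth_Pf : msmooth x (fun y => Pf k (WW y)).
Proof.
under eq_fun do rewrite Pf_inv.
by apply: msmooth_invmx => //; exact: msmooth_Kf.
Qed.

Lemma msmooth_Li (a : V -> 'cV[C]_n) : msmooth x a ->
  msmooth x (fun y => Li k (WW y) (a y)).
Proof.
move=> sa; under eq_fun do rewrite Li_l12; have sP := msmooth_Pf; have s1 := msmooth_l1 x; have s2 := msmooth_l2 x.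
apply: msmooth_sub; apply: msmooth_mul; try apply: msmooth_mul => //;
  try exact: msmooth_conj; by [].
Qed.

(** Comes from differentiating L_W(L_W^-1 a) = a. Stating the result after applying [L_W] avoids
    differentiating the inverse explicitly. *)
Lemma mderive_Li X (a : V -> 'cV[C]_n) : msmooth x a ->
  Lf k (WW x) (mderive X (fun y => Li k (WW y) (a y)) x)
  = mderive X a x - WW X *m Qc k (Li k (WW x) (a x)).
Proof.
move=> sa; have sL := msmooth_Li sa.
have := mderive_Lf X sL; rewrite (@mderive_near _ _ _ _ _ _ _ a) => [->|].
  by rewrite addrK.
by apply: filterS near_Kf_unit => y uy; exact: LfK.
Qed.

(** The coefficient E of dW in the differential of Kf: dKf = dW E + conj(E) conj(dW). *)
Definition Ecoef (W : 'M[C]_n) : 'M[C]_n := (ce1 k)%:M + ce2 k *: cbar W.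

Lemma mderive_Kf X : mderive X (fun y => Kf k (WW y)) x
  = WW X *m Ecoef (WW x) + cbar (Ecoef (WW x)) *m cbar (WW X).
Proof.
have sW := msmooth_WW x; have scW := msmooth_conj sW.
under eq_fun do rewrite KfE.
have sc (c : C) := csmooth_cst x c.
rewrite !mderive_add ?mderive_scale ?mderive_mul ?mderive_cst ?mderive_conj ?mderive_WW//;
 try (repeat first [exact: msmooth_cst | apply: msmooth_add | apply: msmooth_scale
   | apply: msmooth_mul | exact: scW | exact: sW | exact: sc]).
by rewrite /Ecoef !cbarE conj_ce2; mx_ring.
Qed.

Lemma mderive_Pf X : mderive X (fun y => Pf k (WW y)) x
  = - (Pf k (WW x) *m (WW X *m Ecoef (WW x) + cbar (Ecoef (WW x)) *m cbar (WW X)) *m Pf k (WW x)).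
Proof.
under eq_fun do rewrite Pf_inv.
by rewrite mderive_invmx ?mderive_Kf ?Pf_inv//; exact: msmooth_Kf.
Qed.

End AtUnit.
End ChartCalculus.

Section Openness.
Variables (R : realType) (n : nat) (V : normedModType R) (k : coeffs R) (ch : chart n V).
Local Notation C := R[i].
Local Notation WW := (WW ch).
Local Notation zz := (zz ch).

Definition SA : set V := [set x | dom k (WW x)].
Definition ST : set V := [set X | WW X = (WW X)^T].

Lemma normc_le_ReIm (z : C) : `|z| <= (`|complex.Re z| + `|complex.Im z|)%:C%C.
Proof.
rewrite [in leLHS](complexE z) rmorphD /=; apply: le_trans (ler_normD _ _) _.
have nr (r : R) : `|r%:C%C| = `|r|%:C%C :> C.
  by rewrite normc_def /= expr0n addr0 sqrtr_sqr.
have ni : `|'i%C| = 1 :> C by rewrite normc_def /= expr0n add0r expr1n sqrtr1.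
by rewrite normrM ni mul1r !nr.
Qed.

Lemma csmooth_near_small (x : V) (f : V -> C) (e : R) : csmooth x f -> f x = 0 -> 0 < e ->
  \forall y \near x, `|f y| < e%:C%C.
Proof.
move=> [/smooth_at_continuous cr /smooth_at_continuous ci] f0 e0.
have e2 : 0 < e / 2 by rewrite divr_gt0.
have Hr : \forall y \near x, `|complex.Re (f y)| < e / 2.
  have := cr; rewrite /prop_for /continuous_at f0 => /cvgr0Pnorm_lt; exact.
have Hi : \forall y \near x, `|complex.Im (f y)| < e / 2.
  have := ci; rewrite /prop_for /continuous_at f0 => /cvgr0Pnorm_lt; exact.
near=> y; apply: le_lt_trans (normc_le_ReIm _) _; rewrite ltcR [e]splitr.
by apply: ltrD; near: y.
Unshelve. all: by end_near.
Qed.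

(** Each product |y_i| |y_j| is at most half of |y_i|^2 + |y_j|^2; summing over all pairs gives the
    factor [m]. *)
Lemma quad_small m (E : 'M[C]_m) (e : R) (y : 'cV[C]_m) : 0 <= e ->
  (forall i j, `|E i j| <= e%:C%C) ->
  `|\tr (cadj y *m E *m y)| <= (e *+ m)%:C%C * \tr (cadj y *m y).
Proof.
move=> e0 Ee.
have S1 : \tr (cadj y *m y) = \sum_i `|y i ord0| ^+ 2.
  rewrite trace_mx11 mxE; apply: eq_bigr => i _.
  by rewrite !mxE mulrC sqr_normc.
have -> : \tr (cadj y *m E *m y) = \sum_j \sum_i conjc (y i ord0) * E i j * y j ord0.
  rewrite trace_mx11 mxE; apply: eq_bigr => j _; rewrite !mxE mulr_suml.
  by apply: eq_bigr => i _; rewrite !mxE.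
apply: le_trans (ler_norm_sum _ _ _) _.
apply: (@le_trans _ _ (\sum_(j < m) \sum_(i < m) e%:C%C * ((`|y i ord0| ^+ 2 + `|y j ord0| ^+ 2) / 2))).
  apply: ler_sum => j _; apply: le_trans (ler_norm_sum _ _ _) _; apply: ler_sum => i _.
  rewrite !normrM normcJ mulrAC mulrC; apply: ler_pM => //.
  rewrite ler_pdivlMr ?ltr0n// -subr_ge0.
  have -> : `|y i ord0| ^+ 2 + `|y j ord0| ^+ 2 - `|y i ord0| * `|y j ord0| * 2
     = (`|y i ord0| - `|y j ord0|) ^+ 2 by ring.
  by rewrite real_exprn_even_ge0// rpredB// normr_real.
rewrite S1 le_eqVlt; apply/orP; left; apply/eqP.
have E2 : \sum_(j < m) \sum_(i < m) e%:C%C * ((`|y i ord0| ^+ 2 + `|y j ord0| ^+ 2) / 2)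
  = e%:C%C / 2 * (\sum_(j < m) \sum_(i < m) `|y i ord0| ^+ 2
    + \sum_(j < m) \sum_(i < m) `|y j ord0| ^+ 2).
  rewrite -big_split mulr_sumr; apply: eq_bigr => j _ /=.
  rewrite -big_split mulr_sumr; apply: eq_bigr => i _ /=; ring.
have A1 : \sum_(j < m) \sum_(i < m) `|y i ord0| ^+ 2 = (\sum_i `|y i ord0| ^+ 2) *+ m.
  by rewrite sumr_const card_ord.
have A2 : \sum_(j < m) \sum_(i < m) `|y j ord0| ^+ 2 = (\sum_i `|y i ord0| ^+ 2) *+ m.
  by rewrite -sumrMnl; apply: eq_bigr => j _; rewrite sumr_const card_ord.
have -> : (e *+ m)%:C%C = e%:C%C *+ m :> C by exact: rmorphMn.
rewrite E2 A1 A2; move: (\sum_i _) (e%:C%C : C) => s c.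
rewrite -mulr2n mulrnAr -mulrnAl -(mulr_natr (c / 2) 2) divfK ?pnatr_eq0//.
by rewrite mulrnAr mulrnAl.
Qed.

(* With Pf = t t^* at x, the matrix t^* Kf t is the identity at x and stays close
   to it nearby. *)
Lemma dom_near (x : V) : SA x -> \forall y \near x,
  forall u : 'cV[C]_n, u != 0 -> 0 < complex.Re (\tr (cadj u *m Kf k (WW y) *m u)).
Proof.
move=> dx; have [Ws Wp] := dx.
have uK := dom_unit dx.
have [t ut Pt] := Pf_cholesky dx.
pose E y := cadj t *m (Kf k (WW y) - Kf k (WW x)) *m t.
have K0 : Kf k (WW x) = invmx (cadj t) *m invmx t.
  have uat : cadj t \in unitmx by rewrite adj_unit.
  have : Kf k (WW x) = invmx (Pf k (WW x)) by rewrite Pf_inv invmxK.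
  rewrite Pt => ->; apply: invmx_eq.
  by rewrite mulmxA (mulmxK uat) mulmxV.
have sE : msmooth x E.
  apply: msmooth_mul (msmooth_cst _ _); apply: msmooth_mul (msmooth_cst _ _) _.
  by apply: msmooth_sub (msmooth_cst _ _); exact: msmooth_Kf.
have E0 i j : E x i j = 0 by rewrite /E subrr mulmx0 mul0mx mxE.
(* Chosen so that n e = n / (n + 1) < 1, the margin needed when [quad_small] is compared with the
   identity. *)
pose e : R := n.+1%:R^-1.
have e0 : 0 < e by rewrite invr_gt0 ltr0n.
have nE : \forall y \near x, forall ij : 'I_n * 'I_n, `|E y ij.1 ij.2| < e%:C%C.
  by apply: filter_forall => ij; exact: csmooth_near_small.
apply: filterS nE => y Ey u u0.
have uat : cadj t \in unitmx by rewrite adj_unit.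
pose v := invmx t *m u.
have v0 : v != 0.
  by apply: contraNneq u0 => v0; rewrite -(mulKVmx ut u) -/v v0 mulmx0.
have uv : u = t *m v by rewrite mulKVmx.
have -> : \tr (cadj u *m Kf k (WW y) *m u) = \tr (cadj v *m v) + \tr (cadj v *m E y *m v).
  have -> : Kf k (WW y) = Kf k (WW x) + (Kf k (WW y) - Kf k (WW x)) by rewrite addrC subrK.
  rewrite mulmxDr mulmxDl mxtraceD; congr (_ + _).
    rewrite K0 uv /cadj cbarM trmxM -/(cadj t) -/(cadj v) !mulmxA.
    by rewrite (mulmxK uat) (mulmxKV ut).
  by rewrite uv /E /cadj cbarM trmxM !mulmxA.
rewrite ReD.
have Sv := adj_norm_gt0 v0.
have qs := @quad_small n (E y) e v (ltW e0) (fun i j => ltW (Ey (i, j))).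
have : `|\tr (cadj v *m E y *m v)| < \tr (cadj v *m v).
  apply: le_lt_trans qs _; rewrite gtr_pMl//.
  by rewrite -[1]/(1%:C%C) ltcR -mulr_natr /e mulrC ltr_pdivrMr ?ltr0n// mul1r ltr_nat.
move=> /(le_lt_trans (normc_ge_Re _)); rewrite ltcE /= => /andP[_].
by rewrite ltr_norml => /andP[+ _]; rewrite -subr_gt0 opprK addrC.
Qed.

Lemma SA_open : open_in_subspace SA ST.
Proof.
split.
- by rewrite /ST /= WW0 trmx0.
- by move=> c X Y; rewrite /ST /= => TX TY; rewrite WWP !trmxE -TX -TY.
(* Off the symmetric matrices [Kf] need not be Hermitian, so the ambient open set asks for a
   positive real part only; on symmetric matrices the value is real and this is positivity. *)
pose Q := [set y | forall u : 'cV[C]_n, u != 0 ->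
   0 < complex.Re (\tr (cadj u *m Kf k (WW y) *m u))].
exists (interior Q); split; first exact: open_interior.
apply/seteqP; split=> x.
  by move=> dx; split; [exact: dom_near|case: dx].
move=> [/interior_subset Qx Tx]; split=> // u u0.
rewrite -trace_mx11 ltcE; apply/andP; split; last exact: Qx.
set z := \tr _.
have : conjc z = z.
  have cK : (cbar (Kf k (WW x)))^T = Kf k (WW x) by rewrite -Kf_tr// trmxK.
  by rewrite /z -cbar_trace -mxtrace_tr /cadj !(cbarE, trmxE) cK mulmxA.
case: z => a b [] /eqP; rewrite eq_sym -subr_eq0 opprK -mulr2n mulrn_eq0 /=.
by move=> /eqP ->.
Qed.

(** Short tangent segments stay in the domain, so [derive_eq_on_line] applies to forms that agree on
    the domain only. *)
Lemma SA_line (x X : V) : SA x -> ST X -> \forall h \near (0 : R), SA (h *: X + x).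
Proof.
move=> Ax TX; have [T0 Tl [D [oD DE]]] := SA_open.
have [Dx Tx] : (D `&` ST) x by rewrite -DE.
have : \forall h \near (0 : R), D (h *: X + x).
  have c : {for (0 : R), continuous (fun h : R => h *: X + x)}.
    by apply: cvgD; [exact: cvgZr_tmp cvg_id|exact: cvg_cst].
  by apply: c; rewrite scale0r add0r; exact: open_nbhs_nbhs (conj oD Dx).
apply: filterS => h Dh; rewrite DE; split; [exact: Dh|exact: (Tl h X x TX Tx)].
Qed.

End Openness.

(** * Invariant Kaehler structures *)

Section Frame.
Variables (R : realType) (n : nat) (V : normedModType R) (k : coeffs R) (ch : chart n V).
Local Notation C := R[i].
Local Notation WW := (WW ch).
Local Notation zz := (zz ch).
Local Notation SA := (SA k ch).
Local Notation ST := (ST ch).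
Local Notation P x := (Pf k (WW x)).

Section SmoothForm.
Variables (x : V) (Ku : Kf k (WW x) \in unitmx).

Lemma csmooth_sieg (X Y : 'M[C]_n) : csmooth x (fun y => sieg (P y) X Y).
Proof.
have sP := msmooth_Pf Ku; have sc (A : 'M[C]_n) := msmooth_cst x A.
have s2 (A B : 'M[C]_n) : csmooth x (fun y => \tr (P y *m A *m cbar (P y *m B))).
  by apply: csmooth_trace; apply: msmooth_mul; [|apply: msmooth_conj]; apply: msmooth_mul.
have -> : (fun y => sieg (P y) X Y) = (fun y => \tr (P y *m X *m cbar (P y *m Y))
     + (-1) * \tr (P y *m Y *m cbar (P y *m X))).
  by apply/funext => y; rewrite mulN1r.
by apply: csmooth_add => //; apply: csmooth_mul => //; exact: csmooth_cst.
Qed.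

Lemma csmooth_fib (Q : V -> 'M[C]_n) (a b : V -> 'cV[C]_n) :
  msmooth x Q -> msmooth x a -> msmooth x b -> csmooth x (fun y => fib (Q y) (a y) (b y)).
Proof.
move=> sQ sa sb.
have s2 (u v : V -> 'cV[C]_n) : msmooth x u -> msmooth x v ->
    csmooth x (fun y => \tr ((u y)^T *m cbar (Q y) *m cbar (v y))).
  move=> su sv; apply: csmooth_trace; apply: msmooth_mul; last exact: msmooth_conj.
  by apply: msmooth_mul; [exact: msmooth_tr|exact: msmooth_conj].
have -> : (fun y => fib (Q y) (a y) (b y)) = (fun y => \tr ((a y)^T *m cbar (Q y) *m cbar (b y))
     + (-1) * \tr ((b y)^T *m cbar (Q y) *m cbar (a y))).
  by apply/funext => y; rewrite mulN1r.
by apply: csmooth_add; [exact: s2|apply: csmooth_mul; [exact: csmooth_cst|exact: s2]].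
Qed.

Lemma csmooth_gform (c : C) (a b : V -> 'cV[C]_n) (X Y : 'M[C]_n) :
  msmooth x a -> msmooth x b ->
  csmooth x (fun y => gform c (P y) (a y) X (b y) Y).
Proof.
move=> sa sb; apply: csmooth_mul; first exact: csmooth_cst.
apply: csmooth_add; last by apply: csmooth_fib => //; exact: msmooth_Pf.
by apply: csmooth_mul; [exact: csmooth_cst|exact: csmooth_sieg].
Qed.

End SmoothForm.

Variables (c : R) (L : V -> V -> 'cV[C]_n) (J : V -> V -> V).
Hypothesis c0 : 0 < c.
Hypothesis Llin : forall x (r : R) X Y, SA x -> L x (r *: X + Y) = r%:C%C *: L x X + L x Y.
Hypothesis Lsm : forall x X, SA x -> msmooth x (fun y => L y X).
Hypothesis Linj : forall x X Y, SA x -> L x X = L x Y -> WW X = WW Y -> X = Y.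
Hypothesis LJ : forall x X, SA x -> L x (J x X) = 'i%C *: L x X.
Hypothesis WJ : forall x X, WW (J x X) = 'i%C *: WW X.

Definition frame_form (x X Y : V) : C := gform c%:C%C (P x) (L x X) (WW X) (L x Y) (WW Y).

(** [L x] together with [WW] embeds the tangent space so that [J] becomes multiplication by i and
    the form becomes [gform]; every pointwise axiom is then a property of [gform]. Only closedness
    and integrability, which involve derivatives, remain as hypotheses. *)
Lemma frame_kahler :
  closed_form SA ST frame_form ->
  (forall X, ST X -> smooth_on SA (fun x => J x X)) ->
  (forall x X Y, SA x -> ST X -> ST Y ->
        let DJ Z U := 'D_Z (fun y => J y U) x in
        DJ (J x X) Y - DJ (J x Y) X + J x (DJ Y X) - J x (DJ X Y) = 0) ->
  kahler SA ST frame_form J.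
Proof.
move=> cl Js Jn.
have L0 x X : SA x -> WW X = 0 -> L x X = 0 -> X = 0.
  move=> Ax WX LX; apply: (Linj Ax); last by rewrite WW0.
  have -> : L x 0 = 0; last by [].
  by have := Llin (-1) 0 0 Ax; rewrite scaler0 addr0 rmorphN rmorph1 scaleN1r addNr.
split; [exact: SA_open| |exact: cl| |].
- split.
  + by move=> x X Y [Ws _] _ _; apply: gform_real; exact: Pf_tr.
  + move=> x r X Y Z Ax _ _ _.
    by rewrite /frame_form Llin// WWP gform_addl gform_scalel.
  + by move=> x X Y _ _ _; exact: gform_antisym.
  + move=> X Y _ _; apply: smooth_at_on => x Ax.
    by have [] := csmooth_gform (dom_unit Ax) c%:C%C (WW X) (WW Y) (Lsm X Ax) (Lsm Y Ax).
- split; [| |exact: Js|exact: Jn].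
  + move=> x X Ax TX; split; first by rewrite /ST /= WJ trmxZ -TX.
    apply: (Linj Ax).
      rewrite !LJ// scalerA ii; have := Llin (-1) X 0 Ax.
      rewrite addr0 scaleN1r rmorphN rmorph1 => ->.
      have -> : L x 0 = 0; last by rewrite addr0.
      by have := Llin (-1) 0 0 Ax; rewrite scaler0 addr0 rmorphN rmorph1 scaleN1r addNr.
    by rewrite !WJ scalerA ii WWN scaleN1r.
  + move=> x r X Y Ax TX TY; apply: (Linj Ax).
      by rewrite LJ// !Llin// !LJ// scalerDr !scalerA mulrC.
    by rewrite WJ !WWP !WJ scalerDr !scalerA mulrC.
split.
  move=> x X Y Ax _ _; rewrite /frame_form (LJ X Ax) (LJ Y Ax) (WJ x X) (WJ x Y).
  exact: gform_i.
move=> x X Ax TX X0; rewrite /frame_form LJ// WJ.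
have : ~~ ((L x X == 0) && (WW X == 0)).
  by apply: contra X0 => /andP[/eqP lx /eqP wx]; rewrite (L0 x X).
by move=> /(gform_pos c0 Ax TX); rewrite ltcE => /andP[_].
Qed.

End Frame.

(** * Closedness of the forms *)

Section Closed.
Variables (R : realType) (n : nat) (V : normedModType R) (k : coeffs R) (ch : chart n V).
Local Notation C := R[i].
Local Notation WW := (WW ch).
Local Notation zz := (zz ch).
Local Notation SA := (SA k ch).
Local Notation ST := (ST ch).
Local Notation P x := (Pf k (WW x)).

(** The commutation that makes the base form closed: it lets E pass across Kf^-1 at the price of a
    conjugation, so that the terms of the derivative can be matched. *)
Lemma Ecoef_Kf W : Ecoef k W *m Kf k W = cbar (Kf k W) *m Ecoef k W :> 'M[C]_n.
Proof.
have e0 := conj_ce0 k; have e2 := conj_ce2 k.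
rewrite KfE /Ecoef !cbarE conjcK e0 e2.
by move: (ce0 k) (ce1 k) (conjc (ce1 k)) (ce2 k) => ? ? ? ?; mx_ring.
Qed.

Lemma Ecoef_Pf W : Kf k W \in unitmx ->
  Ecoef k W *m Pf k W = cbar (Pf k W) *m Ecoef k W :> 'M[C]_n.
Proof.
move=> uK; have ucK : cbar (Kf k W) \in unitmx by rewrite cbar_unit.
rewrite Pf_inv cbar_inv.
by apply: (canRL (mulKmx ucK)); rewrite mulmxA -Ecoef_Kf mulmxK.
Qed.

(** Each of the two factors P contributes a term in dW and a term in its conjugate. Moving E across
    P and rotating under the trace brings the four terms to the two shapes [a] and [b]. *)
Lemma cderive_sieg x X Y Z : Kf k (WW x) \in unitmx ->
  let E := Ecoef k (WW x) in
  let a A B D := \tr (P x *m A *m cbar (P x) *m E *m B *m cbar (P x) *m cbar D) in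
  let b A B D := \tr (P x *m A *m cbar (P x) *m cbar B *m cbar E *m cbar (P x) *m cbar D) in
  cderive X (fun y => \tr (P y *m WW Y *m cbar (P y *m WW Z))) x =
  - (a (WW X) (WW Y) (WW Z) + a (WW Y) (WW X) (WW Z)
     + b (WW Y) (WW X) (WW Z) + b (WW Y) (WW Z) (WW X)).
Proof.
move=> uK E a b.
have sP := msmooth_Pf uK; have scP := msmooth_conj sP.
have sc (A : 'M[C]_n) := msmooth_cst x A.
have EP := Ecoef_Pf uK.
have EP' : cbar (Ecoef k (WW x)) *m cbar (P x) = P x *m cbar (Ecoef k (WW x)).
  by have := congr1 (@cbar R n n) EP; rewrite !cbarE.
under eq_fun do rewrite cbarM.
rewrite cderive_trace; last first.
  by apply: msmooth_mul; apply: msmooth_mul.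
rewrite mderive_mul; [|exact: msmooth_mul..].
rewrite !mderive_mul// !mderive_cst mderive_conj// mderive_Pf//.
rewrite !mulmx0 !addr0.
rewrite /a /b {a b}; move: (WW X) (WW Y) (WW Z) => A B D.
rewrite /E {E}; move: (Ecoef k (WW x)) (P x) EP EP' => E Q EP EP'.
rewrite !cbarE.
pose M1 := Q *m A *m E *m Q *m B *m cbar Q *m cbar D.
pose M2 := Q *m cbar E *m cbar A *m Q *m B *m cbar Q *m cbar D.
pose M3 := Q *m B *m cbar Q *m cbar A *m cbar E *m cbar Q *m cbar D.
pose M4 := Q *m B *m cbar Q *m E *m A *m cbar Q *m cbar D.
transitivity (- \tr (M1 + M2 + M3 + M4)).
  rewrite -[RHS]raddfN; congr (\tr _); rewrite /M1 /M2 /M3 /M4; mx_ring.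
have T1 : Q *m A *m E *m Q = Q *m A *m cbar Q *m E by rewrite -CmulA EP CmulA.
have E1 : \tr M1 = \tr (Q *m A *m cbar Q *m E *m B *m cbar Q *m cbar D).
  exact: (f_equal (fun M => \tr (M *m B *m cbar Q *m cbar D)) T1).
have E2 : \tr M2 = \tr (Q *m B *m cbar Q *m cbar D *m cbar E *m cbar Q *m cbar A).
  transitivity (\tr ((cbar E *m cbar Q *m cbar A) *m (Q *m B *m cbar Q *m cbar D))).
    have assoc (a1 a2 a3 a4 a5 a6 a7 : 'M[C]_n) :
      a1 *m a2 *m a3 *m a4 *m a5 *m a6 *m a7 = a1 *m a2 *m a3 *m (a4 *m a5 *m a6 *m a7).
      by rewrite !CmulA.
    by apply: (f_equal mxtrace); rewrite EP'; exact: assoc.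
  by rewrite mxtrace_mulC !CmulA.
rewrite (mxtraceD (M1 + M2 + M3)) (mxtraceD (M1 + M2)) (mxtraceD M1).
have alg (t1 t2 t3 t4 u1 u2 : C) : t1 = u1 -> t2 = u2 ->
    - (t1 + t2 + t3 + t4) = - (u1 + t4 + t3 + u2) by move=> -> ->; ring.
exact: alg E1 E2.
Qed.

Lemma csmooth_sieg_term x (A B : 'M[C]_n) : Kf k (WW x) \in unitmx ->
  csmooth x (fun y => \tr (P y *m A *m cbar (P y *m B))).
Proof.
move=> uK; have sP := msmooth_Pf uK; have sc (D : 'M[C]_n) := msmooth_cst x D.
by apply: csmooth_trace; apply: msmooth_mul; [|apply: msmooth_conj]; apply: msmooth_mul.
Qed.

Lemma cderive_sub x X (f g : V -> C) : csmooth x f -> csmooth x g ->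
  cderive X (fun y => f y - g y) x = cderive X f x - cderive X g x.
Proof.
move=> sf sg; under eq_fun do rewrite -mulN1r.
rewrite cderive_add//; last by apply: csmooth_mul => //; exact: csmooth_cst.
rewrite cderive_mul//; last exact: csmooth_cst.
by rewrite cderive_cst mul0r add0r mulN1r.
Qed.

Lemma closed_sieg x X Y Z : Kf k (WW x) \in unitmx ->
  cderive X (fun y => sieg (P y) (WW Y) (WW Z)) x
  + cderive Y (fun y => sieg (P y) (WW Z) (WW X)) x
  + cderive Z (fun y => sieg (P y) (WW X) (WW Y)) x = 0.
Proof.
move=> uK; have st A B := csmooth_sieg_term A B uK.
(* Only the pattern of the arguments matters: for arbitrary [a] and [b] the antisymmetrised cyclic
   sum cancels term by term. *)
have [a [b ab]] : exists a b : V -> V -> V -> C, forall A B D,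
    cderive A (fun y => \tr (P y *m WW B *m cbar (P y *m WW D))) x
    = - (a A B D + a B A D + b B A D + b B D A).
  by do 2!eexists; move=> A B D; exact: cderive_sieg.
have ds A B D : cderive A (fun y => sieg (P y) (WW B) (WW D)) x =
    - (a A B D + a B A D + b B A D + b B D A) + (a A D B + a D A B + b D A B + b D B A).
  by rewrite -[X in _ + X]opprK -!ab; exact: cderive_sub.
by rewrite !ds; ring.
Qed.

Definition fib1 (a b : 'cV[C]_n) : C := \tr (a^T *m cbar b) - \tr (b^T *m cbar a).

Lemma cderive_fib1 x X (a b : V -> 'cV[C]_n) : msmooth x a -> msmooth x b ->
  csmooth x (fun y => fib1 (a y) (b y)) /\
  cderive X (fun y => fib1 (a y) (b y)) x
  = fib1 (mderive X a x) (b x) + fib1 (a x) (mderive X b x).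
Proof.
move=> sa sb.
have st (u v : V -> 'cV[C]_n) : msmooth x u -> msmooth x v ->
    msmooth x (fun y => (u y)^T *m cbar (v y)).
  by move=> su sv; apply: msmooth_mul; [exact: msmooth_tr|exact: msmooth_conj].
have dt (u v : V -> 'cV[C]_n) : msmooth x u -> msmooth x v ->
    cderive X (fun y => \tr ((u y)^T *m cbar (v y))) x
    = \tr ((mderive X u x)^T *m cbar (v x)) + \tr ((u x)^T *m cbar (mderive X v x)).
  move=> su sv; rewrite cderive_trace; last exact: st.
  rewrite mderive_mul; [|exact: msmooth_tr|exact: msmooth_conj].
  by rewrite mderive_tr mderive_conj// mxtraceD.
have sab := csmooth_trace (st _ _ sa sb); have sba := csmooth_trace (st _ _ sb sa).
split; last by rewrite cderive_sub// !dt// /fib1; tr_ring.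
have -> : (fun y => fib1 (a y) (b y)) =
   (fun y => \tr ((a y)^T *m cbar (b y)) + (-1) * \tr ((b y)^T *m cbar (a y))).
  by apply/funext => y; rewrite mulN1r.
by apply: csmooth_add => //; apply: csmooth_mul => //; exact: csmooth_cst.
Qed.

(** Here [e X y] is the value at [y] of a vector-valued one-form on the constant field [X]; the
    fibre term is the constant symplectic form of C^n evaluated on that one-form. *)
Definition framed (c : C) (e : V -> V -> 'cV[C]_n) (y X Y : V) : C :=
  'i%C * (c * sieg (P y) (WW X) (WW Y) + fib1 (e X y) (e Y y)).

(** The symmetry of the derivatives of [e] says that this one-form is closed; with the antisymmetry
    of [fib1] the six fibre terms cancel in pairs, and [closed_sieg] disposes of the base. *)
Lemma closed_framed (c : C) (e : V -> V -> 'cV[C]_n) w :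
  (forall x X Y, SA x -> ST X -> ST Y -> w x X Y = framed c e x X Y) ->
  (forall x X, SA x -> msmooth x (e X)) ->
  (forall x X Y, SA x -> mderive X (e Y) x = mderive Y (e X) x) ->
  closed_form SA ST w.
Proof.
move=> we se de x X Y Z Ax TX TY TZ; have uK := dom_unit Ax.
have E (A B D : V) : ST A -> ST B -> ST D ->
    'D_A (fun y => complex.Re (w y B D) : R^o) x
    = complex.Re (cderive A (fun y => framed c e y B D) x).
  move=> TA TB TD; apply: derive_eq_on_line.
  by apply: filterS (SA_line Ax TA) => h Ah; rewrite we.
rewrite !E// -!ReD.
have dF (A B D : V) : cderive A (fun y => framed c e y B D) x =
   'i%C * (c * cderive A (fun y => sieg (P y) (WW B) (WW D)) x
     + (fib1 (mderive A (e B) x) (e D x) + fib1 (e B x) (mderive A (e D) x))).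
  have [sf df] := cderive_fib1 A (se x B Ax) (se x D Ax).
  have ss := csmooth_sieg uK (WW B) (WW D).
  have sc d : csmooth x (fun=> d) by exact: csmooth_cst.
  have scs := csmooth_mul (sc c) ss.
  have sm := csmooth_add scs sf.
  rewrite cderive_mul// cderive_cst mul0r add0r cderive_add// cderive_mul//.
  by rewrite cderive_cst mul0r add0r df.
rewrite !dF (de x Y X)// (de x Z X)// (de x Z Y)//.
have := closed_sieg X Y Z uK.
set s1 := cderive X _ x; set s2 := cderive Y _ x; set s3 := cderive Z _ x => s0.
have anti a b : fib1 a b = - fib1 b a by rewrite /fib1; tr_ring.
rewrite (anti (mderive X (e Y) x)) (anti (mderive Y (e Z) x)) (anti (mderive X (e Z) x) (e Y x)).
rewrite -!mulrDr.
have -> : forall u1 u2 u3 : C, (c * s1 + (- u1 + u2)) + (c * s2 + (- u3 + u1)) + (c * s3 + (- u2 + u3))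
   = c * (s1 + s2 + s3) by move=> u1 u2 u3; ring.
by rewrite s0 !mulr0.
Qed.

End Closed.

Section Linearity.
Variables (R : realType) (n : nat) (k : coeffs R).
Local Notation C := R[i].
Implicit Types (W : 'M[C]_n) (a b : 'cV[C]_n).

Lemma Lf_real W (r : R) a b :
  Lf k W (r%:C%C *: a + b) = r%:C%C *: Lf k W a + Lf k W b.
Proof. by rewrite !Lf_l12 !cbarE conjc_real; mx_ring. Qed.

Lemma LfD W a b : Lf k W (a + b) = Lf k W a + Lf k W b.
Proof. by rewrite !Lf_l12 !cbarE; mx_ring. Qed.

Lemma LfB W a b : Lf k W (a - b) = Lf k W a - Lf k W b.
Proof. by rewrite !Lf_l12 !cbarE; mx_ring. Qed.

Lemma Lf0 W : Lf k W 0 = 0.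
Proof. by have := LfB W 0 0; rewrite !subrr. Qed.

Lemma QcD a b : Qc k (a + b) = Qc k a + Qc k b.
Proof. by rewrite !QcE !cbarE; mx_ring. Qed.

Lemma Lf_inj W a b : Kf k W \in unitmx -> Lf k W a = Lf k W b -> a = b.
Proof. by move=> uK /(congr1 (Li k W)); rewrite !LiK. Qed.

End Linearity.

(** * The Kaehler structures in the coordinates z and eta *)

Section CurvedFlat.
Variables (R : realType) (n : nat) (V : normedModType R) (k : coeffs R) (ch : chart n V).
Variable c : R.
Hypothesis c0 : 0 < c.
Local Notation C := R[i].
Local Notation WW := (WW ch).
Local Notation zz := (zz ch).
Local Notation mk := (mk ch).
Local Notation SA := (SA k ch).
Local Notation ST := (ST ch).
Local Notation P x := (Pf k (WW x)).

Definition eta x : 'cV[C]_n := Li k (WW x) (zz x).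
(** The one-form A = dz + dW conj(eta) of the ball, where Q(eta) = -conj(eta), and the one-form G of
    the half plane, where Q(eta) = (conj v - v)^-1 (conj u - u). *)
Definition dz_hor x X : 'cV[C]_n := zz X - WW X *m Qc k (eta x).
Definition deta X x : 'cV[C]_n := Li k (WW x) (dz_hor x X).
Definition curved_form : V -> V -> V -> C := frame_form k ch c dz_hor.
Definition curved_J (x X : V) : V := mk ('i%C *: zz X) ('i%C *: WW X).

Definition flat_hor x X : 'cV[C]_n := Lf k (WW x) (zz X).
Definition flat_form : V -> V -> V -> C := frame_form k ch c flat_hor.
(** Multiplication by i on dz, transported to d(eta) by L_W. It depends on W, since L_W is only
    real-linear. *)
Definition flat_Jz X x : 'cV[C]_n := Li k (WW x) ('i%C *: Lf k (WW x) (zz X)).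
Definition flat_J (x X : V) : V := mk (flat_Jz X x) ('i%C *: WW X).

Lemma msmooth_eta x : Kf k (WW x) \in unitmx -> msmooth x eta.
Proof. by move=> uK; apply: msmooth_Li => //; exact: msmooth_zz. Qed.

Lemma msmooth_dz_hor x X : Kf k (WW x) \in unitmx -> msmooth x (fun y => dz_hor y X).
Proof.
move=> uK; apply: msmooth_sub; first exact: msmooth_cst.
by apply: msmooth_mul; [exact: msmooth_cst|apply: msmooth_Qc; exact: msmooth_eta].
Qed.

Lemma mderive_eta x X : Kf k (WW x) \in unitmx -> mderive X eta x = deta X x.
Proof.
move=> uK; apply: (Lf_inj uK); rewrite mderive_Li//; last exact: msmooth_zz.
by rewrite mderive_zz /deta LfK.
Qed.

(** The right-hand side is symmetric in [X] and [Y], which is the closedness of d(eta) required by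
    [closed_framed]. *)
Lemma Lf_mderive_deta x X Y : Kf k (WW x) \in unitmx ->
  Lf k (WW x) (mderive X (deta Y) x)
  = - (WW X *m Qc k (deta Y x) + WW Y *m Qc k (deta X x)).
Proof.
move=> uK; have sd := msmooth_dz_hor Y uK.
rewrite mderive_Li// -/(deta Y x).
have sQ := msmooth_Qc k (msmooth_eta uK).
have sWQ := msmooth_mul (msmooth_cst x (WW Y)) sQ.
rewrite mderive_sub//; last exact: msmooth_cst.
rewrite mderive_cst mderive_mul//; last exact: msmooth_cst.
rewrite mderive_cst mderive_Qc; last exact: msmooth_eta.
rewrite mderive_eta//.
have alg (A B : 'M[C]_n) (u v w : 'cV[C]_n) :
    0 - (0 *m u + B *m v) - A *m w = - (A *m w + B *m v) by mx_ring.
exact: alg.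
Qed.

Lemma curved_kahler : kahler SA ST curved_form curved_J.
Proof.
apply: (frame_kahler c0).
- move=> x r X Y _; rewrite /dz_hor zzP WWP.
  have alg (d : C) (A B : 'M[C]_n) (u v w : 'cV[C]_n) :
    d *: u + v - (d *: A + B) *m w = d *: (u - A *m w) + (v - B *m w) by mx_ring.
  exact: alg.
- by move=> x X Ax; apply: msmooth_dz_hor; exact: dom_unit.
- move=> x X Y _; rewrite /dz_hor => + eW; rewrite eW => /addIr ez.
  exact: coord_inj ez eW.
- move=> x X _; rewrite /dz_hor zz_mk WW_mk.
  have alg (d : C) (A : 'M[C]_n) (u w : 'cV[C]_n) :
    d *: u - (d *: A) *m w = d *: (u - A *m w) by mx_ring.
  exact: alg.
- by move=> x X; rewrite WW_mk.
- apply: (@closed_framed _ _ _ _ _ c%:C%C deta).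
  + move=> x X Y Ax _ _; have uK := dom_unit Ax.
    rewrite /curved_form /frame_form /gform /framed; congr (_ * (_ + _)).
    by rewrite -[dz_hor x X](LfK uK) -[dz_hor x Y](LfK uK) fib_Lf.
  + move=> x X Ax; have uK := dom_unit Ax.
    by apply: msmooth_Li => //; exact: msmooth_dz_hor.
  + move=> x X Y Ax; have uK := dom_unit Ax.
    apply: (Lf_inj uK); apply: etrans (Lf_mderive_deta X Y uK) _.
    apply: etrans _ (esym (Lf_mderive_deta Y X uK)).
    exact: (f_equal (fun M => - M) (addrC _ _)).
- by move=> X _; apply: smooth_at_on => x _; exact: smooth_at_cst.
(* In the coordinates (z, W) the complex structure is constant, so every term of the Nijenhuis
   tensor vanishes. *)
move=> x X Y _ _ _ DJ.
have DJ0 Z U : DJ Z U = 0 by exact: derive_cst.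
have J0 : curved_J x 0 = 0.
  by apply: (@coord_inj _ _ _ ch); rewrite ?zz_mk ?WW_mk ?zz0 ?WW0 scaler0.
have comb (u1 u2 u3 u4 : V) : u1 = 0 -> u2 = 0 -> u3 = 0 -> u4 = 0 -> u1 - u2 + u3 - u4 = 0.
  by move=> -> -> -> ->; rewrite !subr0 addr0.
have JD Z U : curved_J x (DJ Z U) = 0 := etrans (f_equal (curved_J x) (DJ0 Z U)) J0.
exact: (comb _ _ _ _ (DJ0 (curved_J x X) Y) (DJ0 (curved_J x Y) X) (JD Y X) (JD X Y)).
Qed.

Lemma msmooth_flat_Jz x X : Kf k (WW x) \in unitmx -> msmooth x (flat_Jz X).
Proof.
move=> uK; apply: msmooth_Li => //; apply: msmooth_scale; first exact: csmooth_cst.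
by apply: msmooth_Lf; exact: msmooth_cst.
Qed.

Lemma Lf_mderive_flat_Jz x Z X : Kf k (WW x) \in unitmx ->
  Lf k (WW x) (mderive Z (flat_Jz X) x)
  = 'i%C *: (WW Z *m Qc k (zz X)) - WW Z *m Qc k (flat_Jz X x).
Proof.
move=> uK; have sL := msmooth_Lf k ch (msmooth_cst x (zz X)).
rewrite mderive_Li//; last by apply: msmooth_scale => //; exact: csmooth_cst.
rewrite mderive_scale// mderive_Lf; last exact: msmooth_cst.
rewrite mderive_cst -/(flat_Jz X x).
by rewrite Lf0 add0r.
Qed.

Lemma flat_kahler : kahler SA ST flat_form flat_J.
Proof.
apply: (frame_kahler c0).
- by move=> x r X Y _; rewrite /flat_hor zzP Lf_real.
- by move=> x X Ax; apply: msmooth_Lf; exact: msmooth_cst.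
- move=> x X Y Ax; rewrite /flat_hor => /(Lf_inj (dom_unit Ax)); exact: coord_inj.
- by move=> x X Ax; rewrite /flat_hor zz_mk LfK//; exact: dom_unit.
- by move=> x X; rewrite WW_mk.
- apply: (@closed_framed _ _ _ _ _ c%:C%C (fun X _ => zz X)).
  + move=> x X Y Ax _ _.
    by rewrite /flat_form /frame_form /gform /framed; congr (_ * (_ + _)); rewrite fib_Lf.
  + by move=> x X _; exact: msmooth_cst.
  + by move=> x X Y _; rewrite !mderive_cst.
- move=> X _; apply: smooth_at_on => x Ax; apply: smooth_mk; last exact: msmooth_cst.
  by apply: msmooth_flat_Jz; exact: dom_unit.
move=> x X Y Ax TX TY DJ; have uK := dom_unit Ax.
have zD Z U : zz (DJ Z U) = mderive Z (flat_Jz U) x.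
  by apply: zz_derive_mk; [exact: msmooth_flat_Jz|exact: msmooth_cst].
have WD Z U : WW (DJ Z U) = 0.
  rewrite [LHS](@WW_derive_mk _ _ _ _ _ (flat_Jz U)) ?mderive_cst//.
    exact: msmooth_flat_Jz.
  exact: msmooth_cst.
have WJ Z : WW (flat_J x Z) = 'i%C *: WW Z by rewrite WW_mk.
have zJ Z : zz (flat_J x Z) = Li k (WW x) ('i%C *: Lf k (WW x) (zz Z)) by rewrite zz_mk.
have LD Z U : Lf k (WW x) (zz (DJ Z U)) =
    'i%C *: (WW Z *m Qc k (zz U)) - WW Z *m Qc k (flat_Jz U x).
  by rewrite zD; exact: Lf_mderive_flat_Jz.
have W4 (A B D E : V) : WW (A - B + D - E) = WW A - WW B + WW D - WW E.
  by rewrite !(WWD, WWN).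
have z4 (A B D E : V) : zz (A - B + D - E) = zz A - zz B + zz D - zz E.
  by rewrite !(zzD, zzN).
have L4 (a b d e : 'cV[C]_n) :
   Lf k (WW x) (a - b + d - e) = Lf k (WW x) a - Lf k (WW x) b + Lf k (WW x) d - Lf k (WW x) e.
  by rewrite LfB LfD LfB.
move: DJ {zD} WD LD => DJ WD LD.
apply: (@coord_inj _ _ _ ch); last first.
  have WJD Z U : WW (flat_J x (DJ Z U)) = 0 by rewrite WJ WD scaler0.
  have comb (A B D E : 'M[C]_n) : A = 0 -> B = 0 -> D = 0 -> E = 0 -> A - B + D - E = 0.
    by move=> -> -> -> ->; rewrite !subr0 addr0.
  apply: etrans (W4 _ _ _ _) (etrans (comb _ _ _ _ (WD _ Y) (WD _ X) (WJD Y X) (WJD X Y)) _).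
  by rewrite WW0.
(* The fibre component of the Nijenhuis tensor after applying L_W, with A, B the base and u, v the
   fibre components of X, Y, and ju, jv the fibre components of JX, JY; the terms cancel in
   pairs. *)
have alg (A B : 'M[C]_n) (u v ju jv : 'cV[C]_n) :
  'i%C *: (('i%C *: A) *m v) - ('i%C *: A) *m jv
  - ('i%C *: (('i%C *: B) *m u) - ('i%C *: B) *m ju)
  + 'i%C *: ('i%C *: (B *m u) - B *m ju)
  - 'i%C *: ('i%C *: (A *m v) - A *m jv) = 0 by mx_ring.
have LJ D : Lf k (WW x) (zz (flat_J x D)) = 'i%C *: Lf k (WW x) (zz D) by rewrite zJ (LfK uK).
have E1 := LD (flat_J x X) Y; rewrite WJ in E1.
have E2 := LD (flat_J x Y) X; rewrite WJ in E2.
have E3 := LJ (DJ Y X); rewrite LD in E3.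
have E4 := LJ (DJ X Y); rewrite LD in E4.
apply: (Lf_inj uK); rewrite zz0 Lf0.
apply: etrans (f_equal (Lf k (WW x)) (z4 _ _ _ _)) _.
apply: etrans (L4 _ _ _ _) _.
have comb (a b d e a' b' d' e' : 'cV[C]_n) : a = a' -> b = b' -> d = d' -> e = e' ->
  a - b + d - e = a' - b' + d' - e' by move=> -> -> -> ->.
exact: etrans (comb _ _ _ _ _ _ _ _ E1 E2 E3 E4) (alg _ _ _ _ _ _).
Qed.

End CurvedFlat.

(** * Group actions *)

Section KahlerExt.
Variables (R : realType) (V : normedModType R).

Lemma smooth_on_eq (W : normedModType R) (A : set V) (f g : V -> W) :
  (forall x, A x -> f x = g x) -> smooth_on A f -> smooth_on A g.
Proof.
move=> fg sf x Ax; have [D [h [oD Dx sh hf]]] := sf x Ax.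
by exists D, h; split=> // y Ay Dy; rewrite hf// fg.
Qed.

(** The forms of the theorem are identified with the model forms on the domain only; the segment
    hypothesis is what transfers closedness, the clause that differentiates the form. *)
Lemma kahler_ext (A T : set V) (w w' : V -> V -> V -> R[i]) (J : V -> V -> V) :
  (forall x X, A x -> T X -> \forall h \near (0 : R), A (h *: X + x)) ->
  (forall x X Y, A x -> T X -> T Y -> w x X Y = w' x X Y) ->
  kahler A T w J -> kahler A T w' J.
Proof.
move=> Al ww [op [r1 r2 r3 r4] cl [c1 c2 c3 c4] [k1 k2]].
have Tl := op; case: Tl => _ Tl _.
split; [exact: op| | |by split|].
- split.
  + by move=> x X Y Ax TX TY; rewrite -ww// r1.
  + move=> x c X Y Z Ax TX TY TZ; rewrite -!ww//; first exact: r2.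
    exact: Tl.
  + by move=> x X Y Ax TX TY; rewrite -!ww// r3.
  + by move=> X Y TX TY; apply: smooth_on_eq (r4 X Y TX TY) => x Ax; rewrite ww.
- move=> x X Y Z Ax TX TY TZ; rewrite -[RHS](cl x X Y Z Ax TX TY TZ).
  by congr (_ + _ + _); apply: derive_eq_on_line;
    [have := Al x X Ax TX|have := Al x Y Ax TY|have := Al x Z Ax TZ];
    apply: filterS => h Ah; rewrite ww.
split.
  move=> x X Y Ax TX TY; have [JX _] := c1 x X Ax TX; have [JY _] := c1 x Y Ax TY.
  by rewrite -!ww// k1.
move=> x X Ax TX X0; have [JX _] := c1 x X Ax TX.
by rewrite -ww//; exact: k2.
Qed.

End KahlerExt.

Lemma gform_eq (R : realType) n (c : R[i]) (P P' : 'M[R[i]]_n) a a' X X' b b' Y Y' :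
  P = P' -> a = a' -> X = X' -> b = b' -> Y = Y' ->
  gform c P a X b Y = gform c P' a' X' b' Y'.
Proof. by move=> -> -> -> -> ->. Qed.

Section Homogeneous.
Variables (R : realType) (n : nat) (V : normedModType R) (k : coeffs R) (ch : chart n V).
Variable c : R.
Hypothesis c0 : 0 < c.
Hypothesis e2_le0 : ce2 k <= 0.
Local Notation C := R[i].
Local Notation WW := (WW ch).
Local Notation zz := (zz ch).
Local Notation mk := (mk ch).
Local Notation SA := (SA k ch).
Local Notation ST := (ST ch).
Local Notation P x := (Pf k (WW x)).
Local Notation dz_hor := (dz_hor k ch).
Local Notation flat_hor := (flat_hor k ch).
Local Notation curved_J := (curved_J ch).
Local Notation flat_J := (flat_J k ch).
Local Notation curved_form := (curved_form k ch c).
Local Notation flat_form := (flat_form k ch c).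

Definition curved_act (g : coeff_transf R n) (x : V) : V :=
  mk (zact k g (zz x) (WW x)) (Wact g (WW x)).
Definition flat_act (g : coeff_transf R n) (x : V) : V :=
  mk (eact g (zz x)) (Wact g (WW x)).
Definition FCm (x : V) : V := mk (Lf k (WW x) (zz x)) (WW x).
Definition FCi (x : V) : V := mk (Li k (WW x) (zz x)) (WW x).

Lemma FCm_SA x : SA x -> SA (FCm x).
Proof. by rewrite /SA /= WW_mk. Qed.

Lemma FCi_SA x : SA x -> SA (FCi x).
Proof. by rewrite /SA /= WW_mk. Qed.

Lemma FCmK x : SA x -> FCi (FCm x) = x.
Proof.
by move=> Ax; rewrite /FCi /FCm zz_mk WW_mk (LiK (dom_unit Ax)) mk_coord.
Qed.

Lemma FCiK x : SA x -> FCm (FCi x) = x.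
Proof.
by move=> Ax; rewrite /FCi /FCm zz_mk WW_mk (LfK (dom_unit Ax)) mk_coord.
Qed.

Lemma FC_bij : inverse_bijections SA SA FCm FCi.
Proof. by split; [exact: FCm_SA|exact: FCi_SA|exact: FCmK|exact: FCiK]. Qed.

Lemma smooth_FCm x : smooth_at x FCm.
Proof.
by apply: smooth_mk; [apply: msmooth_Lf; exact: msmooth_zz|exact: msmooth_WW].
Qed.

Lemma smooth_FCi x : SA x -> smooth_at x FCi.
Proof.
move=> Ax; apply: smooth_mk; last exact: msmooth_WW.
by apply: msmooth_Li; [exact: dom_unit|exact: msmooth_zz].
Qed.

Lemma FC_diffeo : diffeomorphism SA SA FCm.
Proof.
exists FCi; split; first exact: FC_bij.
  by apply: smooth_at_on => x _; exact: smooth_FCm.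
by apply: smooth_at_on => x; exact: smooth_FCi.
Qed.

Lemma WW_derive_FCm x X : WW ('D_X FCm x) = WW X.
Proof.
rewrite (@WW_derive_mk _ _ _ _ x (fun x => Lf k (WW x) (zz x)) WW) ?mderive_WW//.
  by apply: msmooth_Lf; exact: msmooth_zz.
exact: msmooth_WW.
Qed.

Lemma dz_hor_FCm x X : SA x -> dz_hor (FCm x) ('D_X FCm x) = flat_hor x X.
Proof.
move=> Ax; rewrite /dz_hor WW_derive_FCm /eta zz_mk WW_mk (LiK (dom_unit Ax)).
rewrite (@zz_derive_mk _ _ _ _ x (fun x => Lf k (WW x) (zz x)) WW).
- rewrite mderive_Lf; last exact: msmooth_zz.
  by rewrite mderive_zz addrK.
- by apply: msmooth_Lf; exact: msmooth_zz.
exact: msmooth_WW.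
Qed.

Lemma FC_pullback : eq_form SA ST (pullback FCm curved_form) flat_form.
Proof.
move=> x X Y Ax _ _; apply: gform_eq; first by rewrite WW_mk.
- exact: dz_hor_FCm.
- exact: WW_derive_FCm.
- exact: dz_hor_FCm.
exact: WW_derive_FCm.
Qed.

Section Transf.
Variable g : coeff_transf R n.
Hypothesis gadm : admissible k g.

Let act_dom x : SA x -> dom k (Wact g (WW x)).
Proof. by move=> Ax; apply: Wact_dom. Qed.

Lemma curved_act_SA x : SA x -> SA (curved_act g x).
Proof. by move=> Ax; rewrite /SA /= WW_mk; exact: act_dom. Qed.

Lemma flat_act_SA x : SA x -> SA (flat_act g x).
Proof. by move=> Ax; rewrite /SA /= WW_mk; exact: act_dom. Qed.

Lemma FCm_act x : SA x -> FCm (flat_act g x) = curved_act g (FCm x).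
Proof.
move=> Ax; rewrite /FCm /flat_act /curved_act !zz_mk !WW_mk; congr mk.
rewrite /eact /zact.
by rewrite (Lf_Wact gadm e2_le0 Ax) LfD.
Qed.

Section At.
Variable x : V.
Hypothesis Ax : SA x.
Local Notation N := (nden g (WW x)).

Let dx : dom k (WW x). Proof. exact: Ax. Qed.
Let uN : N \in unitmx. Proof. exact: (nden_unit gadm e2_le0 dx). Qed.
Let uZ : zden g (WW x) \in unitmx. Proof. exact: (zden_unit gadm e2_le0 dx). Qed.

Lemma msmooth_zden : msmooth x (fun y => zden g (WW y)).
Proof.
under eq_fun do rewrite zdenE.
by apply: msmooth_add; [apply: msmooth_mul; [exact: msmooth_cst|exact: msmooth_WW]|exact: msmooth_cst].
Qed.

Lemma msmooth_nden : msmooth x (fun y => nden g (WW y)).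
Proof.
under eq_fun do rewrite ndenE.
by apply: msmooth_add; [apply: msmooth_mul; [exact: msmooth_WW|exact: msmooth_cst]|exact: msmooth_cst].
Qed.

Lemma msmooth_Wact : msmooth x (fun y => Wact g (WW y)).
Proof.
under eq_fun do rewrite WactE.
apply: msmooth_mul; last exact: msmooth_invmx msmooth_zden uZ.
by apply: msmooth_add; [apply: msmooth_mul; [exact: msmooth_cst|exact: msmooth_WW]|exact: msmooth_cst].
Qed.

Lemma msmooth_zact : msmooth x (fun y => zact k g (zz y) (WW y)).
Proof.
apply: msmooth_mul; first exact: msmooth_invmx msmooth_nden uN.
by apply: msmooth_add; [exact: msmooth_zz|apply: msmooth_Lf; exact: msmooth_cst].
Qed.

Lemma msmooth_eact : msmooth x (fun y => eact g (zz y)).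
Proof.
have sz : msmooth x (fun y => zz y + tal g).
  by apply: msmooth_add; [exact: msmooth_zz|exact: msmooth_cst].
by apply: msmooth_add; apply: msmooth_mul; try exact: msmooth_cst; [|exact: msmooth_conj].
Qed.

Lemma smooth_curved_act : smooth_at x (curved_act g).
Proof. by apply: smooth_mk; [exact: msmooth_zact|exact: msmooth_Wact]. Qed.

Lemma smooth_flat_act : smooth_at x (flat_act g).
Proof. by apply: smooth_mk; [exact: msmooth_eact|exact: msmooth_Wact]. Qed.

(** The quotient rule gives (p - W_1 r) dW (r W + s)^-1; the left factor is N^-1 and the right one
    its transpose. *)
Lemma mderive_Wact X :
  mderive X (fun y => Wact g (WW y)) x = invmx N *m WW X *m (invmx N)^T.
Proof.
have sZ := msmooth_zden; have sI := msmooth_invmx sZ uZ.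
have sp := msmooth_cst x (tp g); have sW := @msmooth_WW _ _ _ ch x.
have sr := msmooth_cst x (tr g).
have sn : msmooth x (fun y => tp g *m WW y + tq g).
  by apply: msmooth_add; [exact: msmooth_mul|exact: msmooth_cst].
under eq_fun do rewrite WactE.
rewrite mderive_mul// mderive_invmx//.
have -> : mderive X (fun y => tp g *m WW y + tq g) x = tp g *m WW X.
  rewrite mderive_add; [|exact: msmooth_mul|exact: msmooth_cst].
  by rewrite mderive_cst addr0 mderive_mul// mderive_cst mul0mx add0r mderive_WW.
have -> : mderive X (fun y => zden g (WW y)) x = tr g *m WW X.
  under eq_fun do rewrite zdenE.
  rewrite mderive_add; [|exact: msmooth_mul|exact: msmooth_cst].
  by rewrite mderive_cst addr0 mderive_mul// mderive_cst mul0mx add0r mderive_WW.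
have Nt : (invmx N)^T = invmx (zden g (WW x)) by rewrite trmx_inv -(zden_tr g dx) trmxK.
rewrite Nt (Wact_den gadm e2_le0 dx) WactE.
have alg (p u r I A : 'M[C]_n) :
  p *m A *m I + u *m (- (I *m (r *m A) *m I)) = (p - u *m I *m r) *m A *m I by mx_ring.
exact: alg.
Qed.

(** Obtained by differentiating N z_1 = z + L_W(alpha), so that N^-1 is never differentiated. *)
Lemma mderive_zact X : N *m mderive X (fun y => zact k g (zz y) (WW y)) x =
  zz X + WW X *m Qc k (tal g) - WW X *m (tr g)^T *m zact k g (zz x) (WW x).
Proof.
have sN := msmooth_nden; have sz := msmooth_zact.
have sL := @msmooth_Lf _ _ _ k ch x _ (msmooth_cst x (tal g)).
have szz := @msmooth_zz _ _ _ ch x.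
have dN : mderive X (fun y => nden g (WW y)) x = WW X *m (tr g)^T.
  under eq_fun do rewrite ndenE.
  have sW := @msmooth_WW _ _ _ ch x; have sr := msmooth_cst x (tr g)^T.
  rewrite mderive_add; [|exact: msmooth_mul|exact: msmooth_cst].
  by rewrite mderive_cst addr0 mderive_mul// mderive_cst mulmx0 addr0 mderive_WW.
have E : mderive X (fun y => nden g (WW y) *m zact k g (zz y) (WW y)) x
    = mderive X (fun y => zz y + Lf k (WW y) (tal g)) x.
  apply: mderive_near; apply: filterS (near_unitmx sN uN) => y uy.
  by rewrite /zact mulKVmx.
move: E; rewrite mderive_mul// dN mderive_add// mderive_zz mderive_Lf; last exact: msmooth_cst.
by rewrite mderive_cst Lf0 add0r => <-; rewrite [RHS]addrAC subrr add0r.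
Qed.

Lemma zz_derive_curved X : N *m zz ('D_X (curved_act g) x) =
  zz X + WW X *m Qc k (tal g) - WW X *m (tr g)^T *m zact k g (zz x) (WW x).
Proof. by rewrite (zz_derive_mk ch msmooth_zact msmooth_Wact) mderive_zact. Qed.

Lemma WW_derive_curved X :
  WW ('D_X (curved_act g) x) = invmx N *m WW X *m (invmx N)^T.
Proof. by rewrite (WW_derive_mk ch msmooth_zact msmooth_Wact) mderive_Wact. Qed.

Lemma zz_derive_flat X : zz ('D_X (flat_act g) x) = rho g (zz X).
Proof.
rewrite (zz_derive_mk ch msmooth_eact msmooth_Wact) /eact /rho.
have szz := @msmooth_zz _ _ _ ch x.
have sz : msmooth x (fun y => zz y + tal g).
  by apply: msmooth_add => //; exact: msmooth_cst.
have scz := msmooth_conj sz.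
have s1 := msmooth_cst x (trho1 g); have s2 := msmooth_cst x (trho2 g).
rewrite mderive_add; [|exact: msmooth_mul..].
rewrite !mderive_mul// !mderive_cst !mul0mx !add0r mderive_conj//.
rewrite mderive_add//; last exact: msmooth_cst.
by rewrite mderive_cst addr0 mderive_zz.
Qed.

Lemma WW_derive_flat X :
  WW ('D_X (flat_act g) x) = invmx N *m WW X *m (invmx N)^T.
Proof. by rewrite (WW_derive_mk ch msmooth_eact msmooth_Wact) mderive_Wact. Qed.

Lemma eta_curved_act : eta k ch (curved_act g x) = rho g (eta k ch x + tal g).
Proof.
have uK1 := dom_unit (act_dom Ax).
rewrite /eta zz_mk WW_mk -[RHS](LiK uK1); congr Li.
rewrite (Lf_Wact gadm e2_le0 dx) LfD.
by rewrite (LfK (dom_unit dx)).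
Qed.

(** The extra terms in dz_1, one from alpha and one from dN, are exactly compensated by the change
    of Q(eta) under the action; what remains is multiplication by N^-1. *)
Lemma dz_hor_curved X :
  dz_hor (curved_act g x) ('D_X (curved_act g) x) = invmx N *m dz_hor x X.
Proof.
apply: (canRL (mulKmx uN)); rewrite {1}/dz_hor.
rewrite CmulDr CmulNr zz_derive_curved WW_derive_curved eta_curved_act.
set e := eta k ch x; set e1 := rho g (e + tal g).
(* The intertwining relation is taken at eta + alpha because the transformed eta is rho(eta +
   alpha). *)
have [_ _ /(_ (e + tal g)) [hQ _]] := gadm.
have z1 : zact k g (zz x) (WW x) = Lf k (Wact g (WW x)) e1.
  by rewrite (Lf_Wact gadm e2_le0 dx) LfD (LfK (dom_unit dx)).
have Nt : (invmx N)^T = (tp g)^T - (tr g)^T *m Wact g (WW x).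
  rewrite (Wact_den gadm e2_le0 dx) !trmxE.
  by rewrite -(Wact_sym gadm e2_le0 dx).
have -> : N *m (invmx N *m WW X *m (invmx N)^T *m Qc k e1)
        = WW X *m (((tp g)^T - (tr g)^T *m Wact g (WW x)) *m Qc k e1).
  by rewrite Nt !CmulA mulmxV// mul1mx.
have QE : Qc k e = (tp g)^T *m Qc k e1 + (tr g)^T *m Pc k e1 - Qc k (tal g).
  by rewrite hQ QcD addrK.
rewrite z1 LfE /dz_hor -/e QE.
have alg (u a b d : 'cV[C]_n) (A p r B : 'M[C]_n) :
  u + A *m d - A *m r *m (b + B *m a) - A *m ((p - r *m B) *m a)
  = u - A *m (p *m a + r *m b - d) by mx_ring.
exact: alg.
Qed.

Lemma flat_hor_act X :
  flat_hor (flat_act g x) ('D_X (flat_act g) x) = invmx N *m flat_hor x X.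
Proof. by rewrite /flat_hor zz_derive_flat WW_mk (Lf_Wact gadm e2_le0 dx). Qed.

Lemma curved_form_act X Y :
  curved_form (curved_act g x) ('D_X (curved_act g) x) ('D_Y (curved_act g) x)
  = curved_form x X Y.
Proof.
apply: etrans (gform_congr _ _ _ _ _ _ uN); apply: gform_eq.
- by rewrite WW_mk (Pf_Wact gadm e2_le0 dx).
- exact: dz_hor_curved.
- exact: WW_derive_curved.
- exact: dz_hor_curved.
exact: WW_derive_curved.
Qed.

Lemma flat_form_act X Y :
  flat_form (flat_act g x) ('D_X (flat_act g) x) ('D_Y (flat_act g) x)
  = flat_form x X Y.
Proof.
apply: etrans (gform_congr _ _ _ _ _ _ uN); apply: gform_eq.
- by rewrite WW_mk (Pf_Wact gadm e2_le0 dx).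
- exact: flat_hor_act.
- exact: WW_derive_flat.
- exact: flat_hor_act.
exact: WW_derive_flat.
Qed.

Lemma zz_curved_J y X : zz (curved_J y X) = 'i%C *: zz X.
Proof. exact: zz_mk. Qed.

Lemma WW_curved_J y X : WW (curved_J y X) = 'i%C *: WW X.
Proof. exact: WW_mk. Qed.

Lemma zz_flat_J y X : zz (flat_J y X) = flat_Jz k ch X y.
Proof. exact: zz_mk. Qed.

Lemma WW_flat_J y X : WW (flat_J y X) = 'i%C *: WW X.
Proof. exact: WW_mk. Qed.

Lemma curved_J_act X :
  'D_(curved_J x X) (curved_act g) x = curved_J (curved_act g x) ('D_X (curved_act g) x).
Proof.
have iN : injective (fun u : 'cV[C]_n => N *m u) by exact: can_inj (mulKmx uN).
apply: (@coord_inj _ _ _ ch).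
  apply: iN; rewrite (zz_curved_J _ ('D_X _ x)) (zz_derive_curved (curved_J x X)) CmulZr.
  rewrite (zz_derive_curved X) (zz_curved_J x X) (WW_curved_J x X).
  have alg (d : C) (u a b : 'cV[C]_n) (A B : 'M[C]_n) :
    d *: u + (d *: A) *m a - (d *: A) *m B *m b = d *: (u + A *m a - A *m B *m b) by mx_ring.
  exact: alg.
rewrite (WW_derive_curved (curved_J x X)) (WW_curved_J _ ('D_X _ x)) (WW_curved_J x X).
by rewrite (WW_derive_curved X) CmulZr CmulZl.
Qed.

Lemma flat_J_act X :
  'D_(flat_J x X) (flat_act g) x = flat_J (flat_act g x) ('D_X (flat_act g) x).
Proof.
have uK1 := dom_unit (act_dom Ax); have uK := dom_unit dx.
apply: (@coord_inj _ _ _ ch).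
  apply: (Lf_inj uK1); rewrite (zz_flat_J _ ('D_X _ x)) (zz_derive_flat (flat_J x X)).
  rewrite (zz_flat_J x X) /flat_Jz (WW_mk ch _ (Wact g (WW x))) (LfK uK1).
  by rewrite !(Lf_Wact gadm e2_le0 dx) (LfK uK) zz_derive_flat (Lf_Wact gadm e2_le0 dx) CmulZr.
rewrite (WW_derive_flat (flat_J x X)) (WW_flat_J _ ('D_X _ x)) (WW_flat_J x X).
by rewrite (WW_derive_flat X) CmulZr CmulZl.
Qed.

Lemma ST_congr (A : 'M[C]_n) (X Y : V) : ST X -> WW Y = A *m WW X *m A^T -> ST Y.
Proof. by rewrite /ST /= => TX ->; rewrite !trmxE -TX CmulA. Qed.

End At.
End Transf.
End Homogeneous.

Section Transitivity.
Variables (R : realType) (V : normedModType R) (E : Type).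

Lemma transitive_from_base (G : set E) mul one (A : set V) (act : E -> V -> V) x0 :
  is_group G mul one -> is_action G mul one A act -> A x0 ->
  (forall x, A x -> exists2 h, G h & act h x0 = x) ->
  transitive_action G A act.
Proof.
move=> [_ Gm _ _ Gi] [_ a1 am] A0 base x y Ax Ay.
have [h Gh hx] := base x Ax; have [h' Gh' hy] := base y Ay.
have [b [Gb _ bh]] := Gi h Gh.
exists (mul h' b); first exact: Gm.
by rewrite am// -hx -(am b h)// bh a1.
Qed.

Lemma group_act_diffeo (G : set E) mul one (A : set V) (act : E -> V -> V) :
  is_group G mul one -> is_action G mul one A act ->
  (forall h x, G h -> A x -> smooth_at x (act h)) ->
  forall h, G h -> diffeomorphism A A (act h).
Proof.
move=> [_ Gm _ _ Gi] [aA a1 am] sm h Gh; have [b [Gb hb bh]] := Gi h Gh.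
exists (act b); split.
- split; [by move=> x; exact: aA|by move=> x; exact: aA| |].
    by move=> x Ax; rewrite -am// bh a1.
  by move=> x Ax; rewrite -am// hb a1.
- by apply: smooth_at_on => x; exact: sm.
by apply: smooth_at_on => x; exact: sm.
Qed.

End Transitivity.

(** * From transformation data to homogeneous Kaehler manifolds *)

Section Model.
Variables (R : realType) (n : nat) (V : normedModType R) (k : coeffs R) (ch : chart n V).
Variable c : R.
Hypothesis c0 : 0 < c.
Hypothesis e2_le0 : ce2 k <= 0.
Local Notation C := R[i].
Local Notation WW := (WW ch).
Local Notation zz := (zz ch).
Local Notation mk := (mk ch).
Local Notation SA := (SA k ch).
Local Notation ST := (ST ch).
Local Notation FCm := (FCm k ch).
Local Notation FCi := (FCi k ch).

Variables (E : Type) (Gs : set E) (mul : E -> E -> E) (one : E).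
Variable ct : E -> coeff_transf R n.
Hypothesis Ggroup : is_group Gs mul one.
Hypothesis ctadm : forall h, Gs h -> admissible k (ct h).

Definition pure_translation (g : coeff_transf R n) (a : 'cV[C]_n) : Prop :=
  [/\ [/\ tp g = 1%:M, tq g = 0, tr g = 0 & ts g = 1%:M] & tal g = a].

Hypothesis ct1 : pure_translation (ct one) 0.
Hypothesis ctM : forall h h', Gs h -> Gs h' ->
  [/\ tp (ct (mul h h')) = tp (ct h) *m tp (ct h') + tq (ct h) *m tr (ct h'),
      tq (ct (mul h h')) = tp (ct h) *m tq (ct h') + tq (ct h) *m ts (ct h'),
      tr (ct (mul h h')) = tr (ct h) *m tp (ct h') + ts (ct h) *m tr (ct h')
    & ts (ct (mul h h')) = tr (ct h) *m tq (ct h') + ts (ct h) *m ts (ct h')].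
(** The translation part of the group law, g'^-1 alpha + alpha', in the components P and Q: on these
    the transposed blocks of g' invert its action, as in the third group of [admissible]. *)
Hypothesis ctMal : forall h h', Gs h -> Gs h' ->
  let al := tal (ct h) in
  Pc k (tal (ct (mul h h'))) = Pc k (tal (ct h'))
     + ((tq (ct h'))^T *m Qc k al + (ts (ct h'))^T *m Pc k al) /\
  Qc k (tal (ct (mul h h'))) = Qc k (tal (ct h'))
     + ((tp (ct h'))^T *m Qc k al + (tr (ct h'))^T *m Pc k al).
Hypothesis ct_translation : forall a, exists2 h, Gs h & pure_translation (ct h) a.
Hypothesis ct_base : exists2 W0, dom k W0 &
  forall W, dom k W -> exists h, [/\ Gs h, tal (ct h) = 0 & Wact (ct h) W0 = W].

Lemma curved_act_translation g a x : pure_translation g a ->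
  curved_act k ch g x = mk (zz x + Lf k (WW x) a) (WW x).
Proof.
move=> [[p1 q0 r0 s1] al]; rewrite /curved_act /zact WactE zdenE ndenE p1 q0 r0 s1 al.
by rewrite mul0mx add0r trmx0 mulmx0 add0r trmx1 invmx1 mulmx1 addr0 !mul1mx.
Qed.

Lemma curved_act_one x : curved_act k ch (ct one) x = x.
Proof. by rewrite (curved_act_translation _ ct1) Lf0 addr0 mk_coord. Qed.

Lemma Wact_zden h W : Gs h -> dom k W ->
  Wact (ct h) W *m zden (ct h) W = tp (ct h) *m W + tq (ct h).
Proof.
by move=> Gh dW; rewrite WactE (mulmxKV (zden_unit (ctadm Gh) e2_le0 dW)).
Qed.

(** The cocycle property of the denominators: multiplying W_1 = h'W by its denominator restores the
    numerator. *)
Lemma zden_mul h h' W : Gs h -> Gs h' -> dom k W ->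
  zden (ct (mul h h')) W = zden (ct h) (Wact (ct h') W) *m zden (ct h') W.
Proof.
move=> Gh Gh' dW; have [_ _ rE sE] := ctM Gh Gh'.
rewrite [zden (ct h) _]zdenE CmulDl -CmulA Wact_zden// !zdenE rE sE.
by mx_ring.
Qed.

Lemma Wact_mul h h' W : Gs h -> Gs h' -> dom k W ->
  Wact (ct (mul h h')) W = Wact (ct h) (Wact (ct h') W).
Proof.
move=> Gh Gh' dW; have uZ := zden_unit (ctadm Gh') e2_le0 dW.
have dW' := Wact_dom (ctadm Gh') e2_le0 dW.
have uZ' := zden_unit (ctadm Gh) e2_le0 dW'.
have uZZ : zden (ct (mul h h')) W \in unitmx by rewrite zden_mul// unitmx_mul uZ uZ'.
have [pE qE _ _] := ctM Gh Gh'.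
rewrite [LHS]WactE pE qE; apply: (canLR (mulmxK uZZ)).
rewrite zden_mul// CmulA Wact_zden// [in RHS]CmulDl -[in RHS]CmulA Wact_zden// zdenE.
by mx_ring.
Qed.

Lemma nden_mul h h' W : Gs h -> Gs h' -> dom k W ->
  nden (ct (mul h h')) W = nden (ct h') W *m nden (ct h) (Wact (ct h') W).
Proof.
move=> Gh Gh' dW; have [_ _ _ _ _] := Ggroup.
have dW' := Wact_dom (ctadm Gh') e2_le0 dW.
by rewrite -(zden_tr _ dW) -(zden_tr _ dW') -(zden_tr _ dW) zden_mul// trmxM.
Qed.

Lemma Lf_tal_mul h h' W : Gs h -> Gs h' -> dom k W ->
  Lf k W (tal (ct (mul h h'))) = Lf k W (tal (ct h'))
    + nden (ct h') W *m Lf k (Wact (ct h') W) (tal (ct h)).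
Proof.
move=> Gh Gh' dW; have [PE QE] := ctMal Gh Gh'.
have NW := nden_Wact (ctadm Gh') e2_le0 dW.
have -> : nden (ct h') W *m Lf k (Wact (ct h') W) (tal (ct h)) =
  nden (ct h') W *m Pc k (tal (ct h)) + (nden (ct h') W *m Wact (ct h') W) *m Qc k (tal (ct h)).
  by rewrite [Lf k (Wact _ _) _]LfE mulmxDr mulmxA.
rewrite NW !LfE PE QE ndenE.
by mx_ring.
Qed.

Lemma zact_mul h h' z W : Gs h -> Gs h' -> dom k W ->
  zact k (ct (mul h h')) z W = zact k (ct h) (zact k (ct h') z W) (Wact (ct h') W).
Proof.
move=> Gh Gh' dW.
have uN := nden_unit (ctadm Gh') e2_le0 dW.
have dW' := Wact_dom (ctadm Gh') e2_le0 dW.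
have uN' := nden_unit (ctadm Gh) e2_le0 dW'.
have uNN : nden (ct (mul h h')) W \in unitmx by rewrite nden_mul// unitmx_mul uN uN'.
rewrite [LHS]/zact; apply: (canLR (mulKmx uNN)).
rewrite [in RHS]/zact nden_mul// -CmulA (mulKVmx uN') Lf_tal_mul//.
by rewrite [in RHS]CmulDr (mulKVmx uN) addrA.
Qed.

Lemma curved_act_mul h h' x : Gs h -> Gs h' -> SA x ->
  curved_act k ch (ct (mul h h')) x = curved_act k ch (ct h) (curved_act k ch (ct h') x).
Proof.
move=> Gh Gh' Ax; have dW : dom k (WW x) := Ax.
have Z : zz (curved_act k ch (ct h') x) = zact k (ct h') (zz x) (WW x) by exact: zz_mk.
have W : WW (curved_act k ch (ct h') x) = Wact (ct h') (WW x) by exact: WW_mk.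
rewrite [RHS]/curved_act Z W.
exact: (f_equal2 mk (zact_mul _ Gh Gh' dW) (Wact_mul Gh Gh' dW)).
Qed.

Lemma curved_is_action : is_action Gs mul one SA (fun h => curved_act k ch (ct h)).
Proof.
split.
- move=> h x Gh Ax; exact: (curved_act_SA e2_le0 (ctadm Gh) Ax).
- by move=> x _; exact: curved_act_one.
- by move=> h h' x Gh Gh' Ax; exact: curved_act_mul.
Qed.

Lemma FCm_inj x y : SA x -> SA y -> FCm x = FCm y -> x = y.
Proof. by move=> Ax Ay /(congr1 FCi); rewrite (FCmK Ax) (FCmK Ay). Qed.

(** The composition law is inherited from the action on (z, W) through the injective equivariant map
    [FCm], instead of being verified on [rho]. *)
Lemma flat_is_action : is_action Gs mul one SA (fun h => flat_act ch (ct h)).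
Proof.
have [G1 Gm _ _ _] := Ggroup.
have fA h x : Gs h -> SA x -> SA (flat_act ch (ct h) x).
  by move=> Gh Ax; exact: (flat_act_SA e2_le0 (ctadm Gh) Ax).
have fc h x (Gh : Gs h) (Ax : SA x) := FCm_act e2_le0 (ctadm Gh) Ax.
split; first exact: fA.
- move=> x Ax; apply: (FCm_inj (fA _ _ G1 Ax) Ax).
  by rewrite (fc _ _ G1 Ax); exact: curved_act_one.
move=> h h' x Gh Gh' Ax; have Ghh := Gm _ _ Gh Gh'.
have Ah' := fA h' x Gh' Ax; have AF := FCm_SA Ax.
apply: (FCm_inj (fA _ _ Ghh Ax) (fA _ _ Gh Ah')).
rewrite (fc _ _ Ghh Ax) (fc _ _ Gh Ah') (fc _ _ Gh' Ax).
exact: (curved_act_mul Gh Gh' AF).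
Qed.

Lemma curved_transitive : transitive_action Gs SA (fun h => curved_act k ch (ct h)).
Proof.
have [W0 dW0 base] := ct_base; have [G1 Gm _ _ _] := Ggroup.
have A0 : SA (mk 0 W0) by rewrite /SA /= WW_mk.
apply: (transitive_from_base Ggroup curved_is_action A0) => x Ax.
have [h [Gh al0 hW]] := base (WW x) Ax.
(* A translation by a shifts the fibre coordinate by L_W(a), so a = L_W^-1 z carries (0, W) to (z,
   W). *)
have [t Gt tt] := ct_translation (Li k (WW x) (zz x)).
exists (mul t h); first exact: Gm.
have [_ _ -> //] := curved_is_action.
rewrite (curved_act_translation _ tt) zz_mk !WW_mk hW (LfK (dom_unit Ax)).
by rewrite /zact zz_mk al0 Lf0 addr0 mulmx0 add0r mk_coord.
Qed.

Lemma flat_transitive : transitive_action Gs SA (fun h => flat_act ch (ct h)).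
Proof.
move=> x y Ax Ay; have [h Gh hE] := curved_transitive (FCm_SA Ax) (FCm_SA Ay).
exists h; first exact: Gh.
apply: (FCm_inj (flat_act_SA e2_le0 (ctadm Gh) Ax) Ay).
by rewrite (FCm_act e2_le0 (ctadm Gh) Ax).
Qed.

Variable w : V -> V -> V -> C.
Variable act : E -> V -> V.

Lemma homogeneous_curved :
  (forall x X Y, SA x -> ST X -> ST Y -> curved_form k ch c x X Y = w x X Y) ->
  (forall h, Gs h -> act h = curved_act k ch (ct h)) ->
  homogeneous_kahler (@GManifold R V SA ST w E Gs mul one act).
Proof.
move=> ww aE; have [cA c1 cm] := curved_is_action; have [G1 Gm _ _ _] := Ggroup.
have isa : is_action Gs mul one SA act.
  split.
  - by move=> h x Gh Ax; rewrite (aE _ Gh); exact: (cA _ _ Gh Ax).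
  - by move=> x Ax; rewrite (aE _ G1); exact: (c1 _ Ax).
  - move=> h h' x Gh Gh' Ax; rewrite (aE _ Gh) (aE _ Gh') (aE _ (Gm _ _ Gh Gh')).
    exact: (cm _ _ _ Gh Gh' Ax).
have inv h x X Y : Gs h -> SA x -> ST X -> ST Y -> w (act h x) ('D_X (act h) x) ('D_Y (act h) x) = w x X Y.
  move=> Gh Ax TX TY; rewrite (aE _ Gh).
  have dA : SA (curved_act k ch (ct h) x) := curved_act_SA e2_le0 (ctadm Gh) Ax.
  (* The base component is transformed by congruence and stays symmetric, so the two forms may also
     be identified at the image point. *)
  have TX' := ST_congr TX (WW_derive_curved e2_le0 (ctadm Gh) Ax X).
  have TY' := ST_congr TY (WW_derive_curved e2_le0 (ctadm Gh) Ax Y).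
  rewrite -(ww _ _ _ Ax TX TY) -(ww _ _ _ dA TX' TY').
  exact: (curved_form_act c e2_le0 (ctadm Gh) Ax X Y).
split => /=; [exact: Ggroup|exact: isa| |].
  by move=> x y Ax Ay; have [h Gh hE] := curved_transitive Ax Ay; exists h; rewrite ?(aE _ Gh).
exists (curved_J ch); split.
- apply: kahler_ext (curved_kahler k ch c0); first by move=> x X Ax TX; exact: (SA_line Ax TX).
  exact: ww.
- apply: (group_act_diffeo Ggroup isa) => h x Gh Ax; rewrite (aE _ Gh).
  exact: (smooth_curved_act e2_le0 (ctadm Gh) Ax).
- by move=> h Gh x X Y Ax TX TY; exact: inv.
move=> h x X Gh Ax TX; rewrite (aE _ Gh).
exact: (curved_J_act e2_le0 (ctadm Gh) Ax X).
Qed.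

Lemma homogeneous_flat :
  (forall x X Y, SA x -> ST X -> ST Y -> flat_form k ch c x X Y = w x X Y) ->
  (forall h, Gs h -> act h = flat_act ch (ct h)) ->
  homogeneous_kahler (@GManifold R V SA ST w E Gs mul one act).
Proof.
move=> ww aE; have [cA c1 cm] := flat_is_action; have [G1 Gm _ _ _] := Ggroup.
have isa : is_action Gs mul one SA act.
  split.
  - by move=> h x Gh Ax; rewrite (aE _ Gh); exact: (cA _ _ Gh Ax).
  - by move=> x Ax; rewrite (aE _ G1); exact: (c1 _ Ax).
  - move=> h h' x Gh Gh' Ax; rewrite (aE _ Gh) (aE _ Gh') (aE _ (Gm _ _ Gh Gh')).
    exact: (cm _ _ _ Gh Gh' Ax).
have inv h x X Y : Gs h -> SA x -> ST X -> ST Y -> w (act h x) ('D_X (act h) x) ('D_Y (act h) x) = w x X Y.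
  move=> Gh Ax TX TY; rewrite (aE _ Gh).
  have dA : SA (flat_act ch (ct h) x) := flat_act_SA e2_le0 (ctadm Gh) Ax.
  have TX' := ST_congr TX (WW_derive_flat e2_le0 (ctadm Gh) Ax X).
  have TY' := ST_congr TY (WW_derive_flat e2_le0 (ctadm Gh) Ax Y).
  rewrite -(ww _ _ _ Ax TX TY) -(ww _ _ _ dA TX' TY').
  exact: (flat_form_act c e2_le0 (ctadm Gh) Ax X Y).
split => /=; [exact: Ggroup|exact: isa| |].
  by move=> x y Ax Ay; have [h Gh hE] := flat_transitive Ax Ay; exists h; rewrite ?(aE _ Gh).
exists (flat_J k ch); split.
- apply: kahler_ext (flat_kahler k ch c0); first by move=> x X Ax TX; exact: (SA_line Ax TX).
  exact: ww.
- apply: (group_act_diffeo Ggroup isa) => h x Gh Ax; rewrite (aE _ Gh).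
  exact: (smooth_flat_act e2_le0 (ctadm Gh) Ax).
- by move=> h Gh x X Y Ax TX TY; exact: inv.
move=> h x X Gh Ax TX; rewrite (aE _ Gh).
exact: (flat_J_act e2_le0 (ctadm Gh) Ax X).
Qed.

End Model.

(** * The Siegel-Jacobi ball *)

Section BlockConjugate.
Variables (R : realType) (n : nat).
Local Notation C := R[i].
Implicit Types (p q : 'M[C]_n) (a : 'cV[C]_n).

Definition conj_block p q : 'M[C]_(n + n) := block_mx p q (cbar q) (cbar p).
(** The real-linear action on C^n, that is, the block matrix restricted to vectors (a, conj a). *)
Definition conj_app p q a : 'cV[C]_n := p *m a + q *m cbar a.

Lemma conj_block_mul p q p' q' :
  conj_block p q *m conj_block p' q' =
  conj_block (p *m p' + q *m cbar q') (p *m q' + q *m cbar p').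
Proof.
rewrite /conj_block mulmx_block !cbarE; congr block_mx.
  by rewrite addrC.
by rewrite addrC.
Qed.

Lemma conj_block_inv p q :
  conj_block p q *m conj_block (cadj p) (- q^T) =
  block_mx (p *m cadj p - q *m cadj q) (q *m p^T - p *m q^T)
    (cbar (q *m p^T - p *m q^T)) (cbar (p *m cadj p - q *m cadj q)).
Proof.
rewrite conj_block_mul /conj_block /cadj !cbarE; congr block_mx; mx_ring.
Qed.

(** The block matrix of p^* and -q^t is the candidate inverse of g. The first two relations defining
    the group say that it is a right inverse, the last two that it is a left inverse, and for square
    matrices one implies the other. *)
Lemma SpC_P p q : SpC R n (conj_block p q) <->
  conj_block p q *m conj_block (cadj p) (- q^T) = 1%:M.
Proof.
rewrite /SpC /= /conj_block block_mxKul block_mxKur; split.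
  move=> [_ h1 h2 _ _]; rewrite [LHS]conj_block_inv h1 h2 subrr.
  by rewrite cbar0 cbar_scalar conjc1 -scalar_mx_block.
move=> E; have E' := mulmx1C E.
move: E; rewrite [LHS]conj_block_inv [RHS]scalar_mx_block => /eq_block_mx [h1 h2 _ _].
move: E'; rewrite [LHS]conj_block_mul [RHS]scalar_mx_block => /eq_block_mx [h3 h4 _ _].
split=> //.
- by apply/eqP; rewrite eq_sym -subr_eq0 h2.
- by rewrite -h3 mulNmx.
have := congr1 (@cbar R n n) h4; rewrite /cadj !cbarE; mx_expand.
by move=> /eqP; rewrite subr_eq0 => /eqP.
Qed.

Lemma cadjK (A : 'M[C]_n) : cadj (cadj A) = A.
Proof. by rewrite /cadj cbar_tr cbarK trmxK. Qed.

Lemma SpC_inv p q : SpC R n (conj_block p q) -> SpC R n (conj_block (cadj p) (- q^T)).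
Proof.
by move=> /SpC_P /mulmx1C E; apply/SpC_P; rewrite cadjK !trmxE opprK.
Qed.

Lemma SpC_mul p q p' q' : SpC R n (conj_block p q) -> SpC R n (conj_block p' q') ->
  SpC R n (conj_block p q *m conj_block p' q').
Proof.
move=> /SpC_P E /SpC_P E'; rewrite conj_block_mul; apply/SpC_P; rewrite -conj_block_mul.
have -> : conj_block (cadj (p *m p' + q *m cbar q')) (- (p *m q' + q *m cbar p')^T) =
   conj_block (cadj p') (- q'^T) *m conj_block (cadj p) (- q^T).
  rewrite conj_block_mul; apply: (f_equal2 conj_block).
    by rewrite /cadj !cbarE !trmxE; mx_ring.
  by rewrite /cadj !trmxE !cbarE; mx_ring.
by rewrite -mulmxA (mulmxA (conj_block p' q')) E' mul1mx.
Qed.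

Lemma SpC_eq g : SpC R n g -> g = conj_block (ulsubmx g) (ursubmx g).
Proof. by case. Qed.

Lemma conj_app_mul p q p' q' a :
  conj_app (p *m p' + q *m cbar q') (p *m q' + q *m cbar p') a = conj_app p q (conj_app p' q' a).
Proof. by rewrite /conj_app !cbarE; mx_ring. Qed.

Lemma conj_appD p q a b : conj_app p q (a + b) = conj_app p q a + conj_app p q b.
Proof. by rewrite /conj_app !cbarE; mx_ring. Qed.

Lemma GJ_mulE p q p' q' a a' :
  GJ_mul (conj_block p q, a) (conj_block p' q', a') =
  (conj_block (p *m p' + q *m cbar q') (p *m q' + q *m cbar p'),
   conj_app (cadj p') (- q'^T) a + a').
Proof.
by rewrite -conj_block_mul /GJ_mul /= /conj_block block_mxKul block_mxKur /conj_app mulNmx.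
Qed.

Lemma conj_block1 : conj_block 1%:M 0 = 1%:M :> 'M[C]_(n + n).
Proof. by rewrite /conj_block cbar0 cbar_scalar conjc1 -scalar_mx_block. Qed.

Lemma conj_block_inj p q p' q' : conj_block p q = conj_block p' q' -> p = p' /\ q = q'.
Proof. by move=> /eq_block_mx [-> ->]. Qed.

Lemma GJ_split h : GJ_set R n h ->
  exists p q a, h = (conj_block p q, a) /\ SpC R n (conj_block p q).
Proof.
case: h => g a Gg; have E : g = _ := SpC_eq Gg.
exists (ulsubmx g), (ursubmx g), a; rewrite -E; split; [by []|exact: Gg].
Qed.

Lemma conj_app_id a : conj_app 1%:M 0 a = a.
Proof. by rewrite /conj_app mul1mx mul0mx addr0. Qed.

Lemma GJ_group : is_group (GJ_set R n) (@GJ_mul R n) (@GJ_one R n).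
Proof.
split.
- by rewrite /GJ_set /= -conj_block1; apply/SpC_P; rewrite /cadj trmx0 oppr0
    cbar_scalar conjc1 trmx1 conj_block1 mulmx1.
- move=> h h' /GJ_split [p [q [a [-> G]]]] /GJ_split [p' [q' [a' [-> G']]]].
  by rewrite GJ_mulE -conj_block_mul; exact: SpC_mul.
- move=> h h' h'' /GJ_split [p [q [a [-> G]]]] /GJ_split [p' [q' [a' [-> G']]]]
    /GJ_split [p'' [q'' [a'' [-> G'']]]].
  rewrite (GJ_mulE p') (GJ_mulE p q p') !GJ_mulE; apply: (f_equal2 pair).
    by apply: (f_equal2 conj_block); rewrite !cbarE; mx_ring.
  rewrite conj_appD addrA; apply: (f_equal (fun u => u + _ + _)); rewrite -conj_app_mul.
  apply: (f_equal2 (fun u v => conj_app u v a)).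
    by rewrite /cadj !cbarE !trmxE; mx_ring.
  by rewrite /cadj !trmxE !cbarE; mx_ring.
- move=> h /GJ_split [p [q [a [-> G]]]]; rewrite /GJ_one -conj_block1 !GJ_mulE cbar0 cbar_scalar conjc1.
  rewrite !mulmx0 !mul0mx !mulmx1 !mul1mx !addr0 !add0r.
  have -> : conj_app (cadj p) (- q^T) 0 = 0 by rewrite /conj_app cbar0 !mulmx0 addr0.
  have -> : cadj (1%:M : 'M[C]_n) = 1%:M by rewrite /cadj cbar_scalar conjc1 trmx1.
  by rewrite trmx0 oppr0 conj_app_id add0r.
(* With the law alpha'' = g'^-1 alpha + alpha', the inverse of (g, alpha) is (g^-1, -g alpha). *)
move=> h /GJ_split [p [q [a [-> G]]]]; exists (conj_block (cadj p) (- q^T), - conj_app p q a); split.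
- exact: SpC_inv.
- have /SpC_P E := G; rewrite GJ_mulE -conj_block_mul E /GJ_one; apply: (f_equal2 pair) => //.
  by rewrite cadjK !trmxE opprK subrr.
have /SpC_P /mulmx1C E := G; rewrite GJ_mulE -conj_block_mul E /GJ_one; apply: (f_equal2 pair) => //.
have appN u : conj_app (cadj p) (- q^T) (- u) = - conj_app (cadj p) (- q^T) u.
  by rewrite /conj_app !cbarE; mx_ring.
rewrite appN -conj_app_mul.
move: E; rewrite conj_block_mul -conj_block1 => /conj_block_inj [-> ->].
by rewrite conj_app_id addNr.
Qed.

End BlockConjugate.

(** * The ball as an instance of the general construction *)

Section BallModel.
Variables (R : realType) (n : nat).
Local Notation C := R[i].
Implicit Types (W : 'M[C]_n) (a z : 'cV[C]_n).

Definition ball_coeffs : coeffs R := Coeffs 1 0 0 (-1).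
Local Notation kb := ball_coeffs.

Lemma ball_ce : [/\ ce0 kb = 1, ce1 kb = 0 & ce2 kb = -1].
Proof.
cbv beta iota delta [ce0 ce1 ce2 cp1 cp2 cq1 cq2 ball_coeffs].
by rewrite !conjcE; split; ring.
Qed.

Lemma ball_ce2_le0 : ce2 kb <= 0.
Proof. by have [_ _ ->] := ball_ce; rewrite oppr_le0 ler01. Qed.

Lemma ball_Pc a : Pc kb a = a.
Proof. by rewrite PcE scale1r scale0r addr0. Qed.

Lemma ball_Qc a : Qc kb a = - cbar a.
Proof. by rewrite QcE scale0r add0r scaleN1r. Qed.

Lemma ball_Lf W a : Lf kb W a = a - W *m cbar a.
Proof. by rewrite LfE ball_Pc ball_Qc mulmxN. Qed.

Lemma ball_Kf W : Kf kb W = 1%:M - W *m cbar W.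
Proof.
by have [e0 e1 e2] := ball_ce; rewrite KfE e0 e1 e2 conjc0 !scale0r !addr0 scaleN1r.
Qed.

Lemma ball_l1 W : l1 kb W = 1%:M.
Proof. by rewrite l1E scale0r addr0. Qed.

Lemma ball_l2 W : l2 kb W = - W.
Proof. by rewrite l2E scaleN1r raddf0 add0r. Qed.

Lemma ball_dom : dom kb = siegel_ball R n.
Proof. by apply/funext => W; rewrite /dom ball_Kf. Qed.

(** Inverting the factors in (1 - W conj(W)) W = W (1 - conj(W) W). *)
Lemma ball_PfC W : dom kb W -> Pf kb W *m W = W *m cbar (Pf kb W).
Proof.
move=> dW; have uK := dom_unit dW; have uK' : cbar (Kf kb W) \in unitmx by rewrite cbar_unit.
rewrite Pf_inv; apply: (canLR (mulKmx uK)); rewrite mulmxA cbar_inv.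
apply: (canRL (mulmxK uK')).
by rewrite ball_Kf !cbarE conjc1; mx_ring.
Qed.

Lemma ball_Li W z : dom kb W ->
  Li kb W z = invmx (1%:M - W *m cbar W) *m (z + W *m cbar z).
Proof.
move=> dW; rewrite -ball_Kf -Pf_inv Li_l12 ball_l1 ball_l2.
rewrite [in RHS]CmulDr CmulA (ball_PfC dW) cbar_scalar conjc1 mul1mx.
by mx_ring.
Qed.

Lemma fst_cont (U V : normedModType R) : continuous (fst : U * V -> U).
Proof. by move=> x; exact: cvg_fst. Qed.
Lemma snd_cont (U V : normedModType R) : continuous (snd : U * V -> V).
Proof. by move=> x; exact: cvg_snd. Qed.

Lemma id_cont (U : normedModType R) : continuous (id : U -> U).
Proof. by move=> x; exact: cvg_id. Qed.

Definition ball_chart : chart n (ballspace R n).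
Proof.
apply: (@Chart R n (ballspace R n) fst snd id) => //.
- exact: fst_cont.
- exact: snd_cont.
- exact: id_cont.
by case.
Defined.

Lemma ball_zz x : zz ball_chart x = cplx x.1. Proof. exact: zzE. Qed.
Lemma ball_WW x : WW ball_chart x = cplx x.2. Proof. exact: WWE. Qed.
Lemma ball_mk a W : mk ball_chart a W = (reim a, reim W). Proof. by []. Qed.

Lemma ball_setE : ball_set R n = SA kb ball_chart.
Proof. by apply/funext => x; rewrite /SA /= ball_WW ball_dom. Qed.

Lemma ball_tanE : ball_tan R n = ST ball_chart.
Proof. by apply/funext => x; rewrite /ST /= ball_WW. Qed.

Variable k : R.
Local Notation ch := ball_chart.

Lemma ball_PfE x : Pf kb (WW ch x) = invmx (1%:M - cplx x.2 *m cbar (cplx x.2)).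
Proof. by rewrite Pf_inv ball_Kf ball_WW. Qed.

Lemma ball_dz_hor x X : SA kb ch x -> dz_hor kb ch x X = cplx X.1 + cplx X.2 *m
  cbar (invmx (1%:M - cplx x.2 *m cbar (cplx x.2)) *m (cplx x.1 + cplx x.2 *m cbar (cplx x.1))).
Proof.
move=> Ax; have dW : dom kb (WW ch x) := Ax.
rewrite /dz_hor ball_Qc /eta (ball_Li _ dW) CmulNr CoppK.
by rewrite (ball_WW X) (ball_zz X) (ball_WW x) (ball_zz x).
Qed.

Lemma ball_formE x X Y : SA kb ch x ->
  curved_form kb ch (k / 2) x X Y = ball_form k x X Y.
Proof.
move=> Ax; exact: (gform_eq _ (ball_PfE x) (ball_dz_hor X Ax) (ball_WW X) (ball_dz_hor Y Ax) (ball_WW Y)).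
Qed.

Lemma ball_flat_formE x X Y : SA kb ch x ->
  flat_form kb ch (k / 2) x X Y = ball_flat_form k x X Y.
Proof.
move=> Ax; have dW : dom kb (WW ch x) := Ax.
apply: etrans (f_equal (fun u => 'i%C * (_ * _ + u)) (fib_Lf _ _ dW)) _.
by rewrite (ball_zz X) (ball_zz Y) (ball_WW X) (ball_WW Y) ball_PfE.
Qed.

Lemma ball_FC : @FC R n = FCm kb ch.
Proof.
apply/funext => x; rewrite /FC /FCm ball_mk ball_WW ball_zz ball_Lf.
by rewrite cplxK.
Qed.

Lemma ball_FCinv x : SA kb ch x -> FCinv x = FCi kb ch x.
Proof.
move=> Ax; have dW : dom kb (WW ch x) := Ax.
by rewrite /FCinv /FCi ball_mk (ball_Li _ dW) ball_WW ball_zz cplxK.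
Qed.

Definition ball_ct (h : GJ_elt R n) : coeff_transf R n :=
  let p := ulsubmx h.1 in let q := ursubmx h.1 in
  CoeffTransf p q (cbar q) (cbar p) p q h.2.

Lemma ball_ctE p q a : ball_ct (conj_block p q, a) = CoeffTransf p q (cbar q) (cbar p) p q a.
Proof. by rewrite /ball_ct /= block_mxKul block_mxKur. Qed.

Lemma ball_actE h : ball_act h = curved_act kb ch (ball_ct h).
Proof.
apply/funext => x; rewrite /ball_act /curved_act ball_mk ball_WW ball_zz.
rewrite WactE zdenE /zact ndenE ball_Lf /cadj /=.
by rewrite addrA.
Qed.

Lemma ball_flat_actE h : ball_flat_act h = flat_act ch (ball_ct h).
Proof.
apply/funext => x; rewrite /ball_flat_act /flat_act ball_mk ball_WW ball_zz.
by rewrite WactE zdenE /eact /rho /= cbarD.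
Qed.

(** With (e0, e1, e2) = (1, 0, -1) the Hermitian relations are those of U(n,n); all requirements are
    the last two defining relations of the group and their conjugates. *)
Lemma ball_adm h : GJ_set R n h -> admissible kb (ball_ct h).
Proof.
move=> /GJ_split [p [q [a [-> G]]]]; rewrite ball_ctE /admissible.
have [e0 e1 e2] := ball_ce; rewrite e0 e1 e2 conjc0.
have : SpC R n (conj_block p q) := G.
rewrite /SpC /= /conj_block block_mxKul block_mxKur => -[_ h1 h2 h3 h4].
have h3' : p^T *m cbar p - cadj q *m q = 1%:M.
  by have := congr1 (@cbar R n n) h3; rewrite /cadj !cbarE conjc1.
have h4' : cadj p *m q = q^T *m cbar p.
  by have := congr1 (@cbar R n n) h4; rewrite /cadj !cbarE.
rewrite /cadj in h3 h3' h4 h4'.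
split.
- split.
  + by rewrite -h3'.
  + exact: h4.
  by rewrite -h4'.
- have alg (A B D E : 'M[C]_n) : 1 *: A + 0 *: B + 0 *: D + -1 *: E = A - E by mx_ring.
  split; apply: etrans (alg _ _ _ _) _; rewrite cbarK.
  + by rewrite -[LHS]opprB h3' raddfN.
  + by rewrite -h4 subrr raddf0.
  + by rewrite h4' subrr raddf0.
  exact: h3.
move=> b; rewrite /rho /= !ball_Qc !ball_Pc.
have alg (A B A' B' D D' : 'M[C]_n) (u v : 'cV[C]_n) :
   A *m - (B *m v + B' *m u) + A' *m (D *m u + D' *m v)
   = (A' *m D - A *m B') *m u - (A *m B - A' *m D') *m v by mx_ring.
rewrite cbarD !cbarM cbarK; split; rewrite alg.
  by rewrite h4 subrr h3' mul0mx mul1mx add0r.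
by rewrite h3 h4' subrr mul0mx mul1mx subr0.
Qed.

Lemma ball_ct1 : pure_translation (ball_ct (GJ_one R n)) 0.
Proof.
rewrite /GJ_one -conj_block1 ball_ctE /pure_translation /=.
by rewrite cbar0 cbar_scalar conjc1.
Qed.

Lemma ball_ctM h h' : GJ_set R n h -> GJ_set R n h' ->
  let g := ball_ct h in let g' := ball_ct h' in let g'' := ball_ct (GJ_mul h h') in
  [/\ tp g'' = tp g *m tp g' + tq g *m tr g', tq g'' = tp g *m tq g' + tq g *m ts g',
      tr g'' = tr g *m tp g' + ts g *m tr g' & ts g'' = tr g *m tq g' + ts g *m ts g'].
Proof.
move=> /GJ_split [p [q [a [-> _]]]] /GJ_split [p' [q' [a' [-> _]]]]; cbv zeta.
rewrite GJ_mulE !ball_ctE /=; split; [by []|by []| |]; by rewrite !cbarE addrC.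
Qed.

Lemma ball_ctMal h h' : GJ_set R n h -> GJ_set R n h' ->
  let al := tal (ball_ct h) in let g' := ball_ct h' in
  Pc kb (tal (ball_ct (GJ_mul h h'))) = Pc kb (tal g')
     + ((tq g')^T *m Qc kb al + (ts g')^T *m Pc kb al) /\
  Qc kb (tal (ball_ct (GJ_mul h h'))) = Qc kb (tal g')
     + ((tp g')^T *m Qc kb al + (tr g')^T *m Pc kb al).
Proof.
move=> /GJ_split [p [q [a [-> _]]]] /GJ_split [p' [q' [a' [-> _]]]]; cbv zeta.
rewrite GJ_mulE !ball_ctE /= !ball_Pc !ball_Qc /conj_app /cadj; split; first by mx_ring.
by rewrite !cbarE; mx_ring.
Qed.

Lemma ball_ct_translation a : exists2 h, GJ_set R n h & pure_translation (ball_ct h) a.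
Proof.
have [G1 _ _ _ _] := GJ_group R n.
exists (1%:M, a); first exact: G1.
rewrite -conj_block1 ball_ctE /pure_translation /=.
by rewrite cbar0 cbar_scalar conjc1.
Qed.

(** The base point is 0. Take p p^* = (1 - W conj(W))^-1 and q = W conj(p): then q conj(p)^-1 = W,
    and p p^* - q q^* = 1 because W passes across Pf by [ball_PfC]. *)
Lemma ball_base : exists2 W0, dom kb W0 &
  forall W, dom kb W -> exists h, [/\ GJ_set R n h, tal (ball_ct h) = 0 & Wact (ball_ct h) W0 = W].
Proof.
exists 0.
  split; first by rewrite trmx0.
  move=> x x0; rewrite ball_Kf mul0mx subr0 mulmx1 -trace_mx11.
  exact: adj_norm_gt0.
move=> W dW; have [Ws _] := dW; have [p up Pp] := Pf_cholesky dW.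
have PW := ball_PfC dW; have uK := dom_unit dW.
have ucp : cbar p \in unitmx by rewrite cbar_unit.
have PK : Pf kb W - Pf kb W *m W *m cbar W = 1%:M.
  have : Pf kb W *m Kf kb W = 1%:M by rewrite Pf_inv mulVmx.
  by rewrite ball_Kf => <-; mx_ring.
have cPp : cbar p *m p^T = cbar (Pf kb W) by rewrite Pp /cadj !cbarE.
have E0 : p *m cadj p - W *m cbar p *m cadj (W *m cbar p) = 1%:M.
  rewrite /cadj cbarM cbarK trmxM -Pp -[RHS]PK PW CmulA -(CmulA W) cPp.
  by rewrite -cbar_tr -Ws.
have E1 : W *m cbar p *m p^T - p *m (W *m cbar p)^T = 0.
  by rewrite trmxM -Ws CmulA -(CmulA W) cPp -/(cadj p) -Pp PW subrr.
exists (conj_block p (W *m cbar p), 0); split.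
- apply/SpC_P; rewrite conj_block_inv E0 E1 cbar0 cbar_scalar conjc1.
  by rewrite -scalar_mx_block.
- by rewrite ball_ctE.
by rewrite WactE zdenE ball_ctE /= !mulmx0 !add0r (mulmxK ucp).
Qed.

Hypothesis hk : 0 < k.

Lemma ball_c0 : 0 < k / 2. Proof. by rewrite divr_gt0. Qed.

Lemma ball_homogeneous : homogeneous_kahler (SJball n k).
Proof.
rewrite /SJball ball_setE ball_tanE.
apply: (homogeneous_curved ball_c0 ball_ce2_le0 (GJ_group R n) ball_adm ball_ct1 ball_ctM
  ball_ctMal ball_ct_translation ball_base).
  by move=> x X Y Ax _ _; exact: ball_formE.
by move=> h _; exact: ball_actE.
Qed.

Lemma ball_flat_homogeneous : homogeneous_kahler (SJball_flat n k).
Proof.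
rewrite /SJball_flat ball_setE ball_tanE.
apply: (homogeneous_flat ball_c0 ball_ce2_le0 (GJ_group R n) ball_adm ball_ct1 ball_ctM
  ball_ctMal ball_ct_translation ball_base).
  by move=> x X Y Ax _ _; exact: ball_flat_formE.
by move=> h _; exact: ball_flat_actE.
Qed.

Lemma ball_pullback : eq_form (ball_set R n) (ball_tan R n)
  (pullback (@FC R n) (ball_form k)) (ball_flat_form k).
Proof.
rewrite ball_FC ball_setE ball_tanE => x X Y Ax TX TY.
rewrite -(ball_flat_formE X Y Ax) -(FC_pullback (k / 2) Ax TX TY).
by rewrite /pullback (ball_formE _ _ (FCm_SA Ax)).
Qed.

Lemma ball_bij : inverse_bijections (ball_set R n) (ball_set R n) (@FC R n) (@FCinv R n).
Proof.
rewrite ball_FC ball_setE; have [b1 b2 b3 b4] := FC_bij kb ch.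
split; first exact: b1.
- by move=> y Ay; rewrite (ball_FCinv Ay); exact: b2.
- by move=> x Ax; rewrite (ball_FCinv (b1 _ Ax)); exact: b3.
by move=> y Ay; rewrite (ball_FCinv Ay); exact: b4.
Qed.

Lemma ball_equivariant h x : GJ_set R n h -> ball_set R n x ->
  FC (ball_flat_act h x) = ball_act h (FC x).
Proof.
rewrite ball_setE ball_FC ball_flat_actE ball_actE => Gh Ax.
exact: (FCm_act ball_ce2_le0 (ball_adm Gh) Ax).
Qed.

Lemma ball_diffeo : homogeneous_kahler_diffeo (SJball_flat n k) (SJball n k) (@FC R n).
Proof.
split; [exact: ball_flat_homogeneous|exact: ball_homogeneous| |exact: ball_pullback].
by rewrite /= ball_setE ball_FC; exact: FC_diffeo.
Qed.

Lemma ball_flat_invariant : invariant_form (GJ_set R n) (ball_set R n) (ball_tan R n)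
  (@ball_flat_act R n) (ball_flat_form k).
Proof.
by have [_ _ _ [J [_ _ i _]]] := ball_flat_homogeneous; exact: i.
Qed.

Lemma ball_inverses W : siegel_ball R n W ->
  1%:M - W *m cbar W \in unitmx /\
  forall g, SpC R n g -> let p := ulsubmx g in let q := ursubmx g in
    [/\ cbar q *m W + cbar p \in unitmx, W *m cadj q + cadj p \in unitmx
      & (p *m W + q) *m invmx (cbar q *m W + cbar p)
        = invmx (W *m cadj q + cadj p) *m (q^T + W *m p^T)].
Proof.
rewrite -ball_dom => dW; split; first by rewrite -ball_Kf; exact: dom_unit.
move=> g Gg; have adm := @ball_adm (g, 0) Gg.
have uz := zden_unit adm ball_ce2_le0 dW; have un := nden_unit adm ball_ce2_le0 dW.
have e := Wact_left adm ball_ce2_le0 dW.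
rewrite WactE zdenE in e uz; rewrite ndenE in e un.
by split; [exact: uz|exact: un|rewrite (addrC (ursubmx g)^T); exact: e].
Qed.

End BallModel.

(** * The Siegel-Jacobi upper half space *)

Section RealBlocks.
Variables (R : realType) (n : nat).
Local Notation C := R[i].

Lemma rtocD m p (A B : 'M[R]_(m, p)) : rtoc (A + B) = rtoc A + rtoc B.
Proof. exact: (map_mxD (real_complex R)). Qed.
Lemma rtocN m p (A : 'M[R]_(m, p)) : rtoc (- A) = - rtoc A.
Proof. exact: (map_mxN (real_complex R)). Qed.
Lemma rtocM m p q (A : 'M[R]_(m, p)) (B : 'M[R]_(p, q)) : rtoc (A *m B) = rtoc A *m rtoc B.
Proof. exact: (map_mxM (real_complex R)). Qed.
Lemma rtoc_tr m p (A : 'M[R]_(m, p)) : rtoc A^T = (rtoc A)^T.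
Proof. by apply/matrixP => i j; rewrite !mxE. Qed.
Lemma rtoc_scalar m (c : R) : rtoc (c%:M : 'M[R]_m) = (c%:C%C)%:M.
Proof. exact: (map_scalar_mx (real_complex R)). Qed.
Lemma rtoc0 m p : rtoc (0 : 'M[R]_(m, p)) = 0.
Proof. exact: (map_mx0 (real_complex R)). Qed.
Lemma cbar_rtoc m p (A : 'M[R]_(m, p)) : cbar (rtoc A) = rtoc A.
Proof. by apply/matrixP => i j; rewrite !mxE conjc_real. Qed.
Lemma rtoc1 m : rtoc (1%:M : 'M[R]_m) = 1%:M.
Proof. by rewrite rtoc_scalar. Qed.

Lemma SpR_blocks (a b c d : 'M[R]_n) : SpR R n (block_mx a b c d) <->
  [/\ a^T *m d - c^T *m b = 1%:M, a^T *m c = c^T *m a & b^T *m d = d^T *m b].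
Proof.
rewrite /SpR /= /Jsymp tr_block_mx !mulmx_block !(mulmx0, mulmx1, mulmxN, mulNmx, mul0mx, addr0, add0r).
split.
  move=> /eq_block_mx [h1 h2 _ h4]; split.
  - by rewrite -h2 addrC.
  - by apply/eqP; rewrite -subr_eq0 addrC h1.
  by apply/eqP; rewrite -subr_eq0 addrC h4.
move=> [h1 h2 h3]; congr block_mx.
- by rewrite h2 addNr.
- by rewrite addrC.
- by have := congr1 trmx h1; rewrite linearB /= !trmx_mul !trmxK trmx1 => <-; rewrite opprB addrC.
by rewrite h3 addNr.
Qed.

Lemma Jsymp2 : Jsymp R n *m Jsymp R n = - 1%:M.
Proof.
rewrite /Jsymp mulmx_block !(mulmx0, mulmx1, mulmxN, mulNmx, mul0mx, addr0, add0r, oppr0).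
by rewrite [in RHS]scalar_mx_block opp_block_mx oppr0.
Qed.

(** The inverse is -J g^T J, by g^T J g = J and J^2 = -1. *)
Lemma SpR_inv g : SpR R n g -> exists g', [/\ SpR R n g', g *m g' = 1%:M & g' *m g = 1%:M].
Proof.
move=> Gg; have E : g^T *m Jsymp R n *m g = Jsymp R n := Gg.
have L : - (Jsymp R n *m g^T *m Jsymp R n) *m g = 1%:M.
  by rewrite mulNmx -!mulmxA (mulmxA g^T) E Jsymp2 opprK.
have L' := mulmx1C L.
exists (- (Jsymp R n *m g^T *m Jsymp R n)); split=> //.
move: L'; move: (- _) => g' L'; rewrite /SpR /= -E.
by rewrite !mulmxA -trmx_mul L' trmx1 mul1mx -mulmxA L' mulmx1.
Qed.

Lemma GJR_group : is_group (GJR_set R n) (@GJR_mul R n) (@GJR_one R n).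
Proof.
split.
- by rewrite /GJR_set /SpR /= trmx1 mul1mx mulmx1.
- move=> [g l] [g' l'] Gg Gg'; rewrite /GJR_set /SpR /= trmx_mul.
  have E : g^T *m Jsymp R n *m g = Jsymp R n := Gg.
  have E' : g'^T *m Jsymp R n *m g' = Jsymp R n := Gg'.
  by rewrite -[RHS]E' -[in RHS]E !mulmxA.
- by move=> [g l] [g' l'] [g'' l''] _ _ _; rewrite /GJR_mul /= mulmxDl !mulmxA addrA.
- by move=> [g l] _; rewrite /GJR_mul /= mul1mx mul0mx add0r !mulmx1 addr0.
move=> [g l] Gg; have [g' [Gg' gg' g'g]] := SpR_inv Gg.
exists (g', - (l *m g')); rewrite /GJR_mul /= gg' g'g; split=> //.
  by rewrite subrr.
by rewrite mulNmx -mulmxA g'g mulmx1 addNr.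
Qed.

(** For x = y + i w the value x^* r x equals y^T r y + w^T r w: the cross terms cancel by the
    symmetry of r. *)
Lemma posdef_rtoc (r : 'M[R]_n) : r^T = r -> posdefC (rtoc r) <-> posdefR r.
Proof.
move=> rs; split=> H x x0.
  have x0' : rtoc x != 0.
    apply: contraNneq x0 => /matrixP xe; apply/eqP/matrixP => i j.
    by have := xe i j; rewrite !mxE => -[].
  have := H _ x0'; rewrite /cadj cbar_rtoc -rtoc_tr -!rtocM mxE.
  by rewrite ltcR.
have xE : x = rtoc (map_mx (@complex.Re R) x) + 'i%C *: rtoc (map_mx (@complex.Im R) x).
  by rewrite -[LHS]reimK.
move: xE; set y := map_mx _ x; set w := map_mx _ x => xE.
have q0 (u : 'cV[R]_n) : 0 <= (u^T *m r *m u) ord0 ord0.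
  have [->|u0] := eqVneq u 0; first by rewrite mulmx0 mxE.
  exact: ltW (H _ u0).
have -> : cadj x *m rtoc r *m x = rtoc (y^T *m r *m y + w^T *m r *m w).
  have sw : (w^T *m r *m y) = (y^T *m r *m w).
    have tr11 (A : 'M[R]_1) : A^T = A by apply/matrixP => i j; rewrite mxE !ord1.
    by rewrite -[LHS]tr11 !trmx_mul trmxK rs mulmxA.
  rewrite [in LHS]xE /cadj !cbarE !trmxE !cbar_rtoc conj_i -!rtoc_tr.
  have alg (u v : 'M[C]_(1, n)) (A : 'M[C]_n) (s t : 'cV[C]_n) :
    (u + - 'i%C *: v) *m A *m (s + 'i%C *: t) =
    u *m A *m s - ('i%C * 'i%C) *: (v *m A *m t) + 'i%C *: (u *m A *m t - v *m A *m s).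
    by mx_ring.
  by rewrite alg -!rtocM sw subrr scaler0 addr0 ii scaleN1r opprK rtocD.
rewrite mxE ltcR mxE.
have [y0|y0] := eqVneq y 0; last by rewrite ltr_wpDr//; exact: H.
rewrite ltr_wpDl//; apply: H; apply: contraNneq x0 => w0.
by rewrite xE y0 w0 rtoc0 scaler0 addr0.
Qed.

End RealBlocks.

(** If v l1 = 0 then v Kf v^* = -|conj(l2) v^*|^2 <= 0. On the half plane this gives the
    invertibility of conj(v) - i. *)
Lemma l1_unit (R : realType) n (k : coeffs R) (W : 'M[R[i]]_n) : dom k W -> l1 k W \in unitmx.
Proof.
move=> [Ws Wp]; rewrite unitmxE unitfE; apply/negP => /det0P [v v0 vl].
have x0 : cadj v != 0.
  apply: contraNneq v0 => /(congr1 (@cadj R _ _)).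
  by rewrite /cadj cbar_tr cbarK trmxK cbar0 trmx0 => ->.
have := Wp _ x0; rewrite -trace_mx11.
have -> : cadj (cadj v) *m Kf k W *m cadj v =
   - (cadj (cbar (l2 k W) *m cadj v) *m (cbar (l2 k W) *m cadj v)).
  rewrite /cadj cbarM !trmxM !cbar_tr !cbarK !trmxK (l2_tr _ Ws) Kf_l12.
  by rewrite mulmxBr mulmxBl !mulmxA vl !mul0mx sub0r.
by rewrite raddfN /= oppr_gt0 => /lt_geF; rewrite adj_norm_ge0.
Qed.

(** * The upper half space as an instance of the general construction *)

Section UpperModel.
Variables (R : realType) (n : nat).
Local Notation C := R[i].
Implicit Types (v : 'M[C]_n) (a z : 'cV[C]_n).
Local Notation I := ('i%C : C).

Definition upper_coeffs : coeffs R := Coeffs 2^-1 2^-1 (- (I / 2)) (I / 2).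
Local Notation ku := upper_coeffs.

Lemma two_neq0 : 2 != 0 :> C. Proof. by rewrite pnatr_eq0. Qed.

Lemma conj_half : conjc (2^-1 : C) = 2^-1.
Proof. by rewrite fmorphV rmorph_nat. Qed.

Lemma conj_ihalf : conjc (I / 2) = - (I / 2).
Proof. by rewrite conjcM conj_i conj_half mulNr. Qed.

Lemma i_neq0 : I != 0.
Proof. by apply/eqP => i0; have := @ii R; rewrite i0 mul0r => /eqP; rewrite eq_sym oppr_eq0 oner_eq0. Qed.

Lemma inv_2i : (2 * I)^-1 = - (I / 2).
Proof.
have nz : 2 * I != 0 by rewrite mulf_neq0 ?two_neq0 ?i_neq0.
apply: (mulfI nz); rewrite mulfV//.
have -> : 2 * I * - (I / 2) = - (I * I) by field.
by rewrite ii opprK.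
Qed.

Lemma upper_ce : [/\ ce0 ku = 0, ce1 ku = - (I / 2) & ce2 ku = 0].
Proof.
cbv beta iota delta [ce0 ce1 ce2 cp1 cp2 cq1 cq2 upper_coeffs].
rewrite conjcN conj_half conj_ihalf; by split; field.
Qed.

Lemma upper_ce2_le0 : ce2 ku <= 0.
Proof. by have [_ _ ->] := upper_ce. Qed.

Lemma upper_Pc a : Pc ku a = 2^-1 *: (a + cbar a).
Proof. by rewrite PcE CscaleD. Qed.

Lemma upper_Qc a : Qc ku a = - (I / 2) *: (a - cbar a).
Proof. by rewrite QcE /=; mx_ring. Qed.

(** So [Kf] is the entrywise imaginary part of v; being real, it equals its conjugate. *)
Lemma upper_Kf v : Kf ku v = (I / 2) *: (cbar v - v).
Proof.
have [e0 e1 e2] := upper_ce; rewrite KfE e0 e1 e2 conjcN conj_ihalf opprK.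
by rewrite raddf0 scale0r addr0 add0r; mx_ring.
Qed.

Lemma cbar_upper_Kf v : cbar (Kf ku v) = Kf ku v.
Proof. by rewrite upper_Kf !cbarE conj_ihalf; mx_ring. Qed.

Lemma cbar_upper_Pf v : cbar (Pf ku v) = Pf ku v.
Proof. by rewrite Pf_inv cbar_inv cbar_upper_Kf. Qed.

Lemma cbar_upper_Pc a : cbar (Pc ku a) = Pc ku a.
Proof. by rewrite upper_Pc !cbarE conj_half [cbar a + a]addrC. Qed.

Lemma cbar_upper_Qc a : cbar (Qc ku a) = Qc ku a.
Proof. by rewrite upper_Qc !cbarE conjcN conj_ihalf; mx_ring. Qed.

Lemma upper_split a : a = Pc ku a + I *: Qc ku a.
Proof.
have E : 2^-1 + - (I * (I / 2)) = 1 :> C by rewrite mulrA ii; field.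
have E' : 2^-1 + I * (I / 2) = 0 :> C by rewrite mulrA ii; field.
have -> : Pc ku a + I *: Qc ku a = (2^-1 + - (I * (I / 2))) *: a + (2^-1 + I * (I / 2)) *: cbar a.
  by rewrite upper_Pc upper_Qc; mx_ring.
by rewrite E E' scale1r scale0r addr0.
Qed.

Lemma upper_split_uniq a x y : cbar x = x -> cbar y = y -> a = x + I *: y ->
  Pc ku a = x /\ Qc ku a = y.
Proof.
move=> xr yr ->; rewrite upper_Pc upper_Qc !cbarE xr yr conj_i; split.
  have -> : 2^-1 *: (x + I *: y + (x + - I *: y)) = (2^-1 + 2^-1) *: x by mx_ring.
  by rewrite (_ : 2^-1 + 2^-1 = 1) ?scale1r//; field.
have -> : - (I / 2) *: (x + I *: y - (x + - I *: y)) = (- (I * I) * (2^-1 + 2^-1)) *: y by mx_ring.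
by rewrite ii opprK mul1r (_ : 2^-1 + 2^-1 = 1) ?scale1r//; field.
Qed.

Lemma upper_dom : dom ku = siegel_upper R n.
Proof.
apply/funext => v; apply/propext; rewrite /dom upper_Kf.
have KE (s r : 'M[R]_n) : (I / 2) *: (cbar (rtoc s + I *: rtoc r) - (rtoc s + I *: rtoc r)) = rtoc r.
  rewrite !cbarE !cbar_rtoc conj_i.
  have alg (A B : 'M[C]_n) : (I / 2) *: (A + - I *: B - (A + I *: B))
     = (- (I * I) * (2^-1 + 2^-1)) *: B by mx_ring.
  by rewrite alg ii opprK mul1r (_ : 2^-1 + 2^-1 = 1) ?scale1r//; field.
split.
  move=> [vs vp]; exists (reim v).1, (reim v).2; have vE : v = rtoc (reim v).1 + I *: rtoc (reim v).2.
    by rewrite -[LHS]reimK.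
  have rs : (reim v).2^T = (reim v).2.
    by rewrite [in RHS]vs; apply/matrixP => i j; rewrite !mxE.
  split; [exact: vE| |exact: rs|].
    by rewrite [in RHS]vs; apply/matrixP => i j; rewrite !mxE.
  by apply/(posdef_rtoc rs); rewrite -(KE (reim v).1) -vE.
move=> [s [r [-> st rt rp]]]; rewrite KE; split; last exact/posdef_rtoc.
by rewrite trmxD trmxZ -!rtoc_tr st rt.
Qed.

Lemma upper_invE v : dom ku v -> invmx (cbar v - v) = (I / 2) *: Pf ku v.
Proof.
move=> dv; have uK := dom_unit dv; apply: invmx_eq.
by rewrite -scalemxAr scalemxAl -upper_Kf Pf_inv mulmxV.
Qed.

Lemma upper_diff_unit v : dom ku v -> cbar v - v \in unitmx.
Proof.
move=> dv; have uK := dom_unit dv.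
suff : (cbar v - v) *m ((I / 2) *: Pf ku v) = 1%:M by move=> /mulmx1_unit [].
by rewrite -scalemxAr scalemxAl -upper_Kf Pf_inv mulmxV.
Qed.

Lemma upper_l1 v : cbar (l1 ku v) = (I / 2) *: (cbar v - I%:M).
Proof.
rewrite l1E !cbarE conjcN conj_ihalf opprK conj_half.
apply: etrans (_ : _ = (I / 2) *: cbar v + (- (I * I) / 2)%:M) _; last by mx_ring.
by rewrite ii opprK mul1r addrC.
Qed.

Lemma upper_l2 v : l2 ku v = (I / 2) *: (v - I%:M).
Proof.
rewrite l2E.
apply: etrans (_ : _ = (I / 2) *: v + (- (I * I) / 2)%:M) _; last by mx_ring.
by rewrite ii opprK mul1r addrC.
Qed.

Lemma upper_Li v z : dom ku v ->
  Li ku v z = (cbar v - I%:M) *m invmx (cbar v - v) *m z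
     - (v - I%:M) *m invmx (cbar v - v) *m cbar z.
Proof.
move=> dv; rewrite Li_l12 upper_l1 upper_l2 cbar_upper_Pf (upper_invE dv).
have alg (c : C) (A B P : 'M[C]_n) (a b : 'cV[C]_n) :
  (c *: A) *m P *m a - (c *: B) *m P *m b = A *m (c *: P) *m a - B *m (c *: P) *m b.
  by mx_ring.
exact: alg.
Qed.

Lemma upper_Lf v a : Lf ku v a =
  (2 * I)^-1 *: ((v + I%:M) *m a - (v - I%:M) *m cbar a).
Proof.
rewrite LfE inv_2i upper_Pc upper_Qc.
have -> : - (I / 2) *: ((v + I%:M) *m a - (v - I%:M) *m cbar a) =
  (- (I * I) / 2) *: (a + cbar a) + v *m (- (I / 2) *: (a - cbar a)) by mx_ring.
by rewrite ii opprK mul1r.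
Qed.

(** With P and Q the real and imaginary parts of eta, z = P + v Q; subtracting this from its
    conjugate leaves (conj v - v) Q. *)
Lemma upper_Qc_Li v z : dom ku v -> Qc ku (Li ku v z) = invmx (cbar v - v) *m (cbar z - z).
Proof.
move=> dv; have uD := upper_diff_unit dv; have uK := dom_unit dv.
apply: (canRL (mulKmx uD)).
have E := LfK uK z; rewrite LfE in E.
by rewrite -[z in RHS]E cbarD cbarM cbar_upper_Pc cbar_upper_Qc; mx_ring.
Qed.

Lemma upper_l1_unit v : dom ku v -> cbar v - I%:M \in unitmx.
Proof.
move=> dv; have := l1_unit dv; rewrite -cbar_unit upper_l1 unitmxZ //.
by rewrite unitfE mulf_neq0 ?i_neq0// invr_eq0 two_neq0.
Qed.

Definition upper_chart : chart n (upperspace R n).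
Proof.
apply: (@Chart R n (upperspace R n) snd fst (fun u => (u.2, u.1))) => //.
- exact: snd_cont.
- exact: fst_cont.
- exact: swap_continuous.
by case.
Defined.
Local Notation ch := upper_chart.

Lemma upper_zz x : zz ch x = cplx x.2. Proof. exact: zzE. Qed.
Lemma upper_WW x : WW ch x = cplx x.1. Proof. exact: WWE. Qed.
Lemma upper_mk a v : mk ch a v = (reim v, reim a). Proof. by []. Qed.

Lemma upper_setE : upper_set R n = SA ku ch.
Proof. by apply/funext => x; rewrite /SA /= upper_WW upper_dom. Qed.

Lemma upper_tanE : upper_tan R n = ST ch.
Proof. by apply/funext => x; rewrite /ST /= upper_WW. Qed.

Variable k : R.

(** The origin of k/8: H = (i/2) Kf^-1 dv, so Tr(H /\ conj(H)) carries the extra factor (i/2)(-i/2)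
    = 1/4. *)
Lemma upper_c : (k / 2)%:C%C * (I / 2 * - (I / 2)) = (k / 8)%:C%C.
Proof.
have -> : I / 2 * - (I / 2) = - (I * I) / 4 by field.
rewrite ii opprK mul1r -(rmorph_nat (real_complex R) 4) -fmorphV -rmorphM /=.
by congr (_%:C%C); field.
Qed.

Lemma upper_sieg (P : 'M[C]_n) (X Y : 'M[C]_n) : cbar P = P ->
  (k / 8)%:C%C * sieg P X Y =
  (k / 2)%:C%C * (\tr ((I / 2) *: P *m X *m cbar ((I / 2) *: P *m Y))
                  - \tr ((I / 2) *: P *m Y *m cbar ((I / 2) *: P *m X))).
Proof.
move=> Pr; rewrite /sieg !cbarM !cbarZ !Pr conj_ihalf.
have algS (c d u u' : C) : c * (d * u - d * u') = (c * d) * (u - u') by ring.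
have S (U V : 'M[C]_n) : \tr ((I / 2) *: P *m U *m ((- (I / 2)) *: P *m cbar V)) =
   I / 2 * - (I / 2) * \tr (P *m U *m (P *m cbar V)).
  rewrite -mxtraceZ; apply: (f_equal mxtrace).
  have algM (c d : C) (A B D : 'M[C]_n) :
    (c *: A) *m B *m ((d *: A) *m D) = (c * d) *: (A *m B *m (A *m D)) by mx_ring.
  exact: algM.
by rewrite !S algS upper_c.
Qed.

Lemma upper_fib (P : 'M[C]_n) a b : cbar P = P ->
  fib P a b =
  2 / I * (\tr (a^T *m ((I / 2) *: P) *m cbar b) - \tr (b^T *m ((I / 2) *: P) *m cbar a)).
Proof.
move=> Pr; rewrite /fib !Pr.
have alg (u u' : C) : 2 / I * (I / 2 * u - I / 2 * u') = u - u'.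
  by field; rewrite i_neq0.
have F (u v : 'cV[C]_n) : \tr (u^T *m ((I / 2) *: P) *m cbar v) = I / 2 * \tr (u^T *m P *m cbar v).
  by rewrite -scalemxAr -scalemxAl mxtraceZ.
by rewrite !F alg.
Qed.

Lemma upper_formE x X Y : SA ku ch x ->
  curved_form ku ch (k / 8) x X Y = upper_form k x X Y.
Proof.
move=> Ax; have dv : dom ku (WW ch x) := Ax.
have DE : (I / 2) *: Pf ku (WW ch x) = invmx (cbar (cplx x.1) - cplx x.1).
  by rewrite -(upper_invE dv) upper_WW.
have GE Z : dz_hor ku ch x Z = cplx Z.2 -
    cplx Z.1 *m invmx (cbar (cplx x.1) - cplx x.1) *m (cbar (cplx x.2) - cplx x.2).
  by rewrite /dz_hor /eta (upper_Qc_Li _ dv) CmulA (upper_zz Z) (upper_WW Z) (upper_zz x) (upper_WW x).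
have Pr := cbar_upper_Pf (WW ch x).
rewrite /curved_form /frame_form /gform (upper_sieg _ _ Pr) (upper_fib _ _ Pr).
by rewrite DE !GE (upper_WW X) (upper_WW Y).
Qed.

Lemma upper_flat_formE x X Y : SA ku ch x ->
  flat_form ku ch (k / 8) x X Y = upper_flat_form k x X Y.
Proof.
move=> Ax; have dv : dom ku (WW ch x) := Ax.
have DE : (I / 2) *: Pf ku (WW ch x) = invmx (cbar (cplx x.1) - cplx x.1).
  by rewrite -(upper_invE dv) upper_WW.
rewrite /flat_form /frame_form /gform (upper_sieg _ _ (cbar_upper_Pf (WW ch x))).
rewrite [fib _ _ _](fib_Lf _ _ dv).
by rewrite DE (upper_WW X) (upper_WW Y) (upper_zz X) (upper_zz Y).
Qed.

Lemma upper_FC : @FC1 R n = FCm ku ch.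
Proof.
apply/funext => x; rewrite /FC1 /FCm upper_mk upper_WW upper_zz upper_Lf.
by rewrite cplxK.
Qed.

Lemma upper_FCinv x : SA ku ch x -> FC1inv x = FCi ku ch x.
Proof.
move=> Ax; have dv : dom ku (WW ch x) := Ax.
by rewrite /FC1inv /FCi upper_mk (upper_Li _ dv) upper_WW upper_zz cplxK.
Qed.

Definition upper_transf (g : 'M[R]_(n + n)) (alpha : 'cV[C]_n) : coeff_transf R n :=
  let a := rtoc (ulsubmx g) in let b := rtoc (ursubmx g) in
  let c := rtoc (dlsubmx g) in let d := rtoc (drsubmx g) in
  CoeffTransf a b c d (2^-1 *: (a + d + I *: (b - c))) (2^-1 *: (a - d - I *: (b + c))) alpha.

Definition upper_ct (h : GJR_elt R n) : coeff_transf R n :=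
  upper_transf h.1 (GJR_alpha h.2).

Lemma upper_alpha (l : 'rV[R]_(n + n)) :
  Pc ku (GJR_alpha l) = rtoc (GJR_m l) /\ Qc ku (GJR_alpha l) = rtoc (GJR_n l).
Proof. by apply: upper_split_uniq; rewrite ?cbar_rtoc. Qed.

Lemma upper_actE h : upper_act h = curved_act ku ch (upper_ct h).
Proof.
apply/funext => x; rewrite /upper_act /curved_act upper_mk upper_WW upper_zz.
have [PE QE] := upper_alpha h.2.
rewrite WactE zdenE /zact ndenE LfE [tal _]/= PE QE /=.
by rewrite [rtoc (GJR_m _) + _]addrC addrA.
Qed.

Lemma upper_flat_transfE g alpha :
  upper_flat_transf g alpha = flat_act ch (upper_transf g alpha).
Proof.
apply/funext => x; rewrite /upper_flat_transf /flat_act upper_mk upper_WW upper_zz.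
by rewrite WactE zdenE /eact /rho /= cbarD.
Qed.

(** For real blocks and (e0, e1, e2) = (0, -i/2, 0) the Hermitian relations reduce to the symplectic
    ones. *)
Lemma upper_adm g alpha : SpR R n g -> admissible ku (upper_transf g alpha).
Proof.
rewrite -{1}(submxK g) => /SpR_blocks; rewrite /upper_transf.
move: (ulsubmx g) (ursubmx g) (dlsubmx g) (drsubmx g) => a b c d [h1 h2 h3].
have r1 : (rtoc a)^T *m rtoc d - (rtoc c)^T *m rtoc b = 1%:M.
  by rewrite -rtoc1 -h1 rtocD rtocN !rtocM !rtoc_tr.
have r2 : (rtoc a)^T *m rtoc c = (rtoc c)^T *m rtoc a by rewrite -!rtoc_tr -!rtocM h2.
have r3 : (rtoc b)^T *m rtoc d = (rtoc d)^T *m rtoc b by rewrite -!rtoc_tr -!rtocM h3.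
have ra := cbar_rtoc a; have rb := cbar_rtoc b; have rc := cbar_rtoc c; have rd := cbar_rtoc d.
move: (rtoc a) (rtoc b) (rtoc c) (rtoc d) r1 r2 r3 ra rb rc rd => {a b c d h1 h2 h3} a b c d r1 r2 r3 ra rb rc rd.
have r1' : d^T *m a - b^T *m c = 1%:M.
  by have := congr1 trmx r1; rewrite !trmxE.
rewrite /admissible; have [e0 e1 e2] := upper_ce; rewrite e0 e1 e2 conjcN conj_ihalf opprK.
split.
- by split.
- have alg (e : C) (A B D E : 'M[C]_n) :
    0 *: A + e *: B + - e *: D + 0 *: E = e *: (B - D) by mx_ring.
  cbn [tp tq tr ts]; rewrite ra rb rc rd; split; apply: etrans (alg _ _ _ _ _) _.
  + by rewrite r2 subrr scaler0 raddf0.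
  + by rewrite -[_ - _]opprB r1 scalerN scale_scalar_mx mulr1 raddfN.
  + by rewrite r1' scale_scalar_mx mulr1.
  by rewrite r3 subrr scaler0 raddf0.
move=> z.
(* On the pair of imaginary and real parts (Q, P), [rho] is the inverse transpose of g, with blocks
   d, -c, -b, a. *)
have [PE QE] : Pc ku (rho (CoeffTransf a b c d (2^-1 *: (a + d + I *: (b - c)))
     (2^-1 *: (a - d - I *: (b + c))) alpha) z) = a *m Pc ku z - b *m Qc ku z /\
   Qc ku (rho (CoeffTransf a b c d (2^-1 *: (a + d + I *: (b - c)))
     (2^-1 *: (a - d - I *: (b + c))) alpha) z) = d *m Qc ku z - c *m Pc ku z.
  apply: upper_split_uniq.
  - by rewrite !cbarE ra rb cbar_upper_Pc cbar_upper_Qc.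
  - by rewrite !cbarE rd rc cbar_upper_Pc cbar_upper_Qc.
  rewrite /rho /=.
  have zE := upper_split z; have zE' : cbar z = Pc ku z - I *: Qc ku z.
    by rewrite [in LHS]zE !cbarE cbar_upper_Pc cbar_upper_Qc conj_i scaleNr.
  rewrite zE' [in X in _ *m X + _]zE.
  move: (Pc ku z) (Qc ku z) => x y.
  have alg (h : C) :
    h *: (a + d + I *: (b - c)) *m (x + I *: y) + h *: (a - d - I *: (b + c)) *m (x - I *: y)
    = (h + h) *: (a *m x) + ((h + h) * (I * I)) *: (b *m y)
      + ((h + h) * I) *: (d *m y) - ((h + h) * I) *: (c *m x) by mx_ring.
  rewrite alg (_ : 2^-1 + 2^-1 = 1) ?mul1r ?ii ?scale1r ?scaleN1r; last by field.
  by rewrite scalerBr addrA.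
rewrite PE QE [tp _]/= [tq _]/= [tr _]/= [ts _]/=.
have alg (A B A' B' C' D' : 'M[C]_n) (x y : 'cV[C]_n) :
  A *m (B *m y - C' *m x) + A' *m (B' *m x - D' *m y) =
  (A *m B - A' *m D') *m y + (A' *m B' - A *m C') *m x by mx_ring.
by rewrite !alg r1 r2 r3 r1' !subrr !mul0mx !mul1mx addr0 add0r.
Qed.

Lemma upper_transf1 alpha : pure_translation (upper_transf 1%:M alpha) alpha.
Proof.
rewrite /pure_translation /upper_transf /= scalar_mx_block.
by rewrite block_mxKul block_mxKur block_mxKdl block_mxKdr rtoc1 rtoc0.
Qed.

Lemma upper_ct1 : pure_translation (upper_ct (GJR_one R n)) 0.
Proof.
have <- : GJR_alpha (0 : 'rV[R]_(n + n)) = 0.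
  by rewrite /GJR_alpha /GJR_m /GJR_n !linear0 !rtoc0 scaler0 addr0.
exact: upper_transf1.
Qed.

Lemma upper_ctM h h' : GJR_set R n h -> GJR_set R n h' ->
  let g := upper_ct h in let g' := upper_ct h' in let g'' := upper_ct (GJR_mul h h') in
  [/\ tp g'' = tp g *m tp g' + tq g *m tr g', tq g'' = tp g *m tq g' + tq g *m ts g',
      tr g'' = tr g *m tp g' + ts g *m tr g' & ts g'' = tr g *m tq g' + ts g *m ts g'].
Proof.
case: h h' => [g l] [g' l'] _ _; rewrite /upper_ct /upper_transf /GJR_mul /=.
have E : g *m g' = block_mx (ulsubmx g) (ursubmx g) (dlsubmx g) (drsubmx g)
  *m block_mx (ulsubmx g') (ursubmx g') (dlsubmx g') (drsubmx g') by rewrite !submxK.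
rewrite mulmx_block in E.
by rewrite E !(block_mxKul, block_mxKur, block_mxKdl, block_mxKdr) !rtocD !rtocM.
Qed.

Lemma upper_ctMal h h' : GJR_set R n h -> GJR_set R n h' ->
  let al := tal (upper_ct h) in let g' := upper_ct h' in
  Pc ku (tal (upper_ct (GJR_mul h h'))) = Pc ku (tal g')
     + ((tq g')^T *m Qc ku al + (ts g')^T *m Pc ku al) /\
  Qc ku (tal (upper_ct (GJR_mul h h'))) = Qc ku (tal g')
     + ((tp g')^T *m Qc ku al + (tr g')^T *m Pc ku al).
Proof.
case: h h' => [g l] [g' l'] _ _; rewrite /upper_ct /upper_transf /GJR_mul /=.
rewrite !(upper_alpha _).1 !(upper_alpha _).2 -!rtoc_tr -!rtocM -!rtocD /GJR_m /GJR_n.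
have E : l *m g' = row_mx (lsubmx l) (rsubmx l)
  *m block_mx (ulsubmx g') (ursubmx g') (dlsubmx g') (drsubmx g') by rewrite hsubmxK submxK.
rewrite mul_row_block in E.
rewrite !linearD /= E row_mxKl row_mxKr !linearD /= !trmx_mul.
by split; rewrite addrC.
Qed.

Lemma SpR1 : SpR R n 1%:M.
Proof. by have [G1 _ _ _ _] := GJR_group R n. Qed.

Lemma upper_ct_translation a : exists2 h, GJR_set R n h & pure_translation (upper_ct h) a.
Proof.
(* The row is (n, m) with alpha = m + i n, so the imaginary part comes first. *)
pose l := row_mx (map_mx (@complex.Im R) a)^T (map_mx (@complex.Re R) a)^T.
have aE : GJR_alpha l = a.
  by rewrite /GJR_alpha /GJR_m /GJR_n row_mxKl row_mxKr !trmxK -[RHS]reimK.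
exists (1%:M, l); first exact: SpR1.
have := upper_transf1 (GJR_alpha l); rewrite [X in pure_translation _ X]aE; exact.
Qed.

Lemma upper_base : exists2 W0, dom ku W0 &
  forall W, dom ku W -> exists h, [/\ GJR_set R n h, tal (upper_ct h) = 0 & Wact (upper_ct h) W0 = W].
Proof.
exists (I%:M).
  rewrite upper_dom; exists 0, 1%:M; split.
  - by rewrite rtoc0 add0r rtoc1 scale_scalar_mx mulr1.
  - by rewrite trmx0.
  - by rewrite trmx1.
  move=> x x0; rewrite mulmx1; have := @adj_norm_gt0 R _ _ (rtoc x).
  have -> : rtoc x != 0.
    apply: contraNneq x0 => /matrixP xe; apply/eqP/matrixP => i j.
    by have := xe i j; rewrite !mxE => -[].
  move=> /(_ isT); rewrite /cadj cbar_rtoc -rtoc_tr -rtocM trace_mx11 mxE.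
  by rewrite ltcR.
move=> W; rewrite upper_dom => -[s [r [-> st rt rp]]].
have [||||a ra] := @cholesky R (idfun : {rmorphism R -> R}) _ _ n r.
- by [].
- by move=> x x0; exists (Num.sqrt x); rewrite -expr2 sqr_sqrtr// ltW.
- by rewrite rt; apply/matrixP => i j; rewrite mxE.
- by move=> x x0; have := rp x x0; congr (0 < (_^T *m _ *m _) _ _); apply/matrixP => i j; rewrite mxE.
have {}ra : r = a *m a^T.
  by rewrite [LHS]ra; congr (_ *m _^T); apply/matrixP => i j; rewrite mxE.
have ur : r \in unitmx.
  have /posdef_unitmx : posdefC (rtoc r) by apply/posdef_rtoc.
  by rewrite map_unitmx.
have uaT : a^T \in unitmx by move: ur; rewrite ra unitmx_mul => /andP[].
have ua : a \in unitmx by rewrite -unitmx_tr.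
(* With r = a a^T this matrix sends the base point i to (i a + s a^-T) a^T = s + i r. *)
exists (block_mx a (s *m invmx a^T) 0 (invmx a^T), 0); split.
- apply/SpR_blocks; rewrite !trmx0 !mulmx0 !mul0mx subr0; split=> //; first exact: mulmxV.
  by rewrite trmx_mul st mulmxA.
- by rewrite /= /GJR_alpha /GJR_m /GJR_n !linear0 !rtoc0 scaler0 addr0.
have uc : rtoc (invmx a^T) \in unitmx by rewrite map_unitmx unitmx_inv.
rewrite WactE zdenE /= block_mxKul block_mxKur block_mxKdl block_mxKdr.
rewrite rtoc0 Cmul0l add0r; apply: (canLR (mulmxK uc)).
have aE : a = r *m invmx a^T by rewrite ra mulmxK.
by rewrite CmulSr CmulDl CmulZl -!rtocM -aE addrC.
Qed.

Hypothesis hk : 0 < k.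

Lemma upper_c0 : 0 < k / 8. Proof. by rewrite divr_gt0. Qed.

Let adm h (Gh : GJR_set R n h) : admissible ku (upper_ct h) := upper_adm _ Gh.

Lemma upper_homogeneous : homogeneous_kahler (SJupper n k).
Proof.
rewrite /SJupper upper_setE upper_tanE.
apply: (homogeneous_curved upper_c0 upper_ce2_le0 (GJR_group R n) adm upper_ct1 upper_ctM
  upper_ctMal upper_ct_translation upper_base).
  by move=> x X Y Ax _ _; exact: upper_formE.
by move=> h _; exact: upper_actE.
Qed.

Lemma upper_flat_homogeneous : homogeneous_kahler (SJupper_flat n k).
Proof.
rewrite /SJupper_flat upper_setE upper_tanE.
apply: (homogeneous_flat upper_c0 upper_ce2_le0 (GJR_group R n) adm upper_ct1 upper_ctM
  upper_ctMal upper_ct_translation upper_base).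
  by move=> x X Y Ax _ _; exact: upper_flat_formE.
by move=> h _; exact: upper_flat_transfE.
Qed.

Lemma upper_pullback : eq_form (upper_set R n) (upper_tan R n)
  (pullback (@FC1 R n) (upper_form k)) (upper_flat_form k).
Proof.
rewrite upper_FC upper_setE upper_tanE => x X Y Ax TX TY.
rewrite -(upper_flat_formE X Y Ax) -(FC_pullback (k / 8) Ax TX TY).
by rewrite /pullback (upper_formE _ _ (FCm_SA Ax)).
Qed.

Lemma upper_bij : inverse_bijections (upper_set R n) (upper_set R n) (@FC1 R n) (@FC1inv R n).
Proof.
rewrite upper_FC upper_setE; have [b1 b2 b3 b4] := FC_bij ku ch.
split; first exact: b1.
- by move=> y Ay; rewrite (upper_FCinv Ay); exact: b2.
- by move=> x Ax; rewrite (upper_FCinv (b1 _ Ax)); exact: b3.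
by move=> y Ay; rewrite (upper_FCinv Ay); exact: b4.
Qed.

Lemma upper_equivariant h x : GJR_set R n h -> upper_set R n x ->
  FC1 (upper_flat_act h x) = upper_act h (FC1 x).
Proof.
rewrite upper_setE upper_FC upper_actE /upper_flat_act upper_flat_transfE => Gh Ax.
exact: (FCm_act upper_ce2_le0 (adm Gh) Ax).
Qed.

Lemma upper_diffeo : homogeneous_kahler_diffeo (SJupper_flat n k) (SJupper n k) (@FC1 R n).
Proof.
split; [exact: upper_flat_homogeneous|exact: upper_homogeneous| |exact: upper_pullback].
by rewrite /= upper_setE upper_FC; exact: FC_diffeo.
Qed.

Lemma upper_flat_invariant g alpha : SpR R n g ->
  (forall x, upper_set R n x -> upper_set R n (upper_flat_transf g alpha x)) /\
  eq_form (upper_set R n) (upper_tan R n)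
    (pullback (upper_flat_transf g alpha) (upper_flat_form k)) (upper_flat_form k).
Proof.
move=> Gg; have ga := upper_adm alpha Gg; rewrite upper_setE upper_tanE upper_flat_transfE.
have fA x (Ax : SA ku ch x) := flat_act_SA upper_ce2_le0 ga Ax.
split; first exact: fA.
move=> x X Y Ax TX TY; rewrite /pullback -(upper_flat_formE _ _ Ax) -(upper_flat_formE _ _ (fA _ Ax)).
exact: (flat_form_act (k / 8) upper_ce2_le0 ga Ax X Y).
Qed.

(** The factors conj(v) - i and v - i differ by conj(v) - v, so they may be exchanged around (conj v
    - v)^-1; after that each bracketed inverse cancels against its neighbour. *)
Lemma FC1inv_factor x : upper_set R n x ->
  let v := cplx x.1 in let u := cplx x.2 in
  v - I%:M \in unitmx ->
  cplx (FC1inv x).2 =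
    (cbar v - I%:M) *m invmx (cbar v - v) *m (v - I%:M)
    *m (invmx (v - I%:M) *m u - invmx (cbar v - I%:M) *m cbar u).
Proof.
rewrite /upper_set /= -upper_dom => dv; rewrite /FC1inv /= reimK => uv.
have ucv := upper_l1_unit dv; have uD := upper_diff_unit dv.
move: (cplx x.1) (cplx x.2) dv uv ucv uD => v u dv uv ucv uD.
have alg (A B E : 'M[C]_n) : E \in unitmx -> B = A + E ->
    B *m invmx E *m A = A *m invmx E *m B.
  by move=> uE ->; rewrite !(mulmxDl, mulmxDr) mulmxV// mul1mx -!mulmxA mulVmx// mulmx1.
have comm : (cbar v - I%:M) *m invmx (cbar v - v) *m (v - I%:M) =
            (v - I%:M) *m invmx (cbar v - v) *m (cbar v - I%:M).
  by apply: alg => //; rewrite addrAC addrCA subrr addr0.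
by rewrite mulmxBr !mulmxA (mulmxK uv) comm (mulmxK ucv).
Qed.

Lemma upper_inverses v : siegel_upper R n v ->
  [/\ cbar v - v \in unitmx, cbar v - I%:M \in unitmx
    & forall g : 'M[R]_(n + n), SpR R n g ->
      let a := rtoc (ulsubmx g) in let b := rtoc (ursubmx g) in
      let c := rtoc (dlsubmx g) in let d := rtoc (drsubmx g) in
      [/\ c *m v + d \in unitmx, v *m c^T + d^T \in unitmx
        & (a *m v + b) *m invmx (c *m v + d)
          = invmx (v *m c^T + d^T) *m (v *m a^T + b^T)]].
Proof.
rewrite -upper_dom => dv; split; [exact: upper_diff_unit|exact: upper_l1_unit|].
move=> g Gg; have ga := upper_adm 0 Gg.
have uz := zden_unit ga upper_ce2_le0 dv; have un := nden_unit ga upper_ce2_le0 dv.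
have e := Wact_left ga upper_ce2_le0 dv.
rewrite WactE zdenE in e uz; rewrite ndenE in e un.
by split; [exact: uz|exact: un|exact: e].
Qed.

End UpperModel.

Theorem proposition4 (R : realType) (n : nat) (k : R)
    (hn : (0 < n)%N) (hk : 0 < k) :
  (* (i) *)
  ([/\ homogeneous_kahler_diffeo (SJball_flat n k) (SJball n k) (@FC R n),
       inverse_bijections (ball_set R n) (ball_set R n) (@FC R n) (@FCinv R n),
       eq_form (ball_set R n) (ball_tan R n)
         (pullback (@FC R n) (ball_form k)) (ball_flat_form k),
       (forall h x, GJ_set R n h -> ball_set R n x ->
          FC (ball_flat_act h x) = ball_act h (FC x))
     & invariant_form (GJ_set R n) (ball_set R n) (ball_tan R n)
         (@ball_flat_act R n) (ball_flat_form k)]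
   (* the matrix inverses are genuine, and the two expressions of W_1 agree *)
   /\ (forall W : 'M[R[i]]_n, siegel_ball R n W ->
        1%:M - W *m cbar W \in unitmx /\
        forall g, SpC R n g -> let p := ulsubmx g in let q := ursubmx g in
          [/\ cbar q *m W + cbar p \in unitmx, W *m cadj q + cadj p \in unitmx
            & (p *m W + q) *m invmx (cbar q *m W + cbar p)
              = invmx (W *m cadj q + cadj p) *m (q^T + W *m p^T)]))
  (* (ii) *)
  /\
  ([/\ homogeneous_kahler_diffeo (SJupper_flat n k) (SJupper n k) (@FC1 R n),
       inverse_bijections (upper_set R n) (upper_set R n)
         (@FC1 R n) (@FC1inv R n)
       /\ (forall x : upperspace R n, upper_set R n x ->
            let v := cplx x.1 in let u := cplx x.2 in
            v - 'i%C%:M \in unitmx ->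
            cplx (FC1inv x).2 =
              (cbar v - 'i%C%:M) *m invmx (cbar v - v) *m (v - 'i%C%:M)
              *m (invmx (v - 'i%C%:M) *m u
                  - invmx (cbar v - 'i%C%:M) *m cbar u)),
       eq_form (upper_set R n) (upper_tan R n)
         (pullback (@FC1 R n) (upper_form k)) (upper_flat_form k),
       (forall h x, GJR_set R n h -> upper_set R n x ->
          FC1 (upper_flat_act h x) = upper_act h (FC1 x))
     & forall (g : 'M[R]_(n + n)) (alpha : 'cV[R[i]]_n), SpR R n g ->
         (forall x, upper_set R n x ->
            upper_set R n (upper_flat_transf g alpha x)) /\
         eq_form (upper_set R n) (upper_tan R n)
           (pullback (upper_flat_transf g alpha) (upper_flat_form k))
           (upper_flat_form k)]
   (* the matrix inverses are genuine, and the two expressions of v_1 agree *)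
   /\ (forall v : 'M[R[i]]_n, siegel_upper R n v ->
        [/\ cbar v - v \in unitmx, cbar v - 'i%C%:M \in unitmx
          & forall g : 'M[R]_(n + n), SpR R n g ->
            let a := rtoc (ulsubmx g) in let b := rtoc (ursubmx g) in
            let c := rtoc (dlsubmx g) in let d := rtoc (drsubmx g) in
            [/\ c *m v + d \in unitmx, v *m c^T + d^T \in unitmx
              & (a *m v + b) *m invmx (c *m v + d)
                = invmx (v *m c^T + d^T) *m (v *m a^T + b^T)]])).
Proof.
split; split.
- split; [exact: ball_diffeo|exact: ball_bij|exact: ball_pullback| |].
    by move=> h x; exact: ball_equivariant.
  exact: ball_flat_invariant.
- by move=> W; exact: ball_inverses.
- split; [exact: upper_diffeo| |exact: upper_pullback| |].
  + by split; [exact: upper_bij|move=> x; exact: FC1inv_factor].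
  + by move=> h x; exact: upper_equivariant.
  by move=> g alpha; exact: upper_flat_invariant.
by move=> v; exact: upper_inverses.
Qed.
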